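(* Let $r>0$ be an odd integer. Then there are infinitely many distinct fields $K\in\mathfrak{F}$ whose ideal class group contains a relative ideal class of order $r$.
   Context: For an integer $n\notin\{0,\pm3\}$ let $f_n(X)=X^4-nX^3-6X^2+nX+1$ and $K_n=\mathbb{Q}(\rho)$ with $\rho$ a root of $f_n$; $K_n/\mathbb{Q}$ is a real cyclic quartic extension (M.-N. Gras). Let $\mathfrak{F}=\{K_n: n\in\mathbb{Z}\setminus\{0,\pm3\}\}$. For $K\in\mathfrak{F}$ let $k_2=\mathbb{Q}(\sqrt{n^2+16})$ be its unique quadratic subfield. The ideal class $[J]$ of a fractional ideal $J$ of $K$ is called a relative ideal class if $N_{K|k_2}(J)$ is a principal ideal of $k_2$. *)

(* Defs.v *)
From mathcomp Require Import all_boot all_order all_algebra all_field.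
From mathcomp Require Import all_classical.

Set Implicit Arguments.
Unset Strict Implicit.
Unset Printing Implicit Defensive.

Import Order.TTheory GRing.Theory Num.Theory.
Local Open Scope classical_set_scope.
Local Open Scope ring_scope.

(* Number fields are subsets of algC, the field of complex algebraic numbers,
   so that "distinct fields" means distinct subsets.  In the definitions below,
   the parameters K and k stand for such subfields, with k contained in K
   whenever both occur. *)

Definition adjoinQ (rho : algC) : set algC :=
  [set x | exists p q : {poly rat},
     (map_poly ratr q).[rho] != 0 /\
     x = (map_poly ratr p).[rho] / (map_poly ratr q).[rho]].

Definition gras_poly (n : int) : {poly int} :=
  'X^4 - n *: 'X^3 - 6 *: 'X^2 + n *: 'X + 1.

Definition gras_field (n : int) (K : set algC) : Prop :=
  n \notin [:: 0; 3; -3] /\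
  exists2 rho : algC, root (map_poly intr (gras_poly n)) rho & K = adjoinQ rho.

Definition gras_family : set (set algC) :=
  [set K | exists n : int, gras_field n K].

(* A given field may be K_n for several n; its quadratic subfield does not
   depend on the choice of n. *)
Definition quadratic_subfield (K k : set algC) : Prop :=
  exists2 n : int, gras_field n K & k = adjoinQ (sqrtC (n%:~R ^+ 2 + 16)).

Definition int_ring (K : set algC) : set algC := K `&` [set x | x \in Aint].

(* Fractional ideals are nonzero. *)
Definition fractional_ideal (K J : set algC) : Prop :=
  [/\ J `<=` K,
      (exists2 x, J x & x != 0),
      (forall x y, J x -> J y -> J (x + y)),
      (forall c x, int_ring K c -> J x -> J (c * x)) &
      exists d, [/\ int_ring K d, d != 0 & forall x, J x -> int_ring K (d * x)]].

Definition scale_set (a : algC) (J : set algC) : set algC :=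
  [set a * x | x in J].

Definition principal_ideal (K J : set algC) : Prop :=
  exists a, [/\ K a, a != 0 & J = scale_set a (int_ring K)].

Definition int_span (K G : set algC) : set algC :=
  [set x | exists m (c g : 'I_m -> algC),
     [/\ forall i, int_ring K (c i), forall i, G (g i)
       & x = \sum_(i < m) c i * g i]].

Definition ideal_mul (K I J : set algC) : set algC :=
  int_span K [set x * y | x in I & y in J].

Definition ideal_class (K J : set algC) : set (set algC) :=
  [set I | exists a, [/\ K a, a != 0 & I = scale_set a J]].

Definition class_group (K : set algC) : set (set (set algC)) :=
  [set C | exists2 J, fractional_ideal K J & C = ideal_class K J].

(* Since (aI)(bJ) = ab(IJ), the products of representatives of two classes
   already form a full class, namely [I][J] = [IJ]. *)
Definition class_mul (K : set algC) (C D : set (set algC)) : set (set algC) :=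
  [set ideal_mul K I J | I in C & J in D].

Definition class_one (K : set algC) : set (set algC) :=
  ideal_class K (int_ring K).

Definition class_exp (K : set algC) (C : set (set algC)) (m : nat) :
    set (set algC) :=
  iter m (class_mul K C) (class_one K).

Definition class_has_order (K : set algC) (C : set (set algC)) (r : nat) : Prop :=
  [/\ (0 < r)%N, class_exp K C r = class_one K
    & forall m, (0 < m < r)%N -> class_exp K C m <> class_one K].

Definition is_basis (K k : set algC) (m : nat) (b : 'rV[algC]_m) : Prop :=
  [/\ forall i, K (b 0 i),
      forall x, K x -> exists2 c : 'I_m -> algC,
        forall i, k (c i) & x = \sum_(i < m) c i * b 0 i
    & forall c : 'I_m -> algC, (forall i, k (c i)) ->
        \sum_(i < m) c i * b 0 i = 0 -> forall i, c i = 0].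

(* c is the determinant of multiplication by a on the k-vector space K; the
   matrix M must have its entries in k, as b is a basis over k only. *)
Definition is_norm (K k : set algC) (a c : algC) : Prop :=
  exists m (b : 'rV[algC]_m) (M : 'M[algC]_m),
    [/\ is_basis K k b, forall i j, k (M i j), a *: b = b *m M & c = \det M].

(* The relative norm of an ideal is the ideal of k generated by the norms of
   its elements. *)
Definition ideal_norm (K k J : set algC) : set algC :=
  int_span k [set c | exists2 a, J a & is_norm K k a c].

Definition relative_class (K k : set algC) (C : set (set algC)) : Prop :=
  exists J, [/\ fractional_ideal K J, C = ideal_class K J
              & principal_ideal k (ideal_norm K k J)].

(* Main.v *)
(** Write [sigma] for the generator [rho |-> (rho - 1) / (rho + 1)] of the Galois
    group of [K = Q(rho)].  If [-4 z^r = f_n(v)] with [v] odd, then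
    [alpha = (v - rho) / (rho + 1)] is integral of norm [z^r]; when
    [z = 1 mod v^2 + 1], [alpha] is comaximal with its other conjugates, so
    [beta = alpha / sigma^2 alpha] is the [r]-th power of an ideal [I], whose norm
    to the quadratic subfield is [(1)].  If the class of [I] had a smaller order,
    then for some prime [p | r] and some [k] prime to [p], [beta^k] would be a
    unit of relative norm [1] times a [p]-th power.  Such units have rank at most
    [2], so this would make [rho], [sigma rho] and [beta] dependent modulo
    [p]-th powers; that is excluded by choosing [v] and [z] so that for every
    candidate relation there is a prime [q | z] for which its residue at the
    degree one prime [(q, rho - v)] is not a [p]-th power.  Finally, keeping a
    prime [l] that exactly divides [n^2 + 16] but is prime to the discriminants
    [n'^2 + 16] already used gives infinitely many fields. *)

Require Import Defs.
From HB Require Import structures.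
From mathcomp Require Import all_boot all_order all_algebra all_field.
From mathcomp Require Import all_classical.
From mathcomp Require Import zify ring.
Set Implicit Arguments.
Unset Strict Implicit.
Unset Printing Implicit Defensive.
Import Order.TTheory GRing.Theory Num.Theory.
Local Open Scope ring_scope.

(** * Primes modulo which an integer is not a [p]-th power *)

(** Integrality of [n] asks that [v^2 - 1] divide [4 (z^r - 1)] and that [v] divide [4 z^r + 1]. The
    former follows from [z = 1] modulo [v^4 - 1]; the latter calls for an [r]-th root of [-1/4]
    modulo [v], which the shape [v = s^r - 2 w^r] supplies. The obstructing primes [q] divide [w],
    so [v = s^r] modulo [q]: the residue of [rho] at [(q, rho - v)] is then a [p]-th power for every
    [p | r], and no relation in [rho] alone can be excluded there. Such a relation is conjugated
    into one in [sigma rho], whose residue [(v - 1) / (v + 1)] can be controlled. The rank bound on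
    relative units comes from a count: the monomials in three of them outnumber the boxes that their
    sizes can occupy. *)

Lemma modn1_prime_factors (d n : nat) :
  (0 < n)%N -> (forall q, prime q -> q %| n -> q = 1 %[mod d])%N ->
  (n = 1 %[mod d])%N.
Proof.
elim/ltn_ind: n => n IHn n_gt0 n_fact.
have [n_le1 | n_gt1] := leqP n 1; first by congr (_ %% _)%N; lia.
have [/dvdnP[m def_n] q_pr] := (pdiv_dvd n, pdiv_prime n_gt1).
have m_gt0 : (0 < m)%N by move: n_gt0; rewrite def_n muln_gt0 => /andP[].
have lt_mn : (m < n)%N.
  by rewrite [X in (_ < X)%N]def_n ltn_Pmulr // prime_gt1.
rewrite {1}def_n -modnMm (IHn m) // => [|q q_pr' q_m]; last first.
  by apply: n_fact; rewrite // def_n dvdn_mulr.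
by rewrite (n_fact (pdiv n)) ?pdiv_dvd // modnMm.
Qed.

(* If [v_p(c) = 1] then [1 + c + ... + c^(p-1)] is not [1] mod [p^2], so it has
   a prime factor [q] with [p^2] not dividing [q - 1]; as [c] has order [p] mod
   [q], it is not a [p]-th power.  Some power of [a], times a [p]-th power, is
   such a [c]. *)
Lemma exists_non_pth_power (p a M : nat) :
  prime p -> odd p -> (0 < a)%N -> (0 < M)%N -> ~~ (p %| logn p a)%N ->
  exists q, [/\ prime q, coprime q M & forall t : 'F_q, t ^+ p != a%:R].
Proof.
move=> p_pr p_odd a_gt0 M_gt0 p'v.
have p_gt1 := prime_gt1 p_pr; have p_gt0 := prime_gt0 p_pr.
have v_gt0 : (0 < logn p a)%N by case: (logn p a) p'v => //; rewrite dvdn0.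
case: (egcdnP p v_gt0) => e j.
have -> : gcdn (logn p a) p = 1%N.
  by apply/eqP; rewrite -/(coprime _ _) coprime_sym prime_coprime.
move=> def_e _.
have [a1 co_pa1 def_a] := pfactor_coprime p_pr a_gt0.
have [M1 co_pM1 def_M] := pfactor_coprime p_pr M_gt0.
(* Here [e] inverts the valuation of [a] modulo [p], so [a^e] is [p a1^e] times the [p]-th power
   [p^(j p)]. The factor [M1^p] is itself a [p]-th power and keeps the prime factors of [Phi] away
   from [M]. *)
pose c := (p * (a1 ^ e * M1 ^ p))%N; pose Phi := (\sum_(i < p) c ^ i)%N.
have a1_gt0 : (0 < a1)%N by move: a_gt0; rewrite def_a muln_gt0 => /andP[].
have M1_gt0 : (0 < M1)%N by move: M_gt0; rewrite def_M muln_gt0 => /andP[].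
have c_gt0 : (0 < c)%N by rewrite !muln_gt0 !expn_gt0 a1_gt0 M1_gt0 p_gt0.
have def_Phi : Phi = (1 + c + c ^ 2 * \sum_(i < p.-2) c ^ i)%N.
  have geom m : (\sum_(i < m.+2) c ^ i = 1 + c + c ^ 2 * \sum_(i < m) c ^ i)%N.
    rewrite !big_ord_recl /= expn0 expn1 big_distrr /= addnA; congr addn.
    by apply: eq_bigr => i _; rewrite -expnD.
  by have := geom p.-2; rewrite (_ : p.-2.+2 = p) //; lia.
have Phi_gt0 : (0 < Phi)%N by rewrite def_Phi.
have co_Phi_c q : prime q -> (q %| Phi)%N -> ~~ (q %| c)%N.
  move=> q_pr q_Phi; apply/negP=> q_c; move: q_Phi.
  rewrite def_Phi -addnA dvdn_addl; last by apply: dvdn_add q_c (dvdn_mulr _ (dvdn_exp _ q_c)).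
  rewrite dvdn1.
  by move/eqP=> q1; rewrite q1 in q_pr.
have Phi_modp2 : (Phi <> 1 %[mod p ^ 2])%N.
  rewrite def_Phi => /eqP; rewrite -addnA -{2}[1%N]addn0 eqn_modDl mod0n -/(dvdn _ _).
  rewrite dvdn_addl; last by rewrite dvdn_mulr // /c expnMn dvdn_mulr.
  rewrite /c expnS expn1 dvdn_pmul2l // Euclid_dvdM // !Euclid_dvdX //.
  by rewrite !(prime_coprime _ p_pr) in co_pa1 co_pM1; rewrite (negPf co_pa1) (negPf co_pM1).
have [q [q_pr q_Phi q_modp2]] :
    exists q, [/\ prime q, q %| Phi & q <> 1 %[mod p ^ 2]]%N.
  have [/allP allq|/allPn[q]] :=
      boolP (all (fun q => q == 1 %[mod p ^ 2])%N (primes Phi)).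
    case: Phi_modp2; apply: modn1_prime_factors => // q q_pr q_Phi.
    by apply/eqP/allq; rewrite mem_primes q_pr Phi_gt0.
  by rewrite mem_primes => /and3P[q_pr _ q_Phi] /eqP q1; exists q.
have q'c := co_Phi_c q q_pr q_Phi.
have q'p : ~~ (q %| p)%N by apply: contra q'c => /dvdn_mulr->.
have q'a1 : ~~ (q %| a1 ^ e)%N.
  by apply: contra q'c => ?; rewrite dvdn_mull // dvdn_mulr.
have q'M1 : ~~ (q %| M1)%N.
  apply: contra q'c => ?; rewrite dvdn_mull // dvdn_mull // dvdn_exp //.
exists q; split=> //.
  rewrite prime_coprime // def_M Euclid_dvdM // Euclid_dvdX // negb_or q'M1.
  by rewrite negb_and q'p.
move=> t; apply/eqP=> ta.
have nat0 m : (m%:R == 0 :> 'F_q) = (q %| m)%N.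
  by rewrite (dvdn_pcharf (pchar_Fp q_pr)).
pose C : 'F_q := c%:R.
have p0 : p%:R != 0 :> 'F_q by rewrite nat0.
have M0 : M1%:R != 0 :> 'F_q by rewrite nat0.
have C0 : C != 0 by rewrite nat0.
have C_p : C ^+ p = 1.
  apply/eqP; rewrite -subr_eq0 subrX1.
  have -> : \sum_(i < p) C ^+ i = Phi%:R.
    by rewrite natr_sum; apply: eq_bigr => i _; rewrite natrX.
  by move: q_Phi; rewrite -nat0 => /eqP->; rewrite mulr0.
have C1 : C != 1.
  apply/eqP=> C1; move: q_Phi; rewrite -nat0 natr_sum => /eqP.
  under eq_bigr => i _ do rewrite natrX -/C C1 expr1n.
  by rewrite sumr_const card_ord => /eqP; apply/negP.
pose u : 'F_q := t ^+ e * M1%:R / p%:R ^+ j.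
have def_C : C = u ^+ p.
  rewrite /u !exprMn exprVn -exprM mulnC exprM ta /C /c natrM natrM !natrX.
  have ->: a%:R ^+ e = p%:R * p%:R ^+ (j * p) * a1%:R ^+ e :> 'F_q.
    rewrite -exprS -!natrX -natrM; congr (_%:R); rewrite {1}def_a expnMn -expnM.
    by rewrite [(logn p a * e)%N]mulnC def_e addn1 mulnC.
  by rewrite -exprM; field; rewrite expf_neq0.
have u0 : u != 0 by apply: contraNneq C0 => u0; rewrite def_C u0 expr0n gtn_eqF.
have p2_gt0 : (0 < p ^ 2)%N by rewrite expn_gt0 p_gt0.
have u_p2 : u ^+ (p ^ 2) = 1 by rewrite expnS expn1 exprM -def_C.
have [m prim_u] := prim_order_exists p2_gt0 u_p2.
case/(dvdn_pfactor _ _ p_pr) => k le_k2 def_m.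
have k2 : k = 2%N.
  apply/eqP; rewrite eqn_leq le_k2 /= ltnNge; apply/negP=> le_k1.
  case/eqP: C1; rewrite def_C; apply/eqP.
  by rewrite -(prim_order_dvd prim_u) def_m -{2}[p]expn1 dvdn_exp2l.
case: q_modp2; apply/eqP; rewrite eqn_mod_dvd ?prime_gt0 // -k2 -def_m.
rewrite (prim_order_dvd prim_u) subn1; apply/eqP/(mulfI u0).
by rewrite -exprS prednK ?prime_gt0 // mulr1; have := expf_card u; rewrite card_Fp.
Qed.

(** With [X = 1 + p y] the sum is [p + 'C(p, 2) p y] modulo [p^2], and the odd prime [p] divides
    ['C(p, 2)]. *)
Lemma logn_sum_exp_prime (p X : nat) :
  prime p -> odd p -> (X = 1 %[mod p])%N -> logn p (\sum_(i < p) X ^ i) = 1%N.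
Proof.
move=> p_pr p_odd X1; have p_gt0 := prime_gt0 p_pr.
have [y def_X] : exists y, (X = 1 + p * y)%N \/ (X = 0)%N /\ (p = 1)%N.
  have [X0|X_gt0] := posnP X.
    by exists 0%N; right; split=> //; move: X1; rewrite X0 mod0n modn_small // prime_gt1.
  move/eqP: X1; rewrite eqn_mod_dvd // => /dvdnP[y def_y].
  by exists y; left; rewrite mulnC -def_y subnKC.
case: def_X => [def_X|[_ p1]]; last by rewrite p1 in p_pr.
have sumX n : exists k, (\sum_(i < n) X ^ i = n + 'C(n, 2) * (p * y) + p ^ 2 * k)%N.
  have expX i : exists k, (X ^ i = 1 + i * (p * y) + p ^ 2 * k)%N.
    elim: i => [|i [k IHk]]; first by exists 0%N; rewrite expn0 mul0n muln0.
    by exists (k + k * (p * y) + i * y ^ 2)%N; rewrite expnS IHk def_X; ring.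
  elim: n => [|n [k IHk]]; first by exists 0%N; rewrite big_ord0 muln0.
  have [k1 def_k1] := expX n; exists (k + k1)%N.
  by rewrite big_ord_recr /= IHk def_k1 binS bin1; ring.
have [k ->] := sumX p.
have /dvdnP[h ->] : (p %| 'C(p, 2))%N.
  by apply: prime_dvd_bin => //; have := odd_prime_gt2 p_odd p_pr; lia.
have -> : (p + h * p * (p * y) + p ^ 2 * k = p * (1 + p * (h * y + k)))%N by ring.
rewrite lognM // logn_prime // eqxx lognE p_pr /=.
by rewrite dvdn_addl ?dvdn_mulr // dvdn1 gtn_eqF ?prime_gt1.
Qed.

(** Lifting the exponent: each factor [p] of [m] adds one to the valuation, while the part [m1]
    prime to [p] contributes a geometric sum congruent to [m1] modulo [p]. *)
Lemma logn_pred_exp (p X m : nat) :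
    prime p -> odd p -> (1 < X)%N -> (X = 1 %[mod p])%N -> (0 < m)%N ->
  logn p (X ^ m).-1 = (logn p X.-1 + logn p m)%N.
Proof.
move=> p_pr p_odd X_gt1 X1 m_gt0.
have [m1 co_pm1 def_m] := pfactor_coprime p_pr m_gt0.
have expX n : (X ^ n = 1 %[mod p])%N by rewrite -modnXm X1 modnXm exp1n.
have expX_gt1 n : (0 < n)%N -> (1 < X ^ n)%N by case: n => // n _; rewrite -(exp1n n.+1) ltn_exp2r.
have pred_gt0 n : (1 < n -> 0 < n.-1)%N by case: n => [|[]].
have sum_gt0 Y n : (0 < n)%N -> (0 < \sum_(i < n) Y ^ i)%N.
  by case: n => // n _; rewrite big_ord_recl.
have m1_gt0 : (0 < m1)%N by move: m_gt0; rewrite def_m muln_gt0 => /andP[].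
rewrite [in LHS]def_m mulnC expnM predn_exp lognM ?sum_gt0 //; last first.
  by rewrite pred_gt0 ?expX_gt1 // expn_gt0 prime_gt0.
rewrite [X in (_ + X)%N](_ : _ = 0%N) ?addn0.
  elim: (logn p m) => [|k IHk]; first by rewrite expn1 addn0.
  rewrite expnSr expnM predn_exp lognM ?sum_gt0 ?(prime_gt0 p_pr) //; last first.
    by rewrite pred_gt0 ?expX_gt1 // expn_gt0 prime_gt0.
  by rewrite IHk logn_sum_exp_prime // -addnA addn1.
rewrite logn_coprime // prime_coprime //.
have -> : (p %| \sum_(i < m1) (X ^ p ^ logn p m) ^ i)%N = (p %| m1)%N.
  rewrite /dvdn; congr (_ == _); rewrite -modn_summ.
  under eq_bigr => i _ do rewrite -expnM expX.
  by rewrite modn_summ sum1_card card_ord.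
by rewrite -prime_coprime.
Qed.

(* Up to [p]-th powers, the quotient of the two sides is the residue of
   [rho^a (sigma rho)^b beta^e] at the prime [(q, rho - V)]. *)
Definition power_obstruction (p a b e q : nat) (V : 'F_q) : Prop :=
  forall t : 'F_q, 4 ^+ e * V ^+ (a + e) * (V - 1) ^+ (b + 2 * e)
    != t ^+ p * ((V + 1) ^+ b * (- (V ^+ 2 + 1) ^+ 4) ^+ e).

(* Take [s = +-(1 + p^f)] with [f] in [{1, 2}] such that the [p]-adic valuation
   [f + v_p(r)] of [(1 + p^f)^r - 1] is prime to [p], the sign being [-] if and
   only if [b > 0]; then [exists_non_pth_power] applies over the integers. *)
Lemma exists_power_obstruction (p r a b e M : nat) :
    prime p -> odd p -> odd r -> (p %| r)%N -> (b < p)%N -> (e < p)%N ->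
    (0 < b)%N || (0 < e)%N -> (0 < M)%N ->
  exists q s, [/\ prime q, coprime q M &
    let V : 'F_q := s%:R ^+ r in
    [/\ 2 != 0 :> 'F_q, V != 0, V ^+ 4 != 1 & power_obstruction p a b e V]].
Proof.
move=> p_pr p_odd r_odd p_r lt_bp lt_ep be_gt0 M_gt0.
have p_gt2 := odd_prime_gt2 p_odd p_pr.
have r_gt0 : (0 < r)%N by case: r r_odd {p_r}.
have [f f_gt0 p'f] : exists2 f, (0 < f)%N & ~~ (p %| f + logn p r)%N.
  have [p_r1|p'r1] := boolP (p %| 1 + logn p r)%N; last by exists 1%N.
  exists 2%N => //; rewrite -[2%N]/(1 + 1)%N -addnA dvdn_addl // dvdn1.
  by rewrite gtn_eqF // prime_gt1.
have [X def_X] : exists X, X = (1 + p ^ f)%N by eexists.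
have [V0 def_V0] : exists V0, V0 = (X ^ r)%N by eexists.
have X_gt1 : (1 < X)%N by rewrite def_X -addn1 leq_add2l expn_gt0 prime_gt0.
have X1 : (X = 1 %[mod p])%N.
  by apply/eqP; rewrite def_X eqn_mod_dvd ?leq_addr // addKn dvdn_exp.
have V01 : (V0 = 1 %[mod p])%N by rewrite def_V0 -modnXm X1 modnXm exp1n.
have V0_gt1 : (1 < V0)%N by rewrite def_V0 -(exp1n r) ltn_exp2r.
have logV0 : logn p V0.-1 = (f + logn p r)%N.
  by rewrite def_V0 logn_pred_exp // def_X add1n pfactorK.
have logn2 n : (n = 2 %[mod p])%N -> logn p n = 0%N.
  by move=> n2; rewrite logn_coprime // prime_coprime // /dvdn n2 modn_small.
have log_succ : logn p V0.+1 = 0%N by apply: logn2; rewrite -addn1 -modnDml V01 modnDml.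
have log_sqr : logn p (V0 ^ 2 + 1) = 0%N.
  by apply: logn2; rewrite -modnDml -modnXm V01 modnXm modnDml.
have logV00 : logn p V0 = 0%N.
  by rewrite logn_coprime // prime_coprime // /dvdn V01 modn_small // prime_gt1.
have log4 : logn p 4 = 0%N.
  by rewrite (lognX p 2 2) logn_prime // (gtn_eqF p_gt2).
(* Up to sign, [A] and [D] are the two sides of the obstruction at [V = V0], or at [V = - V0] if
   [eps]. The sign exchanges [V0 - 1], which carries the [p]-adic valuation, with [V0 + 1], which
   has none. *)
pose A eps := (4 ^ e * V0 ^ (a + e) * (if eps then V0.+1 else V0.-1) ^ (b + 2 * e))%N.
pose D eps := ((if eps then V0.-1 else V0.+1) ^ b * (V0 ^ 2 + 1) ^ (4 * e))%N.
have V0p_gt0 : (0 < V0.-1)%N by rewrite -ltnS prednK // ltnW.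
have V0_gt0 := ltnW V0_gt1.
have V02_gt0 : (0 < V0 ^ 2 + 1)%N by rewrite addn1.
have A_gt0 eps : (0 < A eps)%N by rewrite !muln_gt0 !expn_gt0 V0_gt0; case: eps; rewrite ?V0p_gt0.
have D_gt0 eps : (0 < D eps)%N by rewrite !muln_gt0 !expn_gt0 V02_gt0; case: eps; rewrite ?V0p_gt0.
pose eps := (0 < b)%N.
(* [A D^(p-1)] is [A / D] up to a [p]-th power. For [b = 0] its valuation is [2 e] times
   [f + v_p(r)]. For [b > 0] the sign [+] would give the factor [b + 2 e], which [p] may divide; the
   sign [-] leaves [V0 - 1] in [D] only and gives [b (p - 1)]. *)
have p'AD : ~~ (p %| logn p (A eps * D eps ^ p.-1))%N.
  rewrite lognM ?expn_gt0 ?D_gt0 // lognX !lognM ?muln_gt0 ?expn_gt0 ?V0_gt0 ?V02_gt0 //;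
    try by case: (eps); rewrite ?V0p_gt0.
  rewrite !lognX logV00 log4 log_sqr !muln0 !add0n addn0.
  rewrite /eps; have [b0|b_gt0] := posnP b.
    rewrite b0 logV0 mul0n muln0 addn0 add0n !Euclid_dvdM // !negb_or p'f andbT.
    move: be_gt0; rewrite b0 /= => e_gt0.
    by rewrite !gtnNdvd.
  rewrite log_succ logV0 muln0 add0n !Euclid_dvdM // !negb_or p'f !andbT.
  by rewrite !gtnNdvd //; lia.
have N_gt0 : (0 < M * (2 * (V0 * (V0.-1 * (V0.+1 * (V0 ^ 2 + 1))))))%N.
  by rewrite !muln_gt0 M_gt0 V0_gt0 V0p_gt0 V02_gt0.
have ADgt0 : (0 < A eps * D eps ^ p.-1)%N by rewrite muln_gt0 expn_gt0 A_gt0 D_gt0.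
have [q [q_pr + nonpow]] := exists_non_pth_power p_pr p_odd ADgt0 N_gt0 p'AD.
rewrite !coprimeMr => /and3P[co_qM co_q2 /and4P[co_qV co_qV1 co_qV2 co_qV3]].
have nz n : coprime q n -> n%:R != 0 :> 'F_q.
  by rewrite prime_coprime // (dvdn_pcharf (pchar_Fp q_pr)).
pose sg : 'F_q := if eps then -1 else 1.
have sg2 : sg ^+ 2 = 1 by rewrite /sg; case: (eps); rewrite ?sqrrN expr1n.
(* [q.-1 * X] is a natural number representing [- X] modulo [q]; as [r] is odd, its [r]-th power is
   [- V0]. *)
exists q, (if eps then (q.-1 * X)%N else X).
set V : 'F_q := _ ^+ r.
have def_V : V = sg * V0%:R.
  rewrite /V /sg def_V0 natrX; case: (eps); rewrite ?mul1r // natrM exprMn.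
  congr (_ * _); rewrite -subn1 natrB ?prime_gt0 // pchar_Fp_0 // sub0r.
  by rewrite -signr_odd r_odd.
have V1E : V0.-1%:R = V0%:R - 1 :> 'F_q by rewrite -subn1 natrB.
have VS : V0.+1%:R = V0%:R + 1 :> 'F_q by rewrite -[V0.+1]addn1 natrD.
have V2E : (V0 ^ 2 + 1)%:R = V0%:R ^+ 2 + 1 :> 'F_q by rewrite natrD natrX.
have := (nz _ co_qV1, nz _ co_qV2, nz _ co_qV3); rewrite V1E VS V2E => -[[nz1 nz2] nz3].
have sg0 : sg != 0 by rewrite /sg; case: (eps); rewrite ?oppr_eq0 oner_eq0.
split=> //; split.
- exact: nz.
- by rewrite def_V mulf_neq0 // nz.
- rewrite def_V exprMn (exprM sg 2 2) sg2 expr1n mul1r -subr_eq0.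
  have -> : V0%:R ^+ 4 - 1 = (V0%:R - 1) * ((V0%:R + 1) * (V0%:R ^+ 2 + 1)) :> 'F_q by ring.
  by rewrite !mulf_neq0.
move=> t; apply/eqP=> eq_t.
have sgnK N (c : 'F_q) : c = (-1) ^+ N * ((-1) ^+ N * c).
  by rewrite mulrA -expr2 sqrr_sign mul1r.
have [k def_A] : exists k, (A eps)%:R = (-1) ^+ k * t ^+ p * (D eps)%:R.
  move: eq_t; rewrite def_V /A /D /sg; case: (eps).
    have -> : -1 * V0%:R - 1 = -1 * (V0%:R + 1) :> 'F_q by ring.
    have -> : -1 * V0%:R + 1 = -1 * (V0%:R - 1) :> 'F_q by ring.
    have -> : - ((-1 * V0%:R) ^+ 2 + 1) ^+ 4 = -1 * (V0%:R ^+ 2 + 1) ^+ 4 :> 'F_q.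
      by ring.
    rewrite !exprMn => eq_t.
    exists (a + e + (b + 2 * e) + b + e)%N; pose Y : 'F_q := (V0%:R ^+ 2 + 1) ^+ e.
    rewrite !natrM !natrX V1E VS V2E (exprM _ 4 e).
    transitivity ((-1) ^+ (a + e + (b + 2 * e)) * ((-1) ^+ (a + e + (b + 2 * e)) *
      (4 ^+ e * V0%:R ^+ (a + e) * (V0%:R + 1) ^+ (b + 2 * e))) : 'F_q).
      exact: sgnK.
    transitivity ((-1) ^+ (a + e + (b + 2 * e)) * (t ^+ p *
      ((-1) ^+ b * (V0%:R - 1) ^+ b * ((-1) ^+ e * (Y * (Y * (Y * Y)))))) : 'F_q).
      by rewrite -eq_t !exprD; ring.
    by rewrite !exprMn /Y !exprD; ring.
  rewrite !mul1r => eq_t; exists e; rewrite !natrM !natrX V1E VS V2E exprM.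
  by rewrite eq_t -[- _ ^+ 4]mulN1r exprMn; ring.
(* The sign is a [p]-th power because [p] is odd, so [A D^(p-1)] is the [p]-th power of
   [(-1)^k t D]. *)
have /eqP[] := nonpow ((-1) ^+ k * t * (D eps)%:R).
rewrite natrM natrX def_A !exprMn -exprM mulnC exprM -(signr_odd _ p) p_odd expr1.
have -> : (D eps)%:R ^+ p = (D eps)%:R * (D eps)%:R ^+ p.-1 :> 'F_q.
  by rewrite -exprS prednK ?prime_gt0.
by ring.
Qed.

Lemma natr_Fp_eqmod (q m n : nat) : prime q -> (m = n %[mod q])%N -> m%:R = n%:R :> 'F_q.
Proof.
by move=> q_pr mn; rewrite -(Fp_nat_mod q_pr m) mn Fp_nat_mod.
Qed.

(** Each request receives a prime avoiding those already collected in [Q], so the Chinese remainder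
    theorem glues the local choices into a single [s] serving all requests. *)
Lemma exists_power_obstructions (r M : nat) (reqs : seq (nat * nat * nat * nat)) :
    odd r -> (0 < M)%N ->
    {in reqs, forall x, let: (p, a, b, e) := x in
      [/\ prime p, (p %| r)%N, (b < p)%N, (e < p)%N & (0 < b)%N || (0 < e)%N]} ->
  exists Q s, [/\ (0 < Q)%N, coprime Q M,
    forall q, prime q -> (q %| Q)%N -> let V : 'F_q := s%:R ^+ r in
      [/\ 2 != 0 :> 'F_q, V != 0 & V ^+ 4 != 1] &
    {in reqs, forall x, let: (p, a, b, e) := x in
      exists q, [/\ prime q, (q %| Q)%N & power_obstruction p a b e (s%:R ^+ r : 'F_q)]}].
Proof.
move=> r_odd M_gt0; elim: reqs => [_|[[[p a] b] e] reqs IH reqsP].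
  exists 1%N, 0%N; split=> //; first exact: coprime1n.
  by move=> q q_pr; rewrite dvdn1 => /eqP q1; rewrite q1 in q_pr.
have {}IH := IH (fun x xr => reqsP x (mem_behead (s := _ :: _) xr)).
have [Q [s [Q_gt0 co_QM goodQ obsQ]]] := IH.
have [p_pr p_r lt_bp lt_ep be_gt0] := reqsP _ (mem_head _ _).
have p_odd : odd p by apply: dvdn_odd p_r r_odd.
have MQ_gt0 : (0 < M * Q)%N by rewrite muln_gt0 M_gt0.
have [q [s0 [q_pr co_qMQ [q2 qV qV4 obsq]]]] :=
  exists_power_obstruction a p_pr p_odd r_odd p_r lt_bp lt_ep be_gt0 MQ_gt0.
move: co_qMQ; rewrite coprimeMr => /andP[co_qM co_qQ].
pose s' := chinese q Q s0 s.
have s'q : s'%:R = s0%:R :> 'F_q by apply: natr_Fp_eqmod (chinese_modl co_qQ _ _).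
have s'Q q' : prime q' -> (q' %| Q)%N -> s'%:R = s%:R :> 'F_q'.
  move=> q'_pr q'_Q; apply: natr_Fp_eqmod => //.
  by rewrite -(modn_dvdm _ q'_Q) (chinese_modr co_qQ) modn_dvdm.
exists (q * Q)%N, s'; split.
- by rewrite muln_gt0 prime_gt0.
- by rewrite coprimeMl co_qM.
- move=> q' q'_pr; rewrite Euclid_dvdM // => /orP[|q'_Q]; last by rewrite s'Q //; apply: goodQ.
  by rewrite dvdn_prime2 // => /eqP->; rewrite s'q.
move=> x; rewrite inE => /orP[/eqP->|/obsQ]; first by exists q; rewrite dvdn_mulr // s'q.
case: x => [[[p' a'] b'] e'] [q' [q'_pr q'_Q obs']].
by exists q'; rewrite dvdn_mull // s'Q.
Qed.

(** A prime factor [l] of [(2 M)^2 + 1] divides [n^2 + 16] for [n = 8 M]. If [l^2] divides it too,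
    replacing [n] by [n + l] changes the value by [2 l n] modulo [l^2], which is not [0]. *)
Lemma exists_ramified_prime (M : nat) : (0 < M)%N ->
  exists l n : nat, [/\ prime l, coprime l (2 * M),
    (l %| n ^ 2 + 16)%N & ~~ (l ^ 2 %| n ^ 2 + 16)%N].
Proof.
move=> M_gt0; pose M2 := (2 * M)%N; pose l := pdiv (M2 ^ 2 + 1).
have M2_gt0 : (0 < M2)%N by rewrite muln_gt0.
have l_pr : prime l by rewrite pdiv_prime // addn1 ltnS expn_gt0 M2_gt0.
have l_gt0 := prime_gt0 l_pr.
have /dvdnP[k def_k] : (l %| M2 ^ 2 + 1)%N by apply: pdiv_dvd.
have co_l : coprime l M2.
  rewrite prime_coprime //; apply/negP => l_M2; have := pdiv_dvd (M2 ^ 2 + 1).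
  rewrite dvdn_addr ?dvdn_exp // dvdn1 => /eqP l1.
  by move: l_pr; rewrite /l l1.
have co_l2 : coprime l 2 by move: co_l; rewrite coprimeMr => /andP[].
have n_val m : ~~ (l %| m)%N -> ~~ (l ^ 2 %| l * m)%N by rewrite expnS expn1 dvdn_pmul2l.
have [l_k|l'k] := boolP (l %| k)%N.
  exists l, (4 * M2 + l)%N.
  have -> : ((4 * M2 + l) ^ 2 + 16 = l * (16 * k + 8 * M2 + l))%N.
    transitivity (16 * (M2 ^ 2 + 1) + 8 * M2 * l + l ^ 2)%N; first by ring.
    by rewrite def_k; ring.
  split=> //; first by rewrite dvdn_mulr.
  apply: n_val; rewrite dvdn_addl // (dvdn_addr _ (dvdn_mull 16 l_k)).
  have -> : (8 * M2 = 2 ^ 3 * M2)%N by [].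
  by rewrite -prime_coprime // coprimeMr coprimeXr.
exists l, (4 * M2)%N.
have -> : ((4 * M2) ^ 2 + 16 = l * (2 ^ 4 * k))%N.
  transitivity (16 * (M2 ^ 2 + 1))%N; first by ring.
  by rewrite def_k; ring.
split=> //; first by rewrite dvdn_mulr.
apply: n_val; rewrite -prime_coprime // coprimeMr coprimeXr //=.
by rewrite prime_coprime.
Qed.

(** * The choice of [n], [v] and [z] *)

Lemma dvdz_exp_sub (d a b : int) (n : nat) : (d %| a - b)%Z -> (d %| a ^+ n - b ^+ n)%Z.
Proof. by move=> dab; rewrite subrXX dvdz_mulr. Qed.

Lemma dvdz_eqmodn (d m n : nat) : (m = n %[mod d])%N -> (d %| m%:Z - n%:Z)%Z.
Proof. by move=> mn; rewrite -eqz_mod_dvd !modz_nat mn. Qed.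

Lemma exists_inverse_modn (m d : nat) : (0 < m)%N -> coprime m d ->
  exists u, (m * u = 1 %[mod d])%N.
Proof.
move=> m_gt0 co_md; case: (egcdnP d m_gt0) => u k def_u _; exists u.
by rewrite mulnC def_u (eqP co_md) modnMDl.
Qed.

Lemma coprime_from_primes (m n : nat) : (0 < m)%N ->
  (forall q, prime q -> (q %| m)%N -> ~~ (q %| n)%N) -> coprime m n.
Proof.
move=> m_gt0 mn; have [gcd_le1|gcd_gt1] := leqP (gcdn m n) 1.
  by rewrite /coprime eqn_leq gcd_le1 gcdn_gt0 m_gt0.
have := pdiv_dvd (gcdn m n); rewrite dvdn_gcd => /andP[/mn].
by move=> /(_ (pdiv_prime gcd_gt1))/negP.
Qed.

Lemma PoszX (m i : nat) : (m ^ i)%N%:Z = m%:Z ^+ i.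
Proof. by rewrite -[LHS]natz natrX natz. Qed.

(* With [w = Q l^2] and [v = s^r - 2 w^r], a [z] congruent to [- (w / s)^2] modulo
   [v] satisfies [4 z^r = -1] modulo [v], which makes [n] integral. *)
Lemma exists_parameters (r M : nat) : odd r -> (0 < M)%N ->
  exists (n : int) (v z k l : nat),
  [/\ [/\ (1 < v)%N, odd v & z = (1 + (v ^ 2 + 1) * k)%N],
    n * (v%:Z * (v%:Z ^+ 2 - 1)) = v%:Z ^+ 4 - 6 * v%:Z ^+ 2 + 1 + 4 * z%:Z ^+ r,
    [/\ prime l, coprime l (2 * M), (l %| n ^+ 2 + 16)%Z & ~~ ((l ^ 2)%N%:Z %| n ^+ 2 + 16)%Z] &
    forall p a b e, prime p -> (p %| r)%N -> (a < p)%N -> (b < p)%N -> (e < p)%N ->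
      (0 < b)%N || (0 < e)%N ->
    exists q, [/\ prime q, (q %| z)%N & let V : 'F_q := v%:R in
      [/\ 2 != 0 :> 'F_q, V != 0, V ^+ 4 != 1 & power_obstruction p a b e V]]].
Proof.
move=> r_odd M_gt0; have r_gt0 : (0 < r)%N by case: r r_odd.
have rM_gt0 : (0 < r * M)%N by rewrite muln_gt0 r_gt0.
(* [l] is kept prime to [r] as well, since [8 r] is inverted modulo [l^2] below. *)
have [l [n0 [l_pr co_l l_n0 l2_n0]]] := exists_ramified_prime rM_gt0.
pose ok (x : nat * nat * nat * nat) := let: (p, a, b, e) := x in
  [&& prime p, (p %| r)%N, (a < p)%N, (b < p)%N, (e < p)%N & (0 < b)%N || (0 < e)%N].
pose rg := iota 0 r.+1.
pose reqs := [seq x <- [seq (w, e) | w <- [seq (w, b) | w <- [seq (p, a) | p <- rg, a <- rg],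
  b <- rg], e <- rg] | ok x].
have l_gt0 := prime_gt0 l_pr.
have l2_gt0 : (0 < 2 * l)%N by rewrite muln_gt0.
have [] := exists_power_obstructions (reqs := reqs) r_odd l2_gt0.
  by move=> [[[p a] b] e]; rewrite mem_filter => /andP[/and5P[-> -> _ -> /andP[-> ->]] _].
move=> Q [s0 [Q_gt0 co_Q2l goodQ obsQ]].
have [co_lrM co_l2] : coprime l (r * M) /\ coprime l 2.
  by move: co_l; rewrite coprimeMr => /andP[].
have co_lM : coprime l M by move: co_lrM; rewrite coprimeMr => /andP[].
have co_lr : coprime l r by move: co_lrM; rewrite coprimeMr => /andP[].
have [co_Q2 co_Ql] : coprime Q 2 /\ coprime Q l.
  by move: co_Q2l; rewrite coprimeMr => /andP[].
have co_Q2l2 : coprime Q (2 * l ^ 2) by rewrite coprimeMr co_Q2 coprimeXr.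
(* Divisibility of [w] by [Q] and [l^2] makes [v] congruent to [s^r] modulo both, so the
   obstructions found for [s0] apply to [v]. *)
pose w := (Q * l ^ 2)%N.
(* The congruence modulo [2 l^2] makes [v] odd and equal to [1] modulo [l^2]; the lower bound on [s]
   ensures [v > 1]. *)
have [s [s_Q s_l s_big]] : exists s, [/\ s = s0 %[mod Q], s = 1 %[mod 2 * l ^ 2] & 2 * w ^ r + 2 <= s]%N.
  exists (chinese Q (2 * l ^ 2) s0 1 + (2 * w ^ r + 2) * (Q * (2 * l ^ 2)))%N; split.
  - by rewrite addnC mulnA mulnAC modnMDl chinese_modl.
  - by rewrite addnC mulnA modnMDl chinese_modr.
  rewrite (leq_trans _ (leq_addl _ _)) // leq_pmulr // !muln_gt0 Q_gt0.
  by rewrite ?expn_gt0 l_gt0.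
have w_gt0 : (0 < w)%N by rewrite muln_gt0 Q_gt0 expn_gt0 l_gt0.
have s_gt0 : (0 < s)%N by apply: leq_trans s_big; rewrite addn2.
have s_r : (s <= s ^ r)%N by rewrite -{1}(expn1 s) leq_pexp2l.
pose v := (s ^ r - 2 * w ^ r)%N.
have vE : (v + 2 * w ^ r = s ^ r)%N.
  by rewrite subnK // (leq_trans _ s_r) // (leq_trans _ s_big) ?leq_addr.
have v_gt1 : (1 < v)%N by rewrite ltn_subRL (leq_trans _ s_r) // -addnS.
have v_gt0 := ltnW v_gt1.
have /dvdnP[j def_s] : (2 * l ^ 2 %| s - 1)%N by rewrite -eqn_mod_dvd //; apply/eqP.
have {}def_s : s = (j * (2 * l ^ 2) + 1)%N by rewrite -def_s subnK.
have s_odd : odd s by rewrite def_s oddD oddM oddM andbF.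
have v_odd : odd v.
  by move: (congr1 odd vE); rewrite oddD oddM addbF oddX s_odd orbT.
have Fq_w q : prime q -> (q %| w)%N -> v%:R = s%:R ^+ r :> 'F_q.
  move=> q_pr q_w; rewrite -[RHS]natrX -vE natrD [X in _ + X](_ : _ = 0) ?addr0 //.
  apply/eqP; rewrite -(dvdn_pcharf (pchar_Fp q_pr)) dvdn_mull //.
  by apply: dvdn_exp.
have Fq_Q q : prime q -> (q %| Q)%N -> v%:R = s0%:R ^+ r :> 'F_q.
  move=> q_pr q_Q; rewrite Fq_w ?dvdn_mulr //; congr (_ ^+ _).
  by apply: natr_Fp_eqmod; rewrite // -(modn_dvdm _ q_Q) s_Q modn_dvdm.
have nz q n : prime q -> (n%:R != 0 :> 'F_q) = ~~ (q %| n)%N.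
  by move=> q_pr; rewrite (dvdn_pcharf (pchar_Fp q_pr)).
have co_Qv : coprime Q v.
  apply: coprime_from_primes => // q q_pr q_Q; rewrite -nz // Fq_Q //.
  by have [] := goodQ q q_pr q_Q.
pose v4 := (v ^ 4).-1.
have v4E : (v ^ 4 = v4 + 1)%N by rewrite addn1 prednK // expn_gt0 v_gt0.
have v4_gt0 : (0 < v4)%N.
  by rewrite -ltnS prednK ?expn_gt0 ?v_gt0 // -(exp1n 4) ltn_exp2r.
have co_v4Q : coprime v4 Q.
  rewrite coprime_sym; apply: coprime_from_primes => // q q_pr q_Q; rewrite -nz //.
  have [_ _] := goodQ q q_pr q_Q; apply: contra => /eqP v40.
  by rewrite -Fq_Q // -natrX v4E natrD v40 add0r.
have v1 : (v = 1 %[mod l ^ 2])%N.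
  have : (v + 2 * w ^ r = 1 %[mod l ^ 2])%N.
    by rewrite vE -modnXm def_s mulnA modnMDl modnXm exp1n.
  rewrite -modnDmr (_ : (2 * w ^ r) %% l ^ 2 = 0)%N ?addn0 //.
  apply/eqP; rewrite -/(dvdn _ _) dvdn_mull // dvdn_exp // /w dvdn_mull //.
have co_lv : coprime v (l ^ 2).
  by rewrite -coprime_modl v1 coprime_modl coprime1n.
have co_sv : coprime s v.
  apply: coprime_from_primes => // q q_pr q_s; apply/negP=> q_v.
  have : (q %| 2 * w ^ r)%N by rewrite -(dvdn_addr _ q_v) vE dvdn_exp.
  rewrite Euclid_dvdM // Euclid_dvdX // r_gt0 andbT => /orP[|q_w].
    rewrite dvdn_prime2 // => /eqP q2; move: q_s; rewrite q2 dvdn2 s_odd //.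
  move: q_w; rewrite /w Euclid_dvdM // => /orP[q_Q|].
    have [_ + _] := goodQ q q_pr q_Q; rewrite -Fq_Q // nz // q_v //.
  rewrite Euclid_dvdX // andbT => q_l; have : (q %| 1)%N.
    move: q_s; rewrite def_s dvdn_addr // dvdn_mull // dvdn_mull //.
    by rewrite dvdn_exp.
  by rewrite dvdn1 => /eqP q1; rewrite q1 in q_pr.
have [u su1] := exists_inverse_modn s_gt0 co_sv.
have [t rt1] : exists t, (8 * r * t = 1 %[mod l ^ 2])%N.
  apply: exists_inverse_modn; first by rewrite muln_gt0.
  rewrite coprime_sym coprimeXl // coprimeMr co_lr andbT.
  by rewrite (_ : 8 = 2 ^ 3)%N // coprimeXr.
have [kQ kQ1] : exists kQ, (v4 * kQ + 1 = 0 %[mod Q])%N.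
  have [kQ kQ1] := exists_inverse_modn v4_gt0 co_v4Q.
  exists (kQ * Q.-1)%N; rewrite mulnA -modnDml -modnMml kQ1 modnMml mul1n modnDml.
  by rewrite addn1 prednK // modnn mod0n.
have co_lQv : coprime (l ^ 2) (Q * v).
  by rewrite coprimeXl // coprimeMr coprime_sym co_Ql /= -(coprime_pexpl _ _ (isT : 0 < 2)%N) coprime_sym.
(* With [z = 1 + (v^4 - 1) k], the three residues of [k] have separate roles: modulo [l^2] they
   yield [n = 8 r k - 4 = n0], modulo [Q] they yield [z = 0], and modulo [v] they yield
   [z = - (w u)^2], where [u] inverts [s]. *)
pose k := chinese (l ^ 2) (Q * v) (t * (n0 + 4)) (chinese Q v kQ (1 + (w * u) ^ 2)).
have k_l : (k = t * (n0 + 4) %[mod l ^ 2])%N by apply: chinese_modl.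
have k_Q : (k = kQ %[mod Q])%N.
  by rewrite -(modn_dvdm _ (dvdn_mulr v (dvdnn Q))) chinese_modr // modn_dvdm ?dvdn_mulr // chinese_modl.
have k_v : (k = 1 + (w * u) ^ 2 %[mod v])%N.
  by rewrite -(modn_dvdm _ (dvdn_mull Q (dvdnn v))) chinese_modr // modn_dvdm ?dvdn_mull // chinese_modr.
clearbody k.
pose z := (1 + v4 * k)%N.
have z_Q : (Q %| z)%N.
  by rewrite /dvdn /z -modnDmr -modnMmr k_Q modnMmr modnDmr addnC kQ1 mod0n.
pose V := v%:Z; pose Z := z%:Z; pose S := \sum_(i < r) Z ^+ i.
have v4Z : v4%:Z = V ^+ 4 - 1 by rewrite /V -PoszX v4E PoszD addrK.
have Z_1 : Z - 1 = (V ^+ 4 - 1) * k%:Z by rewrite /Z /z PoszD PoszM v4Z addrAC subrr add0r.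
(* The quotient of [V^4 - 6 V^2 + 1 + 4 Z^r] by [V^2 - 1], available because [V^4 - 1] divides
   [Z - 1]. It remains to divide it by [V], which is coprime to [V^2 - 1], and [n] is the result. *)
pose A := V ^+ 2 - 5 + 4 * (V ^+ 2 + 1) * k%:Z * S.
have NE : V ^+ 4 - 6 * V ^+ 2 + 1 + 4 * Z ^+ r = (V ^+ 2 - 1) * A.
  have -> : Z ^+ r = (Z - 1) * S + 1 by rewrite -subrX1 subrK.
  by rewrite Z_1 /A; ring.
have V_N : (V %| V ^+ 4 - 6 * V ^+ 2 + 1 + 4 * Z ^+ r)%Z.
  have V_Z : (V %| Z - - (w * u)%N%:Z ^+ 2)%Z.
    have -> : Z - - (w * u)%N%:Z ^+ 2 = V * (V ^+ 3 * k%:Z) - (k%:Z - (1 + (w * u) ^ 2)%N%:Z).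
      rewrite -[Z](subrK 1) Z_1 PoszD PoszX; ring.
    by rewrite rpredB ?dvdz_mulr // dvdz_eqmodn.
  have V_w : (V %| (2 * w%:Z ^+ r) ^+ 2 - (s%:Z ^+ r) ^+ 2)%Z.
    apply: dvdz_exp_sub.
    have -> : 2 * w%:Z ^+ r - s%:Z ^+ r = - V.
      have := congr1 Posz vE; rewrite PoszD PoszM !PoszX /V => <-; ring.
    by rewrite rpredN.
  have V_s : (V %| (s * u)%N%:Z ^+ (2 * r) - 1)%Z.
    by rewrite -[X in _ - X](expr1n _ (2 * r)) dvdz_exp_sub // dvdz_eqmodn.
  have -> : V ^+ 4 - 6 * V ^+ 2 + 1 + 4 * Z ^+ r = V * (V ^+ 3 - 6 * V) +
      4 * (Z ^+ r - (- (w * u)%N%:Z ^+ 2) ^+ r) -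
      u%:Z ^+ (2 * r) * ((2 * w%:Z ^+ r) ^+ 2 - (s%:Z ^+ r) ^+ 2) - ((s * u)%N%:Z ^+ (2 * r) - 1).
    have sqr_r (x : int) : x ^+ (2 * r) = (x ^+ r) ^+ 2 by rewrite mulnC exprM.
    have neg_r (x : int) : (- x ^+ 2) ^+ r = - (x ^+ r) ^+ 2.
      by rewrite exprNn -signr_odd r_odd expr1 mulN1r -!exprM mulnC.
    rewrite neg_r !sqr_r !PoszM !exprMn; ring.
  apply: rpredB V_s; apply: rpredB (dvdz_mull _ V_w).
  by apply: rpredD; [exact: dvdz_mulr | apply/dvdz_mull/dvdz_exp_sub].
have /dvdzP[n def_A] : (V %| A)%Z.
  move: V_N; rewrite NE Gauss_dvdzr // /coprimez.
  apply/coprimezP; exists (V, -1) => /=; ring.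
have L_V : ((l ^ 2)%N%:Z %| V - 1)%Z by apply: dvdz_eqmodn.
have L_Z : ((l ^ 2)%N%:Z %| Z - 1)%Z.
  by rewrite Z_1 dvdz_mulr // -(expr1n _ 4) dvdz_exp_sub.
have L_S : ((l ^ 2)%N%:Z %| S - r%:Z)%Z.
  have -> : S - r%:Z = \sum_(i < r) (Z ^+ i - 1).
    by rewrite sumrB sumr_const card_ord natz.
  by apply: rpred_sum => i _; rewrite -[X in _ - X](expr1n _ i) dvdz_exp_sub.
have L_k : ((l ^ 2)%N%:Z %| (8 * r * k)%N%:Z - (n0 + 4)%N%:Z)%Z.
  apply: dvdz_eqmodn; rewrite -modnMmr k_l modnMmr mulnA -modnMml rt1 modnMml.
  by rewrite mul1n.
have L_n : ((l ^ 2)%N%:Z %| n - n0%:Z)%Z.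
  have -> : n - n0%:Z = (1 + V - n) * (V - 1) + 4 * k%:Z * ((V + 1) * S * (V - 1) + 2 * (S - r%:Z)) +
     ((8 * r * k)%N%:Z - (n0 + 4)%N%:Z).
    transitivity (n * V - n * (V - 1) - n0%:Z); first by ring.
    by rewrite -def_A /A PoszD !PoszM; ring.
  apply: rpredD L_k; apply: rpredD (dvdz_mull _ L_V) _.
  by apply/dvdz_mull/rpredD; apply: dvdz_mull.
have n_n0 d : (d %| l ^ 2)%N -> (d%:Z %| n ^+ 2 + 16)%Z = (d %| n0 ^ 2 + 16)%N.
  move=> d_l; rewrite -[RHS]/(d%:Z %| (n0 ^ 2 + 16)%N%:Z)%Z.
  have -> : n ^+ 2 + 16 = (n0 ^ 2 + 16)%N%:Z + (n + n0%:Z) * (n - n0%:Z).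
    by rewrite PoszD PoszX; ring.
  by rewrite rpredDr // dvdz_mull // (dvdz_trans _ L_n) // -dvdz_nat.
have def_v4 : (v4 = (v ^ 2 + 1) * (v ^ 2).-1)%N.
  apply: succn_inj; rewrite -[v4.+1]addn1 -v4E.
  by have := expn_gt0 v 2; rewrite v_gt0; case: (v ^ 2)%N (expnM v 2 2) => // m -> _ /=; ring.
exists n, v, z, ((v ^ 2).-1 * k)%N, l; split.
- by split=> //; rewrite /z def_v4 mulnA.
- by rewrite -/V -/Z NE def_A; ring.
- by split=> //; [rewrite coprimeMr co_l2 | rewrite n_n0 // dvdn_mulr | rewrite n_n0].
move=> p a b e p_pr p_r lt_ap lt_bp lt_ep be_gt0.
have le_pr : (p <= r)%N by apply: dvdn_leq.
have [] := obsQ (p, a, b, e).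
  rewrite mem_filter /ok p_pr p_r lt_ap lt_bp lt_ep be_gt0 andTb.
  have mem_rg m : (m <= p)%N -> m \in rg.
    by move=> le_mp; rewrite mem_iota ltnS (leq_trans le_mp).
  apply/allpairsPdep; exists (p, a, b), e; split=> //; last exact/mem_rg/ltnW.
  apply/allpairsPdep; exists (p, a), b; split=> //; last exact/mem_rg/ltnW.
  by apply/allpairsPdep; exists p, a; split=> //; apply/mem_rg => //; apply/ltnW.
move=> q [q_pr q_Q obsq]; exists q; split=> //; first exact: dvdn_trans z_Q.
by rewrite Fq_Q //; have [] := goodQ q q_pr q_Q.
Qed.

(** * The fields [K_n] *)

Lemma Aint_exp (x : algC) (k : nat) : (0 < k)%N -> x ^+ k \in Aint -> x \in Aint.
Proof.
move=> k_gt0 xk; apply: (@root_monic_Aint (minCpoly (x ^+ k) \Po 'X^k)).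
- by rewrite /root horner_comp hornerXn -/(root _ _) root_minCpoly.
- rewrite monicE lead_coef_comp ?size_polyXn // lead_coefXn expr1n mulr1.
  by rewrite -monicE minCpoly_monic.
- by rewrite polyOver_comp // rpredX // polyOverX.
Qed.

(** In an abstract number field generated by [a], sending [a] to [b] is an endomorphism, because [b]
    lies in that field and is a root of the minimal polynomial of [a]. It then extends to all
    algebraic numbers. *)
Lemma adjoinQ_conj_aut (a b : algC) : adjoinQ a b -> minCpoly a = minCpoly b ->
  exists nu : {rmorphism algC -> algC}, nu a = b.
Proof.
move=> [p [q [_ def_b]]] minC_ab.
have [Qn [QnC [[|a1 []] // [a1C]]] genQn] := num_field_exists [:: a].
have QnC_horner (h : {poly rat}) (c : Qn) :
    QnC (map_poly (in_alg Qn) h).[c] = (map_poly ratr h).[QnC c].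
  rewrite -horner_map -map_poly_comp; congr _.[_]; apply: eq_map_poly => d /=.
  by rewrite alg_num_field fmorph_rat.
pose b1 := (map_poly (in_alg Qn) p).[a1] / (map_poly (in_alg Qn) q).[a1].
have b1C : QnC b1 = b by rewrite fmorph_div !QnC_horner a1C.
pose phi := kHomExtend 1 \1 a1 b1.
have homQn1 : kHom 1 1 (\1%VF : 'End(Qn)) by rewrite kHom1.
have root_b1 : root (map_poly \1%VF (minPoly 1 a1)) b1.
  have [m Dm] : exists m : {poly rat}, minPoly 1 a1 = map_poly (in_alg Qn) m.
    have aP i : (minPoly 1 a1)`_i \in 1%VS by apply/polyOverP; apply: minPolyOver.
    have {aP} a_ i := sig_eqW (vlineP _ _ (aP i)).
    exists (\poly_(i < size (minPoly 1 a1)) sval (a_ i)); apply/polyP=> i.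
    rewrite coef_map coef_poly; case: ltnP => [_|/leq_sizeP->] //=; last by rewrite scale0r.
    by case: (a_ i).
  rewrite map_poly_id => [|c _]; last by rewrite id_lfunE.
  rewrite -(fmorph_root QnC) /= /root; have := root_minPoly 1 a1.
  rewrite /root Dm -(fmorph_eq0 QnC) QnC_horner a1C => ma0.
  have : root (map_poly ratr m) a by [].
  have [m1 [Dm1 _] ->] := minCpolyP a => /dvdpP[m2 def_m].
  rewrite horner_map QnC_horner b1C def_m rmorphM hornerM /= -[map_poly _ m1]Dm1 minC_ab.
  by rewrite (rootP (root_minCpoly b)) mulr0.
have phim : monoid_morphism phi.
  by apply/kHom_monoid_morphism; rewrite -genQn span_seq1 /= kHomExtendP.
pose phiM := GRing.isMonoidMorphism.Build _ _ phi phim.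
pose phiRM : {rmorphism _ -> _} := HB.pack (fun_of_lfun phi) phiM.
have [nu Dnu] := extend_algC_subfield_aut QnC phiRM.
exists nu; rewrite -a1C -Dnu -b1C /= -{1}[a1]hornerX /phi.
rewrite (kHomExtend_poly homQn1) ?polyOverX // map_poly_id ?hornerX // => c _.
by rewrite id_lfunE.
Qed.

(** Boolean form of [adjoinQ], to which the closure structure is attached so that the [rpred] lemmas
    apply. *)
Definition adjoinQ_pred (rho : algC) : {pred algC} := fun x => `[< adjoinQ rho x >].

Lemma adjoinQP (rho x : algC) : reflect (adjoinQ rho x) (x \in adjoinQ_pred rho).
Proof. exact: asboolP. Qed.

Lemma adjoinQ_divring_closed (rho : algC) : divring_closed (adjoinQ_pred rho).
Proof.
have E (p : {poly rat}) : (map_poly ratr p).[rho] = (map_poly (ratr : _ -> algC) p).[rho] by [].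
split.
- by apply/adjoinQP; exists 1, 1; rewrite rmorph1 hornerC divr1 oner_neq0.
- move=> x y /adjoinQP[p1 [q1 [nz1 ->]]] /adjoinQP[p2 [q2 [nz2 ->]]].
  apply/adjoinQP; exists (p1 * q2 - p2 * q1), (q1 * q2).
  rewrite !(rmorphB, rmorphM) !hornerE mulf_neq0 //; split=> //; field.
  by rewrite ?nz1 ?nz2.
move=> x y /adjoinQP[p1 [q1 [nz1 ->]]] /adjoinQP[p2 [q2 [nz2 ->]]].
have [->|nz3] := eqVneq ((map_poly (ratr : _ -> algC) p2).[rho]) 0.
  by apply/adjoinQP; exists 0, 1; rewrite mul0r invr0 mulr0 !rmorph0 !rmorph1 !hornerC mul0r oner_neq0.
apply/adjoinQP; exists (p1 * q2), (q1 * p2).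
rewrite !rmorphM !hornerE mulf_neq0 //; split=> //; field.
by rewrite ?nz1 ?nz2 ?nz3.
Qed.
HB.instance Definition _ rho :=
  GRing.isDivringClosed.Build _ (adjoinQ_pred rho) (adjoinQ_divring_closed rho).

Lemma adjoinQ_gen (rho : algC) : rho \in adjoinQ_pred rho.
Proof.
apply/adjoinQP; exists 'X, 1.
by rewrite rmorph1 map_polyX hornerX hornerC divr1 oner_neq0.
Qed.

Lemma adjoinQ_rat (rho x : algC) : x \in Crat -> x \in adjoinQ_pred rho.
Proof.
case/CratP=> a ->; apply/adjoinQP; exists a%:P, 1.
by rewrite rmorph1 map_polyC !hornerC divr1 oner_neq0.
Qed.

Lemma adjoinQ_horner (rho x : algC) (p : {poly rat}) :
  x \in adjoinQ_pred rho -> (map_poly ratr p).[x] \in adjoinQ_pred rho.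
Proof.
move=> Kx; apply: rpred_horner => //; apply/polyOverP=> i.
by rewrite coef_map adjoinQ_rat //; apply/CratP; eexists.
Qed.

(** From [(k + 1)^2 <= m^2] one gets [k < 8], and the rest is a finite check. The excluded values of
    [n] are thus those for which [n^2 + 16] is a square. *)
Lemma sqr_plus16 (m k : nat) : (k ^ 2 + 16 = m ^ 2)%N -> (k == 0)%N || (k == 3)%N.
Proof.
move=> km; have lt_km : (k < m)%N by rewrite -ltn_sqr -km -[X in (X < _)%N]addn0 ltn_add2l.
have le_k7 : (k < 8)%N.
  have : (k.+1 ^ 2 <= m ^ 2)%N by rewrite leq_sqr.
  by rewrite -km -addn1 sqrnD muln1 exp1n -addnA leq_add2l; lia.
have le_m8 : (m < 9)%N.
  by rewrite -ltn_sqr -km (@leq_ltn_trans (7 ^ 2 + 16)) ?leq_add2r ?leq_sqr.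
have /allP/(_ m) : all (fun m => all (fun k =>
  (k ^ 2 + 16 == m ^ 2)%N ==> (k == 0)%N || (k == 3)%N) (iota 0 8)) (iota 0 9)%N by [].
rewrite mem_iota => /(_ le_m8)/allP/(_ k); rewrite mem_iota => /(_ le_k7).
by rewrite km eqxx.
Qed.

Section GrasField.

Variables (n : int) (rho : algC).
Hypothesis n_ok : n \notin [:: 0; 3; -3].
Hypothesis root_rho : root (map_poly intr (gras_poly n)) rho.

Local Notation nC := (n%:~R : algC).
Local Notation K := (adjoinQ_pred rho).
Local Notation theta := (rho - rho^-1).

Lemma gras_horner (R : comNzRingType) (x : R) :
  (map_poly intr (gras_poly n)).[x] =
    x ^+ 4 - n%:~R * x ^+ 3 - 6 * x ^+ 2 + n%:~R * x + 1.
Proof.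
rewrite /gras_poly !(rmorphD, rmorphB, rmorphN) /= !map_polyZ !map_polyXn map_polyX rmorph1.
by rewrite !hornerE.
Qed.

Lemma rho_eq : rho ^+ 4 - nC * rho ^+ 3 - 6 * rho ^+ 2 + nC * rho + 1 = 0.
Proof. by rewrite -gras_horner; apply/rootP. Qed.

Lemma rho_neq0 : rho != 0.
Proof.
apply: contra_eq_neq rho_eq => ->; rewrite !expr0n /=.
have -> : 0 - nC * 0 - 6 * 0 + nC * 0 + 1 = 1 :> algC by ring.
exact: oner_neq0.
Qed.

Lemma rho_neq1 : rho - 1 != 0.
Proof.
rewrite subr_eq0; apply: contra_eq_neq rho_eq => ->; rewrite !expr1n.
have -> : 1 - nC * 1 - 6 * 1 + nC * 1 + 1 = - 4%:R :> algC by ring.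
by rewrite oppr_eq0 pnatr_eq0.
Qed.

Lemma rho_neqN1 : rho + 1 != 0.
Proof.
rewrite addr_eq0; apply: contra_eq_neq rho_eq => ->.
have -> : (-1) ^+ 4 - nC * (-1) ^+ 3 - 6 * (-1) ^+ 2 + nC * -1 + 1 = - 4%:R :> algC by ring.
by rewrite oppr_eq0 pnatr_eq0.
Qed.

(* Away from [0], [1] and [-1] the equation of [rho] determines [n]; this turns
   polynomial identities modulo [gras_poly n] into identities of rational
   functions in [rho]. *)
Lemma n_rho : nC = (rho ^+ 4 - 6 * rho ^+ 2 + 1) / (rho * (rho - 1) * (rho + 1)).
Proof.
apply: (canRL (mulfK _)); first by rewrite !mulf_neq0 ?rho_neq0 ?rho_neq1 ?rho_neqN1.
by apply/eqP; rewrite -subr_eq0 -oppr_eq0 -[X in _ == X]rho_eq; apply/eqP; ring.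
Qed.

(** [theta = rho + sigma^2 rho] is the trace of [rho] to the quadratic subfield; its equation has
    discriminant [n^2 + 16]. *)
Lemma theta_eq : theta ^+ 2 = nC * theta + 4.
Proof.
rewrite n_rho; field.
by rewrite rho_neq0 rho_neq1 rho_neqN1.
Qed.

Lemma disc_eq : (2 * theta - nC) ^+ 2 = nC ^+ 2 + 16.
Proof.
have -> : (2 * theta - nC) ^+ 2 = 4 * theta ^+ 2 - 4 * nC * theta + nC ^+ 2 by ring.
by rewrite theta_eq; ring.
Qed.

Lemma gras_nonsquare (x : algC) : x \in Crat -> x ^+ 2 != nC ^+ 2 + 16.
Proof.
move=> Qx; apply/eqP=> x2.
have Zx : x \in Num.int.
  rewrite Cint_rat_Aint // (@Aint_exp _ 2) // x2.
  by rewrite -rmorphXn -[16]/(16%:~R) -rmorphD Aint_int.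
case/intrP: Zx x2 => m -> /eqP.
rewrite -!rmorphXn -[16]/(16%:~R) -rmorphD eqr_int => /eqP m2.
move: n_ok; rewrite !inE.
have := @sqr_plus16 `|m| `|n|.
have -> : (`|n| ^ 2 + 16 = `|m| ^ 2)%N by apply/eqP; rewrite -eqz_nat; lia.
by move/(_ erefl); lia.
Qed.

Lemma gras_coef_rat : nC \in Crat. Proof. by rewrite rpred_int. Qed.

Lemma nat_rat m : m%:R \in Crat. Proof. by rewrite rpred_nat. Qed.

Lemma theta_irrational : theta \notin Crat.
Proof.
apply/negP=> Qth; have := @gras_nonsquare (2 * theta - nC).
by rewrite disc_eq eqxx rpredB ?rpredM ?gras_coef_rat ?nat_rat // => /(_ isT).
Qed.

Lemma theta_indep (a b : algC) : a \in Crat -> b \in Crat ->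
  a + b * theta = 0 -> a = 0 /\ b = 0.
Proof.
move=> Qa Qb ab0; have [b0|nz_b] := eqVneq b 0.
  by move: ab0; rewrite b0 mul0r addr0.
have := theta_irrational; have -> : theta = - a / b.
  by apply: (canRL (mulfK nz_b)); apply/eqP; rewrite -addr_eq0 addrC mulrC ab0.
by rewrite rpred_div ?rpredN.
Qed.

(** Substituting [a + b theta] into [X^2 - theta X - 1], of which [rho] is a root, gives two
    rational equations [A = B = 0]. Eliminating [a] leaves [(n^2 + 16) (1 - Y)^2 = 16], so
    [n^2 + 16] would be a rational square. *)
Lemma rho_notin_Qtheta (a b : algC) : a \in Crat -> b \in Crat -> rho != a + b * theta.
Proof.
move=> Qa Qb; apply/eqP=> rhoE.
have rho2 : rho ^+ 2 - theta * rho - 1 = 0 by field; apply: rho_neq0.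
pose A := a ^+ 2 + 4 * b ^+ 2 - 4 * b - 1.
pose B := 2 * a * b + nC * b ^+ 2 - a - nC * b.
have AB : A + B * theta = 0.
  have th2 := theta_eq; move: rhoE rho2 th2; set th := theta; clearbody th.
  move=> -> rho2 th2; rewrite -[RHS]rho2 /A /B.
  transitivity ((a + b * th) ^+ 2 - th * (a + b * th) - 1 + (b ^+ 2 - b) * (nC * th + 4 - th ^+ 2)).
    by ring.
  by rewrite th2 subrr mulr0 addr0.
have [QA QB] : A \in Crat /\ B \in Crat.
  by rewrite /A /B !(rpredB, rpredD, rpredM, rpredX, gras_coef_rat, nat_rat, rpred1).
have [A0 B0] := theta_indep QA QB AB; pose Y := (2 * b - 1) ^+ 2.
have Y1 : (nC ^+ 2 + 16) * (1 - Y) ^+ 2 = 16.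
  apply/eqP; rewrite -subr_eq0; apply/eqP.
  transitivity (16 * (Y * A + B * (B - 2 * a * (2 * b - 1)))); last by rewrite A0 B0; ring.
  by rewrite /A /B /Y; ring.
have nzY : 1 - Y != 0.
  by apply: contra_eq_neq Y1 => ->; rewrite expr0n mulr0 eq_sym pnatr_eq0.
have := @gras_nonsquare (4 / (1 - Y)).
have QY : 1 - Y \in Crat by rewrite /Y !(rpredB, rpredX, rpredM, nat_rat, rpred1).
rewrite rpred_div ?nat_rat // => /(_ isT)/eqP[].
rewrite expr_div_n; apply: (canLR (mulfK _)); first by rewrite expf_neq0.
by rewrite Y1; ring.
Qed.

(** The degree is computed through the tower over [Q(theta)]: a cubic relation becomes a linear one
    in [rho] with coefficients in [Q(theta)], and a nonzero coefficient of [rho] would put [rho] in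
    [Q(theta)]. *)
Lemma rho_indep (a0 a1 a2 a3 : algC) :
    a0 \in Crat -> a1 \in Crat -> a2 \in Crat -> a3 \in Crat ->
  a0 + a1 * rho + a2 * rho ^+ 2 + a3 * rho ^+ 3 = 0 -> [/\ a0 = 0, a1 = 0, a2 = 0 & a3 = 0].
Proof.
(* The coefficients come from [rho^2 = theta rho + 1] and [rho^3 = (n theta + 5) rho + theta]. *)
move=> Q0 Q1 Q2 Q3 a_rho; pose b0 := a1 + 5 * a3; pose b1 := a2 + nC * a3.
have [Qb0 Qb1] : b0 \in Crat /\ b1 \in Crat.
  by rewrite !(rpredD, rpredM, gras_coef_rat, nat_rat).
have AB : a0 + a2 + a3 * theta + (b0 + b1 * theta) * rho = 0.
  rewrite -[RHS]a_rho /b0 /b1 n_rho; field.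
  by rewrite rho_neq0 rho_neq1 rho_neqN1.
(* The norm of [b0 + b1 theta], as the conjugate of [theta] is [n - theta]; it serves to invert this
   element. *)
pose N := b0 ^+ 2 + nC * b0 * b1 - 4 * b1 ^+ 2.
have QN : N \in Crat by rewrite /N rpredB ?rpredD ?rpredX ?rpredM ?gras_coef_rat ?nat_rat // rpredX.
have NE : (b0 + b1 * theta) * (b0 + b1 * (nC - theta)) = N.
  transitivity (b0 ^+ 2 + nC * b0 * b1 + b1 ^+ 2 * (nC * theta - theta ^+ 2)); first by ring.
  by rewrite theta_eq /N; ring.
have B0 : b0 + b1 * theta = 0.
  apply/eqP/negPn/negP => nzB.
  have nzB' : b0 + b1 * (nC - theta) != 0.
    apply: contraNneq nzB => B'0.
    have /(theta_indep _ _)[] : (b0 + b1 * nC) + (- b1) * theta = 0 by rewrite -[RHS]B'0; ring.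
    - by rewrite rpredD ?rpredM ?gras_coef_rat.
    - by rewrite rpredN.
    by move=> + /eqP; rewrite oppr_eq0 => + /eqP b10; rewrite b10 mul0r addr0 => ->; rewrite mul0r addr0.
  have nzN : N != 0 by rewrite -NE mulf_neq0.
  pose c := - (a0 + a2 + a3 * theta) * (b0 + b1 * (nC - theta)).
  have cE : rho = c / N.
    apply: (canRL (mulfK nzN)); rewrite -NE /c.
    have -> : - (a0 + a2 + a3 * theta) = (b0 + b1 * theta) * rho.
      by apply/eqP; rewrite eq_sym -addr_eq0 addrC AB.
    by ring.
  pose a := (- (a0 + a2) * (b0 + b1 * nC) + 4 * a3 * b1) / N.
  pose b := ((a0 + a2) * b1 - a3 * b0) / N.
  have Q02 := rpredD Q0 Q2.
  have Qa : a \in Crat.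
    apply: rpred_div QN; apply: rpredD; last by rewrite 2?rpredM ?nat_rat.
    by apply: rpredM; rewrite ?rpredN // (rpredD Qb0) // rpredM // gras_coef_rat.
  have Qb : b \in Crat by apply: rpred_div QN; apply: rpredB; apply: rpredM.
  have /eqP[] := rho_notin_Qtheta Qa Qb.
  rewrite {1}cE /a /b [X in _ + X]mulrAC -mulrDl; congr (_ / _).
  transitivity (c - a3 * b1 * (theta ^+ 2 - (nC * theta + 4))).
    by rewrite theta_eq subrr mulr0 subr0.
  by rewrite /c; ring.
move: AB; rewrite B0 mul0r addr0 => /(theta_indep _ Q3)[]; first by rewrite rpredD.
move=> a02 a30; have [b00 b10] := theta_indep Qb0 Qb1 B0.
move: b00 b10 a02; rewrite /b0 /b1 a30 !mulr0 !addr0 => -> ->; rewrite addr0.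
by move=> ->.
Qed.

End GrasField.

Lemma size_gras_poly (n : int) : size (gras_poly n) = 5%N.
Proof.
rewrite /gras_poly -!addrA size_polyDl size_polyXn //.
rewrite (leq_ltn_trans (size_polyD _ _)) // gtn_max size_polyN (leq_ltn_trans (size_scale_leq _ _)) ?size_polyXn //=.
rewrite (leq_ltn_trans (size_polyD _ _)) // gtn_max size_polyN (leq_ltn_trans (size_scale_leq _ _)) ?size_polyXn //=.
rewrite (leq_ltn_trans (size_polyD _ _)) // gtn_max (leq_ltn_trans (size_scale_leq _ _)) ?size_polyX //=.
by rewrite size_poly1.
Qed.

Lemma gras_poly_monic (n : int) : gras_poly n \is monic.
Proof.
by rewrite monicE lead_coefE size_gras_poly /gras_poly !coefE /=; apply/eqP; ring.
Qed.

Section GrasField.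

Variables (n : int) (rho : algC).
Hypothesis n_ok : n \notin [:: 0; 3; -3].
Hypothesis root_rho : root (map_poly intr (gras_poly n)) rho.

Local Notation nC := (n%:~R : algC).
Local Notation K := (adjoinQ_pred rho).

Lemma rho_Aint : rho \in Aint.
Proof.
apply: (root_monic_Aint root_rho); first by rewrite monic_map ?gras_poly_monic.
by apply/polyOverP => i; rewrite coef_map rpred_int.
Qed.

Lemma Crat_poly_root_eq0 (p : {poly algC}) :
  p \is a polyOver Crat -> (size p <= 4)%N -> root p rho -> p = 0.
Proof.
move=> /polyOverP Qp p_le4; rewrite /root (horner_coef_wide _ p_le4) => /eqP.
rewrite !big_ord_recl big_ord0 /= addr0 !addrA expr0 mulr1 expr1 => p0.
have [p0_0 p1_0 p2_0 p3_0] :=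
  rho_indep n_ok root_rho (Qp 0%N) (Qp 1%N) (Qp 2%N) (Qp 3%N) p0.
apply/polyP=> i; rewrite coef0; case: (ltnP i 4) => [|le4i]; first by move: i => [|[|[|[|]]]].
by rewrite nth_default // (leq_trans p_le4).
Qed.

Lemma gras_poly_dvd (p : {poly int}) :
  root (map_poly intr p) rho -> exists q, p = q * gras_poly n.
Proof.
move=> p0; have := Pdiv.RingMonic.rdivp_eq (gras_poly_monic n) p.
set q := Pdiv.Ring.rdivp _ _; set s := Pdiv.Ring.rmodp _ _ => def_p; exists q.
suffices s0 : s = 0 by rewrite {1}def_p s0 addr0.
apply: (map_inj_poly (intr_inj : injective (intr : int -> algC))); rewrite ?rmorph0 //.
apply: Crat_poly_root_eq0.
- by apply/polyOverP=> i; rewrite coef_map rpred_int.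
- rewrite size_map_inj_poly ?rmorph0 //; last exact: intr_inj.
  by rewrite -ltnS -(size_gras_poly n) Pdiv.Ring.ltn_rmodpN0 // monic_neq0 ?gras_poly_monic.
move: p0; rewrite {1}def_p rmorphD rmorphM /root /= hornerD hornerM.
by rewrite (rootP root_rho) mulr0 add0r.
Qed.

Lemma minCpoly_rho : minCpoly rho = map_poly intr (gras_poly n).
Proof.
have [p [Dp mon_p] p_dvd] := minCpolyP rho.
pose g : {poly rat} := map_poly intr (gras_poly n).
have gC : map_poly ratr g = map_poly intr (gras_poly n) :> {poly algC}.
  by rewrite -map_poly_comp; apply: eq_map_poly => c /=; rewrite ratr_int.
have mon_g : g \is monic by rewrite monic_map ?gras_poly_monic.
have size_g : size g = 5%N by rewrite size_map_inj_poly ?rmorph0 ?size_gras_poly //; apply: intr_inj.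
rewrite Dp -gC; congr (map_poly _ _); apply/eqP.
have p_g : p %| g by rewrite -p_dvd gC.
rewrite -eqp_monic // -dvdp_size_eqp // size_g eqn_leq -{1}size_g dvdp_leq ?monic_neq0 //=.
rewrite ltnNge -(size_map_poly (ratr : {rmorphism rat -> algC})) -Dp; apply/negP => le_p4.
have Qp : minCpoly rho \is a polyOver Crat.
  by rewrite Dp; apply/polyOverP=> i; rewrite coef_map; apply/CratP; eexists.
by have /eqP := Crat_poly_root_eq0 Qp le_p4 (root_minCpoly rho); rewrite minCpoly_eq0.
Qed.

Lemma adjoinQ_poly (x : algC) : x \in K ->
  exists2 h : {poly rat}, (size h <= 4)%N & x = (map_poly ratr h).[rho].
Proof.
case/adjoinQP=> p [q [nz_q ->]].
have [m [Dm mon_m] m_dvd] := minCpolyP rho.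
have m0 : (map_poly ratr m).[rho] = 0 by rewrite -Dm; apply/rootP/root_minCpoly.
have nz_m := monic_neq0 mon_m.
have /Bezout_eq1_coprimepP[[u w] /= uw1] : coprimep q m.
  rewrite /coprimep; have /dvdpP[m1 def_m] := dvdp_gcdr q m.
  have nz_g : gcdp q m != 0 by rewrite gcdp_eq0 (negPf nz_m) andbF.
  have : root (map_poly ratr m) rho by apply/rootP.
  rewrite {1}def_m rmorphM rootM => /orP[]; rewrite m_dvd => m_m1.
    have nz_m1 : m1 != 0 by apply: contraNneq nz_m => m10; rewrite def_m m10 mul0r.
    have := dvdp_leq nz_m1 m_m1; rewrite {1}def_m size_mul //.
    by move: (size_poly_gt0 (gcdp q m)) (size_poly_gt0 m1); rewrite nz_g nz_m1; move: (size m1) (size (gcdp q m)) => i j; lia.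
  have /dvdpP[q1 def_q] := dvdp_trans m_m1 (dvdp_gcdl q m).
  by case/eqP: nz_q; rewrite def_q rmorphM hornerM /= m0 mulr0.
exists ((p * u) %% m).
  have size_m : size m = 5%N.
    rewrite -(size_map_poly (ratr : {rmorphism rat -> algC})) -Dm minCpoly_rho.
    by rewrite size_map_inj_poly ?rmorph0 ?size_gras_poly //; apply: intr_inj.
  by rewrite -ltnS -size_m ltn_modp.
have := congr1 (fun f => (map_poly ratr f).[rho]) (divp_eq (p * u) m).
rewrite rmorphD !rmorphM /= hornerD !hornerM m0 mulr0 add0r => <-.
have := congr1 (fun f : {poly rat} => (map_poly ratr f).[rho]) uw1.
rewrite rmorphD !rmorphM rmorph1 /= hornerD !hornerM m0 mulr0 addr0 hornerC => uq1.
by apply: (canLR (mulfK nz_q)); rewrite -mulrA uq1 mulr1.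
Qed.

Lemma adjoinQ_int_poly (x : algC) : x \in K ->
  exists (h : {poly int}) (d : nat), (0 < d)%N /\ x * d%:R = (map_poly intr h).[rho].
Proof.
case/adjoinQ_poly=> h0 _ ->; have [h [a nz_a ->]] := rat_poly_scale h0.
pose s := sgz a; exists (s *: h), `|a|%N; rewrite absz_gt0; split=> //.
rewrite map_polyZ hornerZ map_polyZ hornerZ /= fmorphV rmorph_int -map_poly_comp.
have -> : (map_poly (ratr \o intr) h).[rho] = (map_poly intr h).[rho] :> algC.
  by congr _.[_]; apply: eq_map_poly => c /=; rewrite ratr_int.
have -> : `|a|%:R = s%:~R * a%:~R :> algC.
  by rewrite -rmorphM /= /s -abszEsg pmulrn.
by field; rewrite intr_eq0.
Qed.

Lemma rho_sqr1_neq0 : rho ^+ 2 + 1 != 0.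
Proof.
apply/eqP=> rho2.
have [Q0 Q1] : 0 \in Crat /\ 1 \in Crat by rewrite rpred0 rpred1.
have [|/eqP] := rho_indep n_ok root_rho Q1 Q0 Q1 Q0; last by rewrite oner_eq0.
by transitivity (rho ^+ 2 + 1); [ring | exact: rho2].
Qed.

(** [2 theta - n] and [2 rho - theta] have the nonnegative squares [n^2 + 16] and [theta^2 + 4].
    Reality of [K] later forces its [p]-th roots of unity to be trivial. *)
Lemma rho_real : rho \is Num.real.
Proof.
have nR : nC \is Num.real by rewrite realz.
have th_real : rho - rho^-1 \is Num.real.
  have dR : 2 * (rho - rho^-1) - nC \is Num.real.
    by rewrite realEsqr (disc_eq root_rho) addr_ge0 // real_exprn_even_ge0.
  have -> : rho - rho^-1 = (2 * (rho - rho^-1) - nC + nC) / 2 by field; apply: rho_neq0 root_rho.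
  by apply: rpred_div; [exact: rpredD | exact: realn].
have dR : 2 * rho - (rho - rho^-1) \is Num.real.
  rewrite realEsqr (_ : _ ^+ 2 = (rho - rho^-1) ^+ 2 + 4); last first.
    by field; apply: rho_neq0 root_rho.
  by rewrite addr_ge0 // real_exprn_even_ge0.
have -> : rho = (2 * rho - (rho - rho^-1) + (rho - rho^-1)) / 2 by field; apply: rho_neq0 root_rho.
by apply: rpred_div; [exact: rpredD | exact: realn].
Qed.

Lemma adjoinQ_real (x : algC) : x \in K -> x \is Num.real.
Proof.
case/adjoinQP=> p [q [_ ->]].
by rewrite rpred_div // rpred_horner ?rho_real //; apply/polyOverP=> i; rewrite coef_map /= Creal_Crat // ; apply/CratP; eexists.
Qed.

End GrasField.

(** Since [n] is a rational function of [rho], that [(rho - 1) / (rho + 1)] is again a root is an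
    identity of rational functions. The generator [sigma] is realized by a morphism [nu] of all of
    [algC]. *)
Lemma gras_aut (n : int) (rho : algC) :
    n \notin [:: 0; 3; -3] -> root (map_poly intr (gras_poly n)) rho ->
  exists nu : {rmorphism algC -> algC}, nu rho = (rho - 1) / (rho + 1).
Proof.
move=> n_ok root_rho; apply: adjoinQ_conj_aut.
  by apply/adjoinQP; rewrite rpred_div ?(rpredB, rpredD) ?adjoinQ_gen ?rpred1.
rewrite !(minCpoly_rho n_ok) //.
have nz0 := rho_neq0 root_rho; have nz1 := rho_neq1 root_rho; have nzN1 := rho_neqN1 root_rho.
rewrite /root gras_horner (n_rho root_rho); apply/eqP; field.
by rewrite nz0 nz1 nzN1.
Qed.

Lemma aut_rat_horner (mu : {rmorphism algC -> algC}) (h : {poly rat}) (x : algC) :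
  mu (map_poly ratr h).[x] = (map_poly ratr h).[mu x].
Proof.
rewrite -horner_map -map_poly_comp; congr _.[_].
by apply: eq_map_poly => c /=; rewrite fmorph_rat.
Qed.

(** * The conjugates of [rho] and the fixed field of [nu] *)

Section GrasGalois.

Variables (n : int) (rho : algC) (nu : {rmorphism algC -> algC}).
Hypothesis n_ok : n \notin [:: 0; 3; -3].
Hypothesis root_rho : root (map_poly intr (gras_poly n)) rho.
Hypothesis nu_rho : nu rho = (rho - 1) / (rho + 1).

Local Notation nC := (n%:~R : algC).
Local Notation K := (adjoinQ_pred rho).

Let nz0 := rho_neq0 root_rho.
Let nz1 := rho_neq1 root_rho.
Let nzN1 := rho_neqN1 root_rho.
Let nz2 := rho_sqr1_neq0 n_ok root_rho.

Let nz1' : 1 - rho != 0. Proof. by rewrite -oppr_eq0 opprB. Qed.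

Lemma nu2_rho : nu (nu rho) = - rho^-1.
Proof.
rewrite nu_rho fmorph_div rmorphB rmorphD rmorph1 nu_rho; field.
rewrite nz0 nzN1 (_ : rho - 1 + (rho + 1) = 2 * rho); last by ring.
by rewrite mulf_neq0 // pnatr_eq0.
Qed.

Lemma nu3_rho : nu (nu (nu rho)) = (1 + rho) / (1 - rho).
Proof.
rewrite nu2_rho rmorphN fmorphV nu_rho; field.
by rewrite nz1' nzN1 nz1.
Qed.

Lemma nu_adjoinQ (x : algC) : x \in K -> nu x \in K.
Proof.
case/adjoinQP=> p [q [_ ->]]; rewrite fmorph_div !aut_rat_horner.
have Kr : nu rho \in K by rewrite nu_rho rpred_div ?(rpredB, rpredD) ?adjoinQ_gen ?rpred1.
by rewrite rpred_div // adjoinQ_horner.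
Qed.

Lemma nu4_adjoinQ (x : algC) : x \in K -> nu (nu (nu (nu x))) = x.
Proof.
case/adjoinQP=> p [q [_ ->]]; rewrite !fmorph_div !aut_rat_horner.
suffices -> : nu (nu (nu (nu rho))) = rho by [].
by rewrite nu2_rho !rmorphN !fmorphV nu2_rho invrN invrK opprK.
Qed.

Lemma conj_uniq : uniq [:: rho; nu rho; nu (nu rho); nu (nu (nu rho))].
Proof.
rewrite /= !inE !negb_or nu3_rho nu2_rho nu_rho andbT.
have neq (x y c : algC) : c != 0 -> x - y = (rho ^+ 2 + 1) * c -> x != y.
  by move=> nz_c xy; rewrite -subr_eq0 xy mulf_neq0.
rewrite (neq _ _ (rho + 1)^-1) ?invr_neq0 //; last by field.
rewrite (neq _ _ rho^-1) ?invr_neq0 //; last by field.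
rewrite (neq _ _ (rho - 1)^-1) ?invr_neq0 //; last by field; rewrite nz1' nz1.
rewrite (neq _ _ ((rho + 1) * rho)^-1) ?invr_neq0 ?mulf_neq0 //; last by field; rewrite nz0 nzN1.
rewrite (neq _ _ (2 * ((rho + 1) * (rho - 1))^-1)) ?mulf_neq0 ?invr_neq0 ?mulf_neq0 ?pnatr_eq0 //; last first.
  by field; rewrite nz1' nz1 nzN1.
rewrite (neq _ _ (rho * (rho - 1))^-1) ?invr_neq0 ?mulf_neq0 //.
by field; rewrite nz0 nz1' nz1.
Qed.

(** Write [x = h(rho)] with [h] of degree at most [3]: then [h - x] vanishes at the four distinct
    conjugates of [rho], so [h] is constant. *)
Lemma fixed_adjoinQ_rat (x : algC) : x \in K -> nu x = x -> x \in Crat.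
Proof.
move=> Kx nux; have [h h_le4 def_x] := adjoinQ_poly n_ok root_rho Kx.
pose p : {poly algC} := map_poly ratr h - x%:P.
have nu_h (mu : {rmorphism algC -> algC}) y :
    mu x = x -> root p y -> root p (mu y).
  rewrite /root /p !hornerE !subr_eq0 => mux /eqP py.
  by rewrite -aut_rat_horner py mux.
have p_r : root p rho by rewrite /root /p !hornerE -def_x subrr.
have p_rs : all (root p) [:: rho; nu rho; nu (nu rho); nu (nu (nu rho))].
  by rewrite /= p_r !nu_h.
have [p0|nz_p] := eqVneq p 0.
  have := congr1 (fun f : {poly algC} => f`_0) p0; rewrite coefB coef_map coefC coef0 /=.
  by move/eqP; rewrite subr_eq0 => /eqP <-; apply/CratP; eexists.
have := max_poly_roots nz_p p_rs conj_uniq; rewrite ltnNge /=.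
suffices -> : (size p <= 4)%N by [].
rewrite (leq_trans (size_polyD _ _)) // geq_max size_map_poly h_le4 size_polyN.
by rewrite (leq_trans (size_polyC_leq1 _)).
Qed.

End GrasGalois.

(** * Reduction of [p]-th powers *)

Lemma horner_map_intr (R : comNzRingType) (p : {poly int}) (c : int) :
  (map_poly intr p).[c%:~R] = p.[c]%:~R :> R.
Proof. exact: horner_map. Qed.

Section LocalPowers.

Variables (n : int) (rho : algC).
Hypothesis n_ok : n \notin [:: 0; 3; -3].
Hypothesis root_rho : root (map_poly intr (gras_poly n)) rho.

Local Notation K := (adjoinQ_pred rho).

(* A [p]-th power in [K] that is a unit at the degree one prime [(q, rho - v)]
   reduces to a [p]-th power in ['F_q].  Denominators prime to that prime are
   harmless; a factor [q] in the denominator is traded for the cofactor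
   [E = (f - f(v)) / (X - v)], which is a unit there as [v] is a simple root. *)
Lemma power_reduction (p q : nat) (v : int) (P1 P2 : {poly int}) (delta : algC) :
    (0 < p)%N -> prime q -> delta \in K ->
    (map_poly intr P1).[rho] = delta ^+ p * (map_poly intr P2).[rho] ->
    (gras_poly n).[v]%:~R = 0 :> 'F_q ->
    (v ^+ 3 + (v - n) * v ^+ 2 + (v ^+ 2 - n * v - 6) * v
      + (v ^+ 3 - n * v ^+ 2 - 6 * v + n))%:~R != 0 :> 'F_q ->
    P2.[v]%:~R != 0 :> 'F_q ->
  exists t : 'F_q, P1.[v]%:~R = t ^+ p * P2.[v]%:~R.
Proof.
move=> p_gt0 q_pr Kdelta P1E fv0; set Ev := (X in X%:~R != 0) => nzEv nzP2.
have Fq0 (c : int) : (c%:~R == 0 :> 'F_q) = (q %| c)%Z by rewrite (dvdz_pcharf (pchar_Fp q_pr)).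
pose ev (h : {poly int}) : algC := (map_poly intr h).[rho].
have evM h g : ev (h * g) = ev h * ev g by rewrite /ev rmorphM hornerM.
have evB h g : ev (h - g) = ev h - ev g by rewrite /ev rmorphB /= hornerD hornerN.
have evX h k : ev (h ^+ k) = ev h ^+ k by rewrite /ev rmorphXn horner_exp.
have evC c : ev c%:P = c%:~R by rewrite /ev map_polyC hornerC.
have ev_f : ev (gras_poly n) = 0 by apply/rootP.
have ev0 h : ev h = 0 -> h.[v]%:~R = 0 :> 'F_q.
  move/rootP/(gras_poly_dvd n_ok root_rho) => [h1 ->].
  by rewrite hornerM rmorphM /= fv0 mulr0.
pose E : {poly int} := 'X^3 + (v - n) *: 'X^2 + (v ^+ 2 - n * v - 6) *: 'X
  + (v ^+ 3 - n * v ^+ 2 - 6 * v + n)%:P.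
have E_v : E.[v] = Ev by rewrite /E !(hornerD, hornerZ, hornerXn, hornerX, hornerC).
have E_f : gras_poly n = E * ('X - v%:P) + (gras_poly n).[v]%:P.
  rewrite /E /gras_poly !hornerE -!mul_polyC !(rmorphD, rmorphB, rmorphM, rmorphN, rmorphXn) /=.
  ring.
have [h0 [d0 [d0_gt0 h0E]]] := adjoinQ_int_poly n_ok root_rho Kdelta.
have : exists g h d, [/\ (0 < d)%N, g.[v]%:~R != 0 :> 'F_q & delta * d%:R * ev g = ev h].
  by exists 1, h0, d0; split=> //; rewrite ?hornerC ?oner_neq0 // /ev rmorph1 hornerC mulr1.
case=> g [h [d]]; elim/ltn_ind: d g h => d IHd g h [d_gt0 nzg dg].
(* The relation, cleared of denominators, is a polynomial vanishing at [rho], hence a multiple of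
   [gras_poly n]; its value at [v] is therefore [0] modulo [q]. *)
have : ev (h ^+ p * P2 - (d%:Z%:P * g) ^+ p * P1) = 0.
  have P1E' : ev P1 = delta ^+ p * ev P2 by [].
  rewrite evB !evM !evX evM evC -dg P1E' !exprMn -pmulrn; ring.
move/ev0; rewrite !hornerE !(rmorphB, rmorphM, rmorphXn) /= => /eqP.
rewrite subr_eq0 -pmulrn => /eqP hd.
have [/dvdnP[d' def_d]|q'd] := boolP (q %| d)%N.
  move: hd; rewrite def_d natrM pchar_Fp_0 // mulr0 mul0r expr0n gtn_eqF // mul0r => /eqP.
  rewrite mulf_eq0 (negPf nzP2) orbF expf_eq0 p_gt0 /= Fq0 => /dvdzP[b hb].
  move/eqP: fv0; rewrite Fq0 => /dvdzP[m fm].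
  have /factor_theorem[h2 def_h] : root (h - (h.[v])%:P) v by rewrite /root !hornerE subrr.
  have {}def_h : h = h2 * ('X - v%:P) + (h.[v])%:P by rewrite -def_h subrK.
  have d'_gt0 : (0 < d')%N by move: d_gt0; rewrite def_d muln_gt0 => /andP[].
  apply: (IHd d' _ (g * E) (b%:P * E - m%:P * h2)).
    by rewrite def_d ltn_Pmulr // prime_gt1.
  split=> //; first by rewrite hornerM rmorphM mulf_neq0 // E_v.
  (* As [q] divides both [h(v)] and [f(v)], the product [E h] is [q] times an integer polynomial
     modulo [f]; cancelling [q] lowers the denominator from [d] to [d']. *)
  have Eh : E * h = gras_poly n * h2 + q%:Z%:P * (b%:P * E - m%:P * h2).
    rewrite E_f {1}def_h hb fm !rmorphM /=; ring.
  apply: (@mulIf _ (q%:R : algC)); first by rewrite pnatr_eq0 -lt0n prime_gt0.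
  transitivity (ev (E * h)); first by rewrite !evM -dg def_d natrM; ring.
  rewrite Eh /ev rmorphD hornerD -!/(ev _) [ev (_ * h2)]evM ev_f mul0r add0r evM evC.
  by rewrite mulrC -pmulrn.
have nzd : d%:R != 0 :> 'F_q by rewrite -(dvdn_pcharf (pchar_Fp q_pr)).
exists (h.[v]%:~R / (d%:R * g.[v]%:~R)).
by rewrite expr_div_n mulrAC hd mulrC mulKf // expf_neq0 // mulf_neq0.
Qed.

End LocalPowers.

Section PowerIndependence.

Variables (n : int) (rho : algC) (nu : {rmorphism algC -> algC}).
Hypothesis n_ok : n \notin [:: 0; 3; -3].
Hypothesis root_rho : root (map_poly intr (gras_poly n)) rho.
Hypothesis nu_rho : nu rho = (rho - 1) / (rho + 1).
Variables (r v z : nat).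
Hypothesis v_gt1 : (1 < v)%N.
Hypothesis n_vz : n * (v%:Z * (v%:Z ^+ 2 - 1)) = v%:Z ^+ 4 - 6 * v%:Z ^+ 2 + 1 + 4 * z%:Z ^+ r.

Local Notation K := (adjoinQ_pred rho).
Local Notation vC := (v%:R : algC).
Local Notation zC := (z%:R : algC).

Lemma n_vzC : n%:~R * (vC * (vC ^+ 2 - 1)) = vC ^+ 4 - 6 * vC ^+ 2 + 1 + 4 * zC ^+ r.
Proof.
have := congr1 (intr : int -> algC) n_vz.
by rewrite !(rmorphM, rmorphD, rmorphXn, rmorphN, rmorph_nat, rmorph1) /= -!pmulrn.
Qed.

(** This is [alpha / sigma^2 alpha] written out: [sigma^2 rho = - 1 / rho] gives
    [sigma^2 alpha = (1 + v rho) / (rho - 1)]. *)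
Definition gras_beta (v : nat) : algC :=
  (v%:R - rho) * (rho - 1) / ((rho + 1) * (1 + v%:R * rho)).

Lemma linear_rho_neq0 (a b : algC) : a \in Crat -> b \in Crat -> b != 0 -> a + b * rho != 0.
Proof.
move=> Qa Qb nz_b; apply: contraNneq nz_b => ab0.
have Q0 : 0 \in Crat by rewrite rpred0.
have [|_ -> //] := rho_indep n_ok root_rho Qa Qb Q0 Q0.
by rewrite !mul0r !addr0.
Qed.

Let nz0 := rho_neq0 root_rho.
Let nz1 := rho_neq1 root_rho.
Let nzN1 := rho_neqN1 root_rho.

(** The factor [v - rho] of [beta] lies in [(q, rho - v)], so [beta] has no direct residue there.
    The identity trades that factor for [z^r], a [p]-th power when [p | r]; the cofactor of [beta]
    on the right takes the value [- (v^2 + 1)^4] at [rho = v]. *)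
Lemma gras_betaE :
  4 * zC ^+ r * (rho * (rho - 1) ^+ 2) =
    gras_beta v * (((vC - 1) * rho + (vC + 1)) * ((vC - 1) - (vC + 1) * rho) * (1 + vC * rho) ^+ 2).
Proof.
have nzv : 1 + vC * rho != 0.
  by rewrite linear_rho_neq0 ?rpred1 ?rpred_nat // pnatr_eq0; case: (v) v_gt1.
have -> : 4 * zC ^+ r = n%:~R * (vC * (vC ^+ 2 - 1)) - (vC ^+ 4 - 6 * vC ^+ 2 + 1).
  by rewrite n_vzC; ring.
rewrite (n_rho root_rho) /gras_beta; field.
by rewrite nz0 nz1 nzN1 nzv.
Qed.

Lemma power_independence (p a b e q : nat) (delta : algC) :
    (0 < r)%N -> (0 < z)%N -> prime p -> (p %| r)%N -> prime q -> (q %| z)%N ->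
    (let V : 'F_q := v%:R in
      [/\ 2 != 0 :> 'F_q, V != 0, V ^+ 4 != 1 & power_obstruction p a b e V]) ->
    delta \in K ->
  rho ^+ a * nu rho ^+ b * gras_beta v ^+ e <> delta ^+ p.
Proof.
move=> r_gt0 z_gt0 p_pr p_r q_pr q_z [Fq2 nzV V4 obs] Kdelta deltaE.
have p_gt0 := prime_gt0 p_pr.
have nzz : zC != 0 by rewrite pnatr_eq0 -lt0n.
pose P1 : {poly int} := 4%:P ^+ e * 'X ^+ (a + e) * ('X - 1) ^+ (b + 2 * e).
pose P2 : {poly int} := ('X + 1) ^+ b *
  (((v%:Z - 1)%:P * 'X + (v%:Z + 1)%:P) * ((v%:Z - 1)%:P - (v%:Z + 1)%:P * 'X) * (1 + v%:Z%:P * 'X) ^+ 2) ^+ e.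
have Fq_z : z%:R = 0 :> 'F_q by apply/eqP; rewrite -(dvdn_pcharf (pchar_Fp q_pr)).
have Fq_n : n%:~R * (v%:R * (v%:R ^+ 2 - 1)) = v%:R ^+ 4 - 6 * v%:R ^+ 2 + 1 :> 'F_q.
  have := congr1 (intr : int -> 'F_q) n_vz.
  rewrite !(rmorphM, rmorphD, rmorphXn, rmorphN, rmorph_nat, rmorph1) /= -!pmulrn Fq_z.
  by rewrite expr0n gtn_eqF // mulr0 addr0.
have nzV2 : v%:R ^+ 2 + 1 != 0 :> 'F_q.
  apply: contra V4 => /eqP V20; rewrite -subr_eq0; apply/eqP.
  by transitivity ((v%:R ^+ 2 + 1) * (v%:R ^+ 2 - 1) : 'F_q); [ring | rewrite V20 mul0r].
have nzVp : v%:R + 1 != 0 :> 'F_q.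
  apply: contra V4 => /eqP V20; rewrite -subr_eq0; apply/eqP.
  by transitivity ((v%:R + 1) * ((v%:R - 1) * (v%:R ^+ 2 + 1)) : 'F_q); [ring | rewrite V20 mul0r].
have P1v : P1.[v%:Z]%:~R = 4 ^+ e * v%:R ^+ (a + e) * (v%:R - 1) ^+ (b + 2 * e) :> 'F_q.
  by rewrite /P1 !hornerE !(rmorphM, rmorphXn, rmorphD, rmorphN, rmorph_nat, rmorph1) /= -!pmulrn.
have P2v : P2.[v%:Z]%:~R = (v%:R + 1) ^+ b * (- (v%:R ^+ 2 + 1) ^+ 4) ^+ e :> 'F_q.
  rewrite /P2 !hornerE !(rmorphM, rmorphXn, rmorphD, rmorphN, rmorph_nat, rmorph1) /= -!pmulrn.
  by congr (_ * _ ^+ _); ring.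
(* [z^m] is the [p]-th root of the factor [z^(r e)] coming from [beta^e]. *)
pose m := (r %/ p * e)%N; pose delta1 := delta / zC ^+ m.
have Kdelta1 : delta1 \in K by rewrite rpred_div // rpredX // adjoinQ_rat // rpred_nat.
have P1rho : (map_poly intr P1).[rho] = delta1 ^+ p * (map_poly intr P2).[rho].
  rewrite /P1 /P2 !(rmorphM, rmorphXn, rmorphD, rmorphN, rmorph1) /=.
  rewrite !(map_polyC, map_polyX) /= !(hornerM, horner_exp, hornerD, hornerN, hornerC, hornerX).
  rewrite -!pmulrn -[1 + (1 + (1 + 1))]/(4%:R) -[(1 + vC * rho) * _]expr2.
  have -> : delta1 ^+ p = delta ^+ p / zC ^+ (r * e).
    by rewrite /delta1 expr_div_n -exprM /m mulnAC divnK.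
  rewrite -deltaE nu_rho expr_div_n.
  set P := (_ * _ * (1 + vC * rho) ^+ 2) ^+ e.
  have PE : gras_beta v ^+ e * P = 4 ^+ e * zC ^+ (r * e) * (rho ^+ e * (rho - 1) ^+ (2 * e)).
    by rewrite /P -exprMn -gras_betaE !exprMn !exprM [(rho - 1) ^+ 2]expr2 exprMn.
  rewrite (exprD _ a e) (exprD _ b (2 * e)).
  transitivity (rho ^+ a * (rho - 1) ^+ b * (gras_beta v ^+ e * P) / zC ^+ (r * e)).
    rewrite PE; have := expf_neq0 (r * e) nzz.
    by move: (zC ^+ _) ((rho - 1) ^+ (2 * e)) => Z R nzZ; field.
  move: (gras_beta v ^+ e) P {PE} => B P.
  have := expf_neq0 b nzN1; have := expf_neq0 (r * e) nzz.
  move: (zC ^+ _) ((rho + 1) ^+ b) => Z C nzC nzZ; field.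
  by rewrite nzZ nzC.
have fv0 : (gras_poly n).[v%:Z]%:~R = 0 :> 'F_q.
  rewrite -horner_map_intr gras_horner -pmulrn.
  transitivity (v%:R ^+ 4 - 6 * v%:R ^+ 2 + 1 - n%:~R * (v%:R * (v%:R ^+ 2 - 1)) : 'F_q); first by ring.
  by rewrite Fq_n subrr.
have nzV1 : v%:R ^+ 2 - 1 != 0 :> 'F_q.
  apply: contra V4 => /eqP V20; rewrite -subr_eq0; apply/eqP.
  by transitivity ((v%:R ^+ 2 + 1) * (v%:R ^+ 2 - 1) : 'F_q); [ring | rewrite V20 mulr0].
have [||t] := power_reduction n_ok root_rho p_gt0 q_pr Kdelta1 P1rho fv0.
- rewrite !(rmorphM, rmorphXn, rmorphD, rmorphN, rmorph_nat, rmorph1) /= -!pmulrn.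
  set E := (X in X != 0).
  (* [E] is [f_n'(v)]; with the value of [n] modulo [q] inserted, it is [(v^2 + 1)^3] over
     [v (v^2 - 1)], so [v] is a simple root. *)
  have EE : v%:R * (v%:R ^+ 2 - 1) * E = (v%:R ^+ 2 + 1) ^+ 3.
    transitivity (v%:R * (v%:R ^+ 2 - 1) * (4 * v%:R ^+ 3 - 12 * v%:R)
      - (3 * v%:R ^+ 2 - 1) * (n%:~R * (v%:R * (v%:R ^+ 2 - 1))) : 'F_q); first by rewrite /E; ring.
    by rewrite Fq_n; ring.
  by apply: contra_eq_neq EE => ->; rewrite mulr0 eq_sym expf_neq0.
- by rewrite P2v mulf_neq0 ?expf_neq0 // oppr_eq0 expf_neq0.
by rewrite P1v P2v => /eqP; apply/negP/obs.
Qed.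

End PowerIndependence.

(** * Relative units *)

Lemma pigeonhole_fiber (A B : finType) (f : A -> B) (k : nat) :
  (k * #|B| < #|A|)%N -> exists b, (k < #|[set a | f a == b]|)%N.
Proof.
move=> lt_kBA; apply/existsP; apply: contraLR lt_kBA => /existsPn fib_le.
rewrite -leqNgt -sum1_card (partition_big f xpredT) //=.
rewrite mulnC -sum_nat_const leq_sum // => b _.
have := fib_le b; rewrite -leqNgt; apply: leq_trans.
by rewrite sum1dep_card subset_leq_card //; apply/subsetP=> a; rewrite !inE.
Qed.

(** A coarse logarithm used as a pigeonhole label: equal labels bound the quotient by [2]. *)
Definition floor_log2 (y : algC) : nat := trunc_log 2 (Num.truncn y).

Lemma floor_log2_bounds (y : algC) : 1 <= y -> 2 ^+ floor_log2 y <= y < 2 * 2 ^+ floor_log2 y.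
Proof.
move=> y_ge1; have y_ge0 : 0 <= y by apply: le_trans y_ge1.
have /andP[le_ty lt_yt] := truncn_itv y_ge0.
have t_gt0 : (0 < Num.truncn y)%N by rewrite truncn_gt0.
have /andP[le_2t lt_t2] := trunc_log_bounds (isT : (1 < 2)%N) t_gt0.
rewrite -exprS -!natrX (le_trans _ le_ty) ?ler_nat //=.
by rewrite (lt_le_trans lt_yt) // ler_nat.
Qed.

Lemma floor_log2_le (y : algC) (k : nat) : 1 <= y -> y <= 2 ^+ k -> (floor_log2 y <= k)%N.
Proof.
move=> y_ge1 le_yk; have /andP[le_2y _] := floor_log2_bounds y_ge1.
by have := le_trans le_2y le_yk; rewrite ler_eXn2l // ltr1n.
Qed.

Lemma floor_log2_eq (x y : algC) : 1 <= x -> 1 <= y -> floor_log2 x = floor_log2 y -> x / y < 2.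
Proof.
move=> x_ge1 y_ge1 xy; have y_gt0 : 0 < y by apply: lt_le_trans y_ge1.
have /andP[_ lt_x] := floor_log2_bounds x_ge1; have /andP[le_y _] := floor_log2_bounds y_ge1.
by rewrite ltr_pdivrMr // (lt_le_trans lt_x) // xy ler_pM2l.
Qed.

Lemma exists_exp2_bound (xs : seq algC) :
  exists C : nat, {in xs, forall x, `|x| <= 2 ^+ C}.
Proof.
exists (\sum_(x <- xs) Num.bound `|x|)%N => x xs_x.
rewrite (le_trans (ltW (archi_boundP (normr_ge0 x)))) // -natrX ler_nat.
rewrite (leq_trans (ltnW (ltn_expl _ (isT : 1 < 2)%N))) // leq_pexp2l //.
by rewrite (big_rem x) //= leq_addr.
Qed.

Section UnitRank.

Variables (n : int) (rho : algC) (nu : {rmorphism algC -> algC}).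
Hypothesis n_ok : n \notin [:: 0; 3; -3].
Hypothesis root_rho : root (map_poly intr (gras_poly n)) rho.
Hypothesis nu_rho : nu rho = (rho - 1) / (rho + 1).

Local Notation K := (adjoinQ_pred rho).

Definition relative_unit (x : algC) : Prop :=
  [/\ x != 0, x \in K, x \in Aint, x^-1 \in Aint & nu (nu x) = x^-1].

Lemma relative_unitM (x y : algC) :
  relative_unit x -> relative_unit y -> relative_unit (x * y).
Proof.
move=> [nzx Kx Zx Zx1 nux] [nzy Ky Zy Zy1 nuy]; split.
- exact: mulf_neq0.
- exact: rpredM.
- exact: rpredM.
- by rewrite invfM rpredM.
by rewrite !(rmorphM nu) nux nuy invfM.
Qed.

Lemma relative_unitV (x : algC) : relative_unit x -> relative_unit x^-1.
Proof.
move=> [nzx Kx Zx Zx1 nux]; split; rewrite ?invrK ?invr_eq0 ?rpredV //.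
by rewrite !(fmorphV nu) nux invrK.
Qed.

Lemma relative_unitX (x : algC) (k : nat) : relative_unit x -> relative_unit (x ^+ k).
Proof.
move=> [nzx Kx Zx Zx1 nux]; split; rewrite -?exprVn ?expf_neq0 ?rpredX //.
by rewrite !(rmorphXn nu) nux.
Qed.

(* With [t = x + 1 / x], the unit [x] is a root of a quartic whose coefficients
   are polynomials in the bounded integers [t + nu t] and [t * nu t]. *)
Lemma relative_unit_bounded_finite : exists S : seq algC,
  forall x, relative_unit x -> `|x| < 2 -> `|x^-1| < 2 -> `|nu x| < 2 -> `|nu x^-1| < 2 ->
    x \in S.
Proof.
pose P (T N : algC) : {poly algC} := 'X^4 - T *: 'X^3 + (N + 2) *: 'X^2 - T *: 'X + 1.
pose rts (p : {poly algC}) := sval (closed_field_poly_normal p).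
have rtsP p x : p \is monic -> root p x -> x \in rts p.
  move=> mon_p; rewrite /rts; case: closed_field_poly_normal => s /= ->.
  by rewrite (monicP mon_p) scale1r root_prod_XsubC.
have [ints ints_mem] : exists ints : seq algC,
    forall y, y \in Num.int -> `|y| <= 16 -> y \in ints.
  exists [seq (i%:R - 16) | i <- iota 0 33] => y /intrP[m ->] m16.
  have {}m16 : `|m| <= 16 by rewrite -(ler_int algC) intr_norm.
  apply/mapP; exists (absz (m + 16)); first by rewrite mem_iota; lia.
  apply/eqP; rewrite eq_sym subr_eq !pmulrn -rmorphD eqr_int; apply/eqP; lia.
exists (flatten [seq rts (P T N) | T <- ints, N <- ints]) => x [nzx Kx Zx Zx1 nux] x2 x2' nx2 nx2'.
pose t := x + x^-1; pose T := t + nu t; pose N := t * nu t.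
have Kt : t \in K by rewrite rpredD ?rpredV.
have nut : nu (nu t) = t by rewrite /t !(rmorphD, fmorphV) nux invrK addrC.
have Zt : t \in Aint by rewrite rpredD.
have Znt : nu t \in Aint by rewrite Aint_aut.
have Kint y : y \in K -> y \in Aint -> nu y = y -> y \in Num.int.
  by move=> Ky Zy nuy; apply: Cint_rat_Aint => //; exact: (fixed_adjoinQ_rat n_ok root_rho nu_rho Ky nuy).
have ZT : T \in Num.int.
  apply: Kint; [exact/rpredD/nu_adjoinQ | exact: rpredD |].
  by rewrite /T (rmorphD nu) nut addrC.
have ZN : N \in Num.int.
  apply: Kint; [exact/rpredM/nu_adjoinQ | exact: rpredM |].
  by rewrite /N (rmorphM nu) nut mulrC.
have t4 : `|t| <= 4.
  by rewrite (le_trans (ler_normD _ _)) // (_ : 4 = 2 + 2) ?lerD ?ltW // -natrD.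
have nt4 : `|nu t| <= 4.
  by rewrite /t rmorphD (le_trans (ler_normD _ _)) // (_ : 4 = 2 + 2) ?lerD ?ltW // -natrD.
apply/flattenP; exists (rts (P T N)).
  apply/allpairsP; exists (T, N); split=> //=; apply: ints_mem => //.
    apply: le_trans (ler_normD _ _) _; apply: le_trans (lerD t4 nt4) _.
    by rewrite -natrD ler_nat.
  rewrite normrM (_ : 16 = 4 * 4) ?ler_pM //.
  by rewrite -natrM.
apply: rtsP.
  have -> : P T N = 'X^4 + (- T *: 'X^3 + (N + 2) *: 'X^2 + - T *: 'X + 1).
    by rewrite /P !scaleNr !addrA.
  rewrite monicE lead_coefDl ?lead_coefXn // size_polyXn ltnS.
  apply/leq_sizeP => j le4j; rewrite !coefE.
  by rewrite !gtn_eqF ?(leq_trans _ le4j) // !mulr0 !addr0.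
rewrite /root /P !(hornerD, hornerN, hornerZ, hornerXn, hornerX, hornerC) /T /N.
(* The quartic is the product of [X^2 - t X + 1] and [X^2 - (nu t) X + 1], and [x] is a root of the
   former. *)
rewrite -(mulr0 (x ^+ 2 - nu t * x + 1)) -(_ : x ^+ 2 - t * x + 1 = 0); last first.
  by rewrite /t; field.
by apply/eqP; ring.
Qed.

(* The sizes of [x] and [nu x] determine those of all conjugates: [N^3]
   monomials fall into [O(N^2)] boxes of bounded ratio, so some box has more
   elements than there are bounded relative units. *)
Lemma relative_unit_pigeonhole (R1 R2 R3 : algC) :
    relative_unit R1 -> relative_unit R2 -> relative_unit R3 ->
  exists N, ~ injective (fun i : 'I_N * 'I_N * 'I_N => R1 ^+ i.1.1 * R2 ^+ i.1.2 * R3 ^+ i.2).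
Proof.
move=> U1 U2 U3; have [S S_P] := relative_unit_bounded_finite.
have [C C_P] := exists_exp2_bound [:: R1; R2; R3; nu R1; nu R2; nu R3;
  R1^-1; R2^-1; R3^-1; nu R1^-1; nu R2^-1; nu R3^-1].
(* There are [(2 L + 1)^2] boxes with [L = 3 C N], hence at most [(6 C + 1)^2 N^2]; this [N] makes
   [F] times that number smaller than [N^3]. *)
pose F := (size S).+1; pose N := (F * (6 * C).+1 ^ 2).+1.
exists N => u_inj; pose u (i : 'I_N * 'I_N * 'I_N) := R1 ^+ i.1.1 * R2 ^+ i.1.2 * R3 ^+ i.2.
have U_u i : relative_unit (u i) by do 2?apply: relative_unitM; apply: relative_unitX.
pose L := (C * N * 3)%N.
have prod_le (x1 x2 x3 : algC) (i : 'I_N * 'I_N * 'I_N) :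
    `|x1| <= 2 ^+ C -> `|x2| <= 2 ^+ C -> `|x3| <= 2 ^+ C ->
  `|x1 ^+ i.1.1 * x2 ^+ i.1.2 * x3 ^+ i.2| <= 2 ^+ L.
  have exp_le (x : algC) (j : 'I_N) : `|x| <= 2 ^+ C -> `|x ^+ j| <= 2 ^+ (C * N).
    move=> le_x; rewrite normrX exprM (le_trans (lerXn2r j _ _ le_x)) ?nnegrE ?exprn_ge0 //.
    by rewrite ler_weXn2l ?exprn_ege1 ?ler1n // ltnW.
  move=> le1 le2 le3; rewrite !normrM /L mulnC -[3%N]/(1 + 1 + 1)%N !mulnDl !mul1n !exprD.
  by rewrite !ler_pM ?exp_le // ?mulr_ge0.
have u_le i : [/\ `|u i| <= 2 ^+ L, `|(u i)^-1| <= 2 ^+ L, `|nu (u i)| <= 2 ^+ L & `|nu (u i)^-1| <= 2 ^+ L].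
  by rewrite /u !invfM -!exprVn !rmorphM !rmorphXn /=; split; apply: prod_le; apply: C_P; rewrite !inE eqxx ?orbT.
(* The factor [2^L] shifts all sizes above [1], where [floor_log2] is meaningful; it cancels in
   quotients. *)
pose y (x : algC) := `|x| * 2 ^+ L.
have y_ge1 x : x != 0 -> `|x^-1| <= 2 ^+ L -> 1 <= y x.
  by move=> nz_x; rewrite normfV -[X in X <= _]mulr1 ler_pdivrMl ?normr_gt0.
have y_le x : `|x| <= 2 ^+ L -> y x <= 2 ^+ (2 * L).
  by move=> le_x; rewrite /y mul2n -addnn exprD ler_pM2r ?exprn_gt0.
have nz_u i : u i != 0 by case: (U_u i).
have y1 i : (1 <= y (u i)) * (1 <= y (nu (u i))).
  have [_ le2 _ le4] := u_le i; rewrite !y_ge1 ?fmorph_eq0 //.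
  by rewrite -(fmorphV nu).
have color_lt i : (floor_log2 (y (u i)) < (2 * L).+1)%N * (floor_log2 (y (nu (u i))) < (2 * L).+1)%N.
  by have [le1 _ le3 _] := u_le i; split; rewrite ltnS floor_log2_le ?y_le ?y1.
pose f i := (Ordinal (color_lt i).1, Ordinal (color_lt i).2).
have [] := @pigeonhole_fiber _ _ f F.
  rewrite !card_prod !card_ord.
  have : (F * ((2 * L).+1 * (2 * L).+1) <= F * (6 * C).+1 ^ 2 * (N * N))%N.
    have le_L : ((2 * L).+1 <= (6 * C).+1 * N)%N.
      rewrite [leqRHS]mulSn (_ : 2 * L = 6 * C * N)%N; last by rewrite /L; ring.
      by rewrite -add1n leq_add2r.
    by rewrite -mulnA leq_pmul2l // -mulnn mulnACA leq_mul.
  by move/leq_ltn_trans; apply; rewrite mulnC ltn_pmul2l.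
move=> b; set A := [set a | _] => lt_FA.
have [i0 Ai0] : exists i0, i0 \in A by apply/set0Pn; rewrite -card_gt0 (leq_trans _ lt_FA).
have ratio_lt i j : i \in A -> j \in A -> (`|u i / u j| < 2) * (`|nu (u i / u j)| < 2).
  rewrite !inE => /eqP Ai /eqP; rewrite -Ai => /esym[eq1 eq2].
  have yE (x x' : algC) : `|x / x'| = y x / y x'.
    by rewrite /y normf_div -mulf_div divff ?mulr1 // expf_neq0 ?pnatr_eq0.
  by rewrite (fmorph_div nu) !yE !floor_log2_eq ?y1.
have : (size [seq u i / u i0 | i <- enum A] <= size S)%N.
  apply: uniq_leq_size.
    rewrite map_inj_uniq ?enum_uniq // => i j.
    by move/(mulIf (invr_neq0 (nz_u i0)))/u_inj.
  move=> x /mapP[i]; rewrite mem_enum => Ai ->.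
  have [lt1 lt2] := ratio_lt i i0 Ai Ai0; have [lt3 lt4] := ratio_lt i0 i Ai0 Ai.
  apply: S_P => //; first exact/relative_unitM/relative_unitV.
  - by rewrite invf_div.
  - by rewrite invf_div.
by rewrite size_map -cardE leqNgt (ltn_trans _ lt_FA).
Qed.

Lemma relative_unit_relation (eta : algC) : relative_unit eta ->
  exists a b c : int, [|| a != 0, b != 0 | c != 0] /\ rho ^ a * nu rho ^ b * eta ^ c = 1.
Proof.
move=> U3; have nz0 := rho_neq0 root_rho; have nz1 := rho_neq1 root_rho.
have nzN1 := rho_neqN1 root_rho.
have Zrho := rho_Aint root_rho.
have Z_nu x : (nu x \in Aint) = (x \in Aint) := Aint_aut nu x.
have nu2 := nu2_rho root_rho nu_rho.
have ZrhoV : rho^-1 \in Aint by rewrite -[rho^-1]opprK -nu2 rpredN !Z_nu.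
have Krho := adjoinQ_gen rho.
(* [rho] has relative norm [rho (- 1 / rho) = -1], so its square is taken, and likewise for
   [nu rho]. *)
have U1 : relative_unit (rho ^+ 2).
  split; rewrite ?expf_neq0 ?rpredX -?exprVn ?rpredX //.
  by rewrite !(rmorphXn nu) nu2 sqrrN exprVn.
have U2 : relative_unit (nu rho ^+ 2).
  split; rewrite ?expf_neq0 ?rpredX -?exprVn ?rpredX ?fmorph_eq0 ?nu_adjoinQ //.
  - by rewrite Z_nu.
  - by rewrite -(fmorphV nu) Z_nu.
  by rewrite !(rmorphXn nu) nu2 !(rmorphN nu, fmorphV nu) sqrrN exprVn.
have [N] := relative_unit_pigeonhole U1 U2 U3.
set u := (fun _ => _) => not_inj_u.
have [i [j neq_ij eq_u]] : exists i, exists2 j, i != j & u i = u j.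
  by apply/injectivePn; apply: contra_notN not_inj_u => /injectiveP.
have nz3 : eta != 0 by case: U3.
have nz2 : nu rho != 0 by rewrite fmorph_eq0.
have expzB (x : algC) (k l : nat) : x != 0 -> x ^ (k%:Z - l%:Z) = x ^+ k / x ^+ l.
  by move=> nz_x; rewrite expfzDr // -invr_expz.
exists ((2 * i.1.1)%N%:Z - (2 * j.1.1)%N%:Z), ((2 * i.1.2)%N%:Z - (2 * j.1.2)%N%:Z), (i.2%:Z - j.2%:Z).
split.
  apply: contra_neqT neq_ij; rewrite !negb_or !negbK !subr_eq0 !eqz_nat !eqn_mul2l /=.
  by case: i j {eq_u} => [[i1 i2] i3] [[j1 j2] j3] /= /and3P[/eqP/val_inj-> /eqP/val_inj-> /eqP/val_inj->].
rewrite !expzB // !exprM !mulf_div -[_ * _ * eta ^+ i.2]/(u i) eq_u.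
by rewrite divff // /u !mulf_neq0 ?expf_neq0.
Qed.

End UnitRank.

Lemma real_odd_unity (x : algC) (p : nat) : x \is Num.real -> odd p -> x ^+ p = 1 -> x = 1.
Proof.
move=> x_real p_odd xp; have p_gt0 : (0 < p)%N by case: p p_odd {xp}.
have [x_ge0|x_lt0] := real_leP (real0 _) x_real.
  by apply/eqP; rewrite -(pexpr_eq1 p_gt0 x_ge0) xp.
have : 0 <= (- x) ^+ p by rewrite exprn_ge0 // oppr_ge0 ltW.
by rewrite exprNn -signr_odd p_odd xp expr1 mulr1 oppr_ge0 ler10.
Qed.

(** * Powers of [beta] are not relative units times [p]-th powers *)

Section NotPower.

Variables (n : int) (rho : algC) (nu : {rmorphism algC -> algC}).
Hypothesis n_ok : n \notin [:: 0; 3; -3].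
Hypothesis root_rho : root (map_poly intr (gras_poly n)) rho.
Hypothesis nu_rho : nu rho = (rho - 1) / (rho + 1).
Variables (r v z : nat).
Hypothesis r_odd : odd r.
Hypothesis z_gt0 : (0 < z)%N.
Hypothesis v_gt1 : (1 < v)%N.
Hypothesis n_vz : n * (v%:Z * (v%:Z ^+ 2 - 1)) = v%:Z ^+ 4 - 6 * v%:Z ^+ 2 + 1 + 4 * z%:Z ^+ r.
Hypothesis obstructions :
  forall p a b e, prime p -> (p %| r)%N -> (a < p)%N -> (b < p)%N -> (e < p)%N ->
    (0 < b)%N || (0 < e)%N ->
  exists q, [/\ prime q, (q %| z)%N & let V : 'F_q := v%:R in
    [/\ 2 != 0 :> 'F_q, V != 0, V ^+ 4 != 1 & power_obstruction p a b e V]].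

Local Notation K := (adjoinQ_pred rho).
Local Notation beta := (gras_beta rho v).

Lemma gras_beta_neq0 : beta != 0.
Proof.
have nzv : v%:R != 0 :> algC by rewrite pnatr_eq0; case: (v) v_gt1.
have [Qv Q1] : (v%:R : algC) \in Crat /\ (1 : algC) \in Crat by rewrite rpred_nat rpred1.
rewrite /gras_beta !mulf_neq0 ?invr_neq0 ?mulf_neq0 ?(rho_neq1 root_rho) ?(rho_neqN1 root_rho) //.
  have := linear_rho_neq0 n_ok root_rho Qv (rpredN1 _).
  by rewrite mulN1r; apply; rewrite oppr_eq0 oner_eq0.
exact: (linear_rho_neq0 n_ok root_rho).
Qed.

Lemma gras_beta_adjoinQ : beta \in K.
Proof.
have Kr := adjoinQ_gen rho; have Kv : v%:R \in K by rewrite adjoinQ_rat ?rpred_nat.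
rewrite /gras_beta; apply: rpred_div; apply: rpredM; rewrite ?rpredB ?rpredD ?rpred1 //.
exact: rpredM.
Qed.

Lemma int_power_independence (p : nat) (a b e : int) (delta : algC) :
    prime p -> (p %| r)%N -> delta \in K -> delta != 0 ->
    rho ^ a * nu rho ^ b * beta ^ e = delta ^+ p ->
  [/\ (p %| a)%Z, (p %| b)%Z & (p %| e)%Z].
Proof.
move=> p_pr p_r Kdelta nz_delta deltaE.
have p_gt0 := prime_gt0 p_pr; have r_gt0 : (0 < r)%N by case: (r) r_odd.
have nz_rho := rho_neq0 root_rho; have nz_beta := gras_beta_neq0.
have nz_nu : nu rho != 0 by rewrite fmorph_eq0.
have Kr := adjoinQ_gen rho; have Knu : nu rho \in K by apply: (nu_adjoinQ nu_rho).
pose md (c : int) := absz (c %% p)%Z.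
have mdE c : c = (md c)%:Z + (c %/ p)%Z * p.
  by rewrite /md gez0_abs ?modz_ge0 -?lt0n ?eqz_nat -?lt0n // addrC -divz_eq.
have md_lt c : (md c < p)%N.
  by rewrite -ltz_nat /md gez0_abs ?modz_ge0 ?ltz_pmod // eqz_nat -lt0n.
have md0 c : md c = 0%N -> (p %| c)%Z.
  by move=> c0; rewrite (mdE c) c0 add0r dvdz_mull.
have mdX (x : algC) c : x != 0 -> x ^ c = x ^+ md c * (x ^ (c %/ p)%Z) ^+ p.
  by move=> nz_x; rewrite {1}(mdE c) expfzDr // -exprz_exp -!exprnP.
pose delta1 := delta / (rho ^ (a %/ p)%Z * nu rho ^ (b %/ p)%Z * beta ^ (e %/ p)%Z).
have Kdelta1 : delta1 \in K.
  by rewrite rpred_div // !rpredM // rpredXz // gras_beta_adjoinQ.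
have delta1E : rho ^+ md a * nu rho ^+ md b * beta ^+ md e = delta1 ^+ p.
  rewrite /delta1 (expr_div_n delta) -deltaE (mdX _ a) // (mdX _ b) // (mdX _ e) // !exprMn.
  have nzX (x : algC) c : x != 0 -> (x ^ c) ^+ p != 0 by move=> nz_x; rewrite expf_neq0 ?expfz_neq0.
  have := nzX _ (a %/ p)%Z nz_rho; have := nzX _ (b %/ p)%Z nz_nu.
  have := nzX _ (e %/ p)%Z nz_beta.
  move: ((rho ^ (a %/ p)%Z) ^+ p) ((nu rho ^ (b %/ p)%Z) ^+ p) ((beta ^ (e %/ p)%Z) ^+ p).
  move: (rho ^+ md a) (nu rho ^+ md b) (beta ^+ md e) => A B C X Y Z nzZ nzY nzX1.
  by field; rewrite nzX1 nzY nzZ.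
have indep := power_independence n_ok root_rho nu_rho v_gt1 n_vz r_gt0 z_gt0 p_pr p_r.
have no_be a' b' e' delta' : (a' < p)%N -> (b' < p)%N -> (e' < p)%N -> delta' \in K ->
    rho ^+ a' * nu rho ^+ b' * beta ^+ e' = delta' ^+ p -> (b' = 0 /\ e' = 0)%N.
  move=> lt_a' lt_b' lt_e' Kd E.
  have [|] := boolP ((0 < b')%N || (0 < e')%N); last by rewrite negb_or -!eqn0Ngt => /andP[/eqP-> /eqP->].
  move=> /(obstructions p_pr p_r lt_a' lt_b' lt_e')[q [q_pr q_z obs]].
  by case: (indep a' b' e' q delta' q_pr q_z obs Kd).
have [b0 e0] := no_be _ _ _ _ (md_lt a) (md_lt b) (md_lt e) Kdelta1 delta1E.
(* Only [rho^a] is left, for which no obstruction is available; [nu] moves the exponent to [nu rho],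
   where there is one. *)
have [a0 _] : (md a = 0 /\ 0 = 0)%N.
  apply: (no_be 0%N (md a) 0%N (nu delta1)); rewrite ?md_lt ?(nu_adjoinQ nu_rho) //.
  by have := congr1 nu delta1E; rewrite b0 e0 !mulr1 !(rmorphXn nu) mul1r.
by rewrite !md0.
Qed.

(** If [p] divides all three exponents, dividing them by [p] leaves a real [p]-th root of unity,
    which is [1] as [p] is odd; the exponents decrease, so this stops. *)
Lemma relative_unit_relation_primitive (p : nat) (eta : algC) :
    prime p -> odd p -> relative_unit rho nu eta ->
  exists a b c : int, ~~ [&& (p %| a)%Z, (p %| b)%Z & (p %| c)%Z] /\
    rho ^ a * nu rho ^ b * eta ^ c = 1.
Proof.
move=> p_pr p_odd U_eta; have [nz_eta K_eta _ _ _] := U_eta.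
have [a [b [c [nz_abc abc1]]]] := relative_unit_relation n_ok root_rho nu_rho U_eta.
have [k] := ubnP (absz a + absz b + absz c)%N.
elim: k a b c nz_abc abc1 => // k IHk a b c nz_abc abc1 lt_k.
have [/and3P[/dvdzP[a' def_a] /dvdzP[b' def_b] /dvdzP[c' def_c]]|] :=
  boolP [&& (p %| a)%Z, (p %| b)%Z & (p %| c)%Z]; last by exists a, b, c.
have p_gt1 := prime_gt1 p_pr.
apply: (IHk a' b' c').
- by move: nz_abc; rewrite def_a def_b def_c !mulf_eq0 -!negb_and; lia.
- apply: (@real_odd_unity _ p) => //; last first.
    by rewrite -abc1 def_a def_b def_c -!exprz_exp -!exprnP !exprMn.
  apply: (adjoinQ_real root_rho).
  by rewrite !rpredM // rpredXz ?(nu_adjoinQ nu_rho) ?adjoinQ_gen.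
have abs_le (i j : int) : i = j * p -> (absz j + absz j <= absz i)%N.
  by move=> ->; rewrite abszM addnn -muln2 leq_mul.
have := abs_le _ _ def_a; have := abs_le _ _ def_b; have := abs_le _ _ def_c.
move: nz_abc lt_k; lia.
Qed.

(** Raising the equation to the power [c] and inserting the primitive relation eliminates [eta]:
    [rho^a (nu rho)^b beta^(k c)] is a [p]-th power. Then [p] divides [a], [b] and [k c], against
    primitivity. *)
Lemma gras_beta_power_neq (p k : nat) (eta delta : algC) :
    prime p -> (p %| r)%N -> ~~ (p %| k)%N -> relative_unit rho nu eta -> delta \in K ->
  beta ^+ k <> eta * delta ^+ p.
Proof.
move=> p_pr p_r p'k U_eta Kdelta betaE.
have p_odd : odd p := dvdn_odd p_r r_odd.
have [nz_eta _ _ _ _] := U_eta.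
have nz_delta : delta != 0.
  apply: contra_eq_neq betaE => ->; rewrite expr0n gtn_eqF ?prime_gt0 // mulr0.
  by rewrite expf_neq0 // gras_beta_neq0.
have [a [b [c [/and3P ndvd abc1]]]] := relative_unit_relation_primitive p_pr p_odd U_eta.
have [|||pa pb pkc] := @int_power_independence p a b (k%:Z * c) (delta ^ c) p_pr p_r.
- by rewrite rpredXz.
- by rewrite expfz_neq0.
- rewrite -exprz_exp -exprnP betaE expfzMl.
  by rewrite mulrA abc1 mul1r exprnP exprnP !exprz_exp mulrC.
case: ndvd; split=> //; move: pkc; rewrite Gauss_dvdzr //.
by rewrite coprimezE /= prime_coprime.
Qed.

End NotPower.

(** * The ideal [I] and its class *)

Local Open Scope classical_set_scope.
Local Open Scope ring_scope.

Section IntegerRing.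

Variable rho : algC.
Local Notation K := (adjoinQ rho).

Lemma int_ringP (x : algC) : int_ring K x <-> (x \in adjoinQ_pred rho) /\ (x \in Aint).
Proof. by split=> [[/adjoinQP]|[/adjoinQP]]. Qed.

Lemma int_ring1 : int_ring K 1.
Proof. by apply/int_ringP; rewrite !rpred1. Qed.

Lemma int_ringD (x y : algC) : int_ring K x -> int_ring K y -> int_ring K (x + y).
Proof. by move=> /int_ringP[? ?] /int_ringP[? ?]; apply/int_ringP; rewrite !rpredD. Qed.

Lemma int_ringM (x y : algC) : int_ring K x -> int_ring K y -> int_ring K (x * y).
Proof. by move=> /int_ringP[? ?] /int_ringP[? ?]; apply/int_ringP; rewrite !rpredM. Qed.

Lemma int_ring_sum (m : nat) (f : 'I_m -> algC) :
  (forall i, int_ring K (f i)) -> int_ring K (\sum_i f i).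
Proof.
move=> Of; apply/int_ringP; split; apply: rpred_sum => i _; by have /int_ringP[] := Of i.
Qed.

Lemma scale_set1 (J : set algC) : scale_set 1 J = J.
Proof.
by apply/seteqP; split=> [_ [x Jx <-]|x Jx]; [rewrite mul1r | exists x; rewrite ?mul1r].
Qed.

Lemma scale_setM (a b : algC) (J : set algC) : scale_set a (scale_set b J) = scale_set (a * b) J.
Proof.
apply/seteqP; split=> [_ [_ [x Jx <-] <-]|_ [x Jx <-]].
  by exists x; rewrite ?mulrA.
by exists (b * x); [exists x | rewrite mulrA].
Qed.

Lemma mem_int_span (m : nat) (c g : 'I_m -> algC) (G : set algC) :
  (forall i, int_ring K (c i)) -> (forall i, G (g i)) -> int_span K G (\sum_i c i * g i).
Proof. by move=> Oc Gg; exists m, c, g. Qed.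

Lemma int_span_gen (G : set algC) (x : algC) : G x -> int_span K G x.
Proof.
move=> Gx; exists 1%N, (fun=> 1), (fun=> x); split=> // [_|]; first exact: int_ring1.
by rewrite big_ord1 mul1r.
Qed.

Lemma ideal_mul_scale (a b : algC) (I J : set algC) :
  ideal_mul K (scale_set a I) (scale_set b J) = scale_set (a * b) (ideal_mul K I J).
Proof.
apply/seteqP; split=> [_ [m [c [g [Oc Gg ->]]]]|_ [_ [m [c [g [Oc Gg ->]]]] <-]].
  have /choice[h hP] i : exists h, [set x * y | x in I & y in J] h /\ g i = a * b * h.
    have [_ [x Ix <-] [_ [y Jy <-] <-]] := Gg i.
    by exists (x * y); split; [exists x => //; exists y | ring].
  exists (\sum_i c i * h i); first by apply: mem_int_span => // i; have [] := hP i.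
  by rewrite mulr_sumr; apply: eq_bigr => i _; have [_ ->] := hP i; ring.
rewrite mulr_sumr; under eq_bigr => i _ do rewrite mulrCA.
apply: mem_int_span => // i; have [x Ix [y Jy <-]] := Gg i.
by exists (a * x); [exists x | exists (b * y); [exists y | ring]].
Qed.

Lemma class_mul_ideal (I J : set algC) :
  class_mul K (ideal_class K I) (ideal_class K J) = ideal_class K (ideal_mul K I J).
Proof.
have K1 : K 1 by have [] := int_ring1.
apply/seteqP; split=> [_ [_ [a [Ka nz_a ->]] [_ [b [Kb nz_b ->]] <-]]|_ [a [Ka nz_a ->]]].
  exists (a * b); split; rewrite ?mulf_neq0 ?ideal_mul_scale //.
  by apply/adjoinQP; rewrite rpredM //; apply/adjoinQP.
exists (scale_set a I); first by exists a.
exists (scale_set 1 J); first by exists 1; rewrite oner_neq0.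
by rewrite ideal_mul_scale mulr1.
Qed.

Definition ideal_pow (I : set algC) (m : nat) : set algC :=
  iter m (ideal_mul K I) (int_ring K).

Lemma class_exp_ideal (I : set algC) (m : nat) :
  class_exp K (ideal_class K I) m = ideal_class K (ideal_pow I m).
Proof. by elim: m => // m IHm; rewrite /class_exp /= -class_mul_ideal -IHm. Qed.

Lemma class_one_principal (I : set algC) :
  ideal_class K I = class_one K <-> principal_ideal K I.
Proof.
have K1 : K 1 by have [] := int_ring1.
split=> [clsI|[a [Ka nz_a ->]]].
  have : ideal_class K I I by exists 1; rewrite scale_set1 oner_neq0.
  by rewrite clsI.
apply/seteqP; split=> [_ [b [Kb nz_b ->]]|_ [b [Kb nz_b ->]]].
  rewrite scale_setM; exists (b * a); split; rewrite ?mulf_neq0 //.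
  by apply/adjoinQP; rewrite rpredM //; apply/adjoinQP.
exists (b / a); rewrite scale_setM divfK // mulf_neq0 ?invr_neq0 //; split=> //.
by apply/adjoinQP; rewrite rpred_div //; apply/adjoinQP.
Qed.

End IntegerRing.

(* The ideal [I] with [I^r = (beta)], described through an [r]-th root [omega]
   of [beta] not assumed to lie in [K]: by unique factorization [x] is in [I] if and only if
   [x / omega] is integral.  The witnesses [g] and [u] of [beta \in I^r] replace
   unique factorization. *)
Section RootIdeal.

Variables (rho beta omega : algC) (r : nat) (g u : 'I_3 -> algC).
Local Notation K := (adjoinQ rho).
Hypothesis r_gt0 : (0 < r)%N.
Hypothesis K_beta : K beta.
Hypothesis beta_neq0 : beta != 0.
Hypothesis omega_r : omega ^+ r = beta.
Hypothesis K_g : forall i, K (g i).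
Hypothesis g_int : forall i, g i ^+ r / beta \in Aint.
Hypothesis O_u : forall i, int_ring K (u i).
Hypothesis ug1 : \sum_i u i * (g i ^+ r / beta) = 1.

Definition root_ideal : set algC := [set x | K x /\ x / omega \in Aint].
Local Notation I := root_ideal.

Lemma omega_neq0 : omega != 0.
Proof. by apply: contra_neq beta_neq0 => w0; rewrite -omega_r w0 expr0n gtn_eqF. Qed.

Lemma root_idealP (x : algC) : K x -> x ^+ r / beta \in Aint -> I x.
Proof.
by move=> Kx xr; split=> //; apply: (Aint_exp r_gt0); rewrite expr_div_n omega_r.
Qed.

Lemma root_ideal_exp (x : algC) : I x -> x ^+ r / beta \in Aint.
Proof. by case=> _ Zx; rewrite -omega_r -expr_div_n rpredX. Qed.

Lemma root_ideal_gens i : I (g i). Proof. exact: root_idealP. Qed.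

Lemma exp_ideal_pow (x : algC) (m : nat) : I x -> ideal_pow rho I m (x ^+ m).
Proof.
move=> Ix; elim: m => [|m IHm]; first by rewrite expr0; apply: int_ring1.
by rewrite exprS; apply: int_span_gen; exists x => //; exists (x ^+ m).
Qed.

Lemma ideal_pow_root (x : algC) (m : nat) :
  ideal_pow rho I m x -> K x /\ x / omega ^+ m \in Aint.
Proof.
elim: m x => [|m IHm] x; first by rewrite expr0 divr1.
move=> [k [c [h [Oc Gh ->]]]]; split.
  apply/adjoinQP/rpred_sum => i _; apply: rpredM; first by have /int_ringP[] := Oc i.
  have [a [Ka _] [b /IHm[Kb _] <-]] := Gh i.
  by apply: rpredM; apply/adjoinQP.
rewrite mulr_suml; apply: rpred_sum => i _.
have [a [Ka Za] [b /IHm[Kb Zb] <-]] := Gh i.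
have -> : c i * (a * b) / omega ^+ m.+1 = c i * ((a / omega) * (b / omega ^+ m)).
  by rewrite exprS; field; rewrite ?expf_neq0 omega_neq0.
by apply: rpredM; [have [] := Oc i | apply: rpredM].
Qed.

Lemma ideal_pow_principal : ideal_pow rho I r = scale_set beta (int_ring K).
Proof.
apply/seteqP; split=> [x /ideal_pow_root[Kx Zx]|_ [t Ot <-]].
  exists (x / beta); last by rewrite mulrC divfK.
  by apply/int_ringP; rewrite -{2}omega_r rpred_div //; apply/adjoinQP.
have -> : beta * t = \sum_i (t * u i) * g i ^+ r.
  rewrite -[LHS]mulr1 -ug1 mulr_sumr; apply: eq_bigr => i _; field.
  exact: beta_neq0.
rewrite -(prednK r_gt0); apply: mem_int_span => i; first exact: int_ringM.
by exists (g i); [exact: root_ideal_gens | exists (g i ^+ r.-1); [exact/exp_ideal_pow/root_ideal_gens | rewrite exprS]].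
Qed.

Lemma root_ideal_class_exp : class_exp K (ideal_class K I) r = class_one K.
Proof. by rewrite class_exp_ideal; apply/class_one_principal; exists beta; rewrite ideal_pow_principal. Qed.

(** If [I^m = (a)], then [(beta^m) = I^(m r) = (a^r)], so the quotient of the generators is a
    unit. *)
Lemma root_ideal_trivial_power (m : nat) : (0 < m)%N ->
  class_exp K (ideal_class K I) m = class_one K ->
  exists a, [/\ K a, a != 0, beta ^+ m / a ^+ r \in Aint & (beta ^+ m / a ^+ r)^-1 \in Aint].
Proof.
move=> m_gt0; rewrite class_exp_ideal => /class_one_principal[a [Ka nz_a Ia]].
exists a; split=> //; last first.
  have : ideal_pow rho I m a by rewrite Ia; exists 1; rewrite ?mulr1 //; apply: int_ring1.
  case/ideal_pow_root=> _ Za; rewrite invf_div -omega_r -exprM mulnC exprM -expr_div_n.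
  exact: rpredX.
(* Only the powers [g_i^m] are known to lie in [(a)], hence the detour through an [m]-th root [t] of
   the quotient: the [m]-th power of [(g_i^r / beta) t] is [(g_i^m / a)^r], and the elements
   [g_i^r / beta] generate the unit ideal. *)
pose y := beta ^+ m / a ^+ r; pose t := m.-root y.
have t_m : t ^+ m = y by rewrite rootCK.
suffices Zt : t \in Aint by rewrite -/y -t_m rpredX.
have Zct i : (g i ^+ r / beta) * t \in Aint.
  apply: (Aint_exp m_gt0); rewrite exprMn t_m /y.
  have : ideal_pow rho I m (g i ^+ m) by apply/exp_ideal_pow/root_ideal_gens.
  rewrite Ia => -[s [_ Zs] as_g].
  have -> : (g i ^+ r / beta) ^+ m * (beta ^+ m / a ^+ r) = s ^+ r.
    rewrite expr_div_n -exprM mulnC exprM -as_g exprMn; field.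
    by rewrite !expf_neq0.
  exact: rpredX.
rewrite -[t]mul1r -ug1 mulr_suml; apply: rpred_sum => i _.
by rewrite -mulrA rpredM //; have [] := O_u i.
Qed.

Lemma root_ideal_fractional (d : algC) : int_ring K d -> d != 0 -> d ^+ r * beta \in Aint ->
  fractional_ideal K I.
Proof.
move=> [Kd Zd] nz_d Zdb; split.
- by move=> x [].
- have /existsNP[i nz_gi] : ~ (forall i, g i = 0).
    move=> g0; move: ug1; rewrite big1 => [/eqP|i _]; first by rewrite eq_sym oner_eq0.
    by rewrite g0 expr0n gtn_eqF // mul0r mulr0.
  by exists (g i); [exact: root_ideal_gens | exact/eqP].
- move=> x y [/adjoinQP Kx Zx] [/adjoinQP Ky Zy]; split; last by rewrite mulrDl rpredD.
  by apply/adjoinQP; rewrite rpredD.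
- move=> c x /int_ringP[Kc Zc] [/adjoinQP Kx Zx]; split; last by rewrite -mulrA rpredM.
  by apply/adjoinQP; rewrite rpredM.
exists d; split=> // x Ix; have [/adjoinQP Kx _] := Ix.
apply/int_ringP; split; first by rewrite rpredM //; apply/adjoinQP.
apply: (Aint_exp r_gt0).
have -> : (d * x) ^+ r = (d ^+ r * beta) * (x ^+ r / beta) by rewrite exprMn; field.
by rewrite rpredM // root_ideal_exp.
Qed.

End RootIdeal.

(** * The relative norm *)

Section RelativeNorm.

Variables (n : int) (rho : algC) (nu : {rmorphism algC -> algC}).
Hypothesis n_ok : n \notin [:: 0; 3; -3].
Hypothesis root_rho : root (map_poly intr (gras_poly n)) rho.
Hypothesis nu_rho : nu rho = (rho - 1) / (rho + 1).

Local Notation K := (adjoinQ rho).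
Local Notation sqrtD := (sqrtC (n%:~R ^+ 2 + 16) : algC).
Local Notation k := (adjoinQ sqrtD).

Lemma sqrtD_rho : sqrtD = 2 * (rho - rho^-1) - n%:~R \/ sqrtD = - (2 * (rho - rho^-1) - n%:~R).
Proof.
have /eqP : sqrtD ^+ 2 = (2 * (rho - rho^-1) - n%:~R) ^+ 2 by rewrite sqrtCK disc_eq.
by rewrite eqf_sqr => /orP[] /eqP; [left | right].
Qed.

Lemma sqrtD_neq0 : sqrtD != 0.
Proof.
apply: contra_eq_neq (sqrtCK (n%:~R ^+ 2 + 16 : algC)) => ->.
by rewrite expr0n eq_sym gt_eqF // ltr_wpDl ?ltr0n // real_exprn_even_ge0 // realz.
Qed.

Lemma adjoinQ_sqrtD : sqrtD \in adjoinQ_pred rho.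
Proof.
have Kd : 2 * (rho - rho^-1) - n%:~R \in adjoinQ_pred rho.
  rewrite rpredB ?rpredM ?rpredB ?rpredV ?adjoinQ_gen //; apply: adjoinQ_rat.
    by rewrite rpred_nat.
  by rewrite rpred_int.
by have [->|->] := sqrtD_rho; rewrite ?rpredN.
Qed.

Lemma nu_sqrtD : nu sqrtD = - sqrtD.
Proof.
have nu_d : nu (2 * (rho - rho^-1) - n%:~R) = - (2 * (rho - rho^-1) - n%:~R).
  rewrite rmorphB (rmorphM nu) (rmorphB nu) fmorphV rmorph_nat rmorph_int nu_rho (n_rho root_rho).
  by field; rewrite (rho_neq0 root_rho) (rho_neq1 root_rho) (rho_neqN1 root_rho).
by have [->|->] := sqrtD_rho; rewrite ?(rmorphN nu) nu_d.
Qed.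

Lemma quadratic_adjoinQP (y : algC) : k y <-> y \in adjoinQ_pred rho /\ nu (nu y) = y.
Proof.
split=> [[p [q [_ ->]]]|[Ky nuy]].
  rewrite rpred_div ?adjoinQ_horner ?adjoinQ_sqrtD //; split=> //.
  by rewrite !fmorph_div !aut_rat_horner nu_sqrtD (rmorphN nu) nu_sqrtD opprK.
have nzd := sqrtD_neq0; have Kd := adjoinQ_sqrtD.
have Kn := nu_adjoinQ nu_rho Ky.
have K2 : (2 : algC) \in adjoinQ_pred rho by rewrite adjoinQ_rat ?rpred_nat.
have Qa : (y + nu y) / 2 \in Crat.
  apply: (fixed_adjoinQ_rat n_ok root_rho nu_rho); first exact: rpred_div (rpredD Ky Kn) K2.
  by rewrite (fmorph_div nu) (rmorphD nu) nuy rmorph_nat addrC.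
have Qb : (y - nu y) / (2 * sqrtD) \in Crat.
  apply: (fixed_adjoinQ_rat n_ok root_rho nu_rho); first exact: rpred_div (rpredB Ky Kn) (rpredM K2 Kd).
  by rewrite (fmorph_div nu) (rmorphB nu) (rmorphM nu) nuy rmorph_nat nu_sqrtD; field.
have -> : y = (y + nu y) / 2 + (y - nu y) / (2 * sqrtD) * sqrtD by field.
apply/adjoinQP/rpredD; first exact: adjoinQ_rat.
by apply: rpredM; [exact: adjoinQ_rat | exact: adjoinQ_gen].
Qed.

Let nz0 := rho_neq0 root_rho.
Let nu2 := nu2_rho root_rho nu_rho.

Lemma rho_addV_neq0 : rho + rho^-1 != 0.
Proof.
have -> : rho + rho^-1 = (rho ^+ 2 + 1) / rho by field.
by rewrite mulf_neq0 ?invr_neq0 // (rho_sqr1_neq0 n_ok root_rho).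
Qed.

Definition rho_basis : 'rV[algC]_2 := \row_j rho ^+ j.

Lemma rho_basis_sum (c : 'I_2 -> algC) : \sum_i c i * rho_basis 0 i = c 0 + c 1 * rho.
Proof. by rewrite !big_ord_recl big_ord0 !mxE expr0 mulr1 addr0; congr (_ + c _ * _); apply/val_inj. Qed.

Lemma rho_basis_free (c : 'I_2 -> algC) : (forall i, k (c i)) ->
  \sum_i c i * rho_basis 0 i = 0 -> forall i, c i = 0.
Proof.
move=> kc; rewrite rho_basis_sum => c0.
have [_ nu0] := (quadratic_adjoinQP (c 0)).1 (kc 0).
have [_ nu1] := (quadratic_adjoinQP (c 1)).1 (kc 1).
have c0' := congr1 (fun y => nu (nu y)) c0.
rewrite !(rmorphD nu, rmorphM nu, rmorph0 nu) nu0 nu1 nu2 in c0'.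
have c10 : c 1 = 0.
  apply: (mulIf rho_addV_neq0); rewrite mul0r -[RHS]subr0 -{1}c0 -c0'; ring.
have c00 : c 0 = 0 by move: c0; rewrite c10 mul0r addr0.
by case=> [[|[|i]] lt_i2] //; [rewrite -[RHS]c00 | rewrite -[RHS]c10]; congr c; apply/val_inj.
Qed.

Lemma rho_basis_is_basis : is_basis K k rho_basis.
Proof.
split; last exact: rho_basis_free.
  by move=> i; apply/adjoinQP; rewrite mxE rpredX // adjoinQ_gen.
move=> x /adjoinQP Kx; have Kr := adjoinQ_gen rho.
have Knx : nu (nu x) \in adjoinQ_pred rho by rewrite !(nu_adjoinQ nu_rho).
have Ks : rho + rho^-1 \in adjoinQ_pred rho by rewrite rpredD ?rpredV.
have nu4 := nu4_adjoinQ root_rho nu_rho Kx.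
have [a1 [Ka1 nua1 a1E]] : exists a1, [/\ a1 \in adjoinQ_pred rho, nu (nu a1) = a1 &
    nu (nu x) = x - a1 * (rho + rho^-1)].
  exists ((x - nu (nu x)) / (rho + rho^-1)); split; first by rewrite rpred_div ?rpredB.
    rewrite !(fmorph_div nu) !(rmorphB nu) !(rmorphD nu) !(fmorphV nu) nu2 nu4.
    rewrite invrN invrK; field; rewrite nz0 mulNr -opprD oppr_eq0 [1 + _]addrC.
    by rewrite -expr2 (rho_sqr1_neq0 n_ok root_rho).
  by rewrite divfK ?rho_addV_neq0 // opprB addrC subrK.
exists (fun i => if i == 0 then x - a1 * rho else a1); last by rewrite rho_basis_sum /= subrK.
move=> i; apply/quadratic_adjoinQP; case: ifP => _ //.
split; first exact: rpredB Kx (rpredM Ka1 Kr).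
by rewrite !(rmorphB nu) !(rmorphM nu) nu2 nua1 a1E; ring.
Qed.

(* On the basis [(1, rho)] the conjugation [nu^2] gives a second left
   eigenvector of the matrix of multiplication by [a], with eigenvalue [nu^2 a]. *)
Lemma is_normE (a c : algC) : K a -> is_norm K k a c -> c = a * nu (nu a).
Proof.
move=> Ka [m [b [M [[Kb span_b free_b] kM aM ->]]]].
pose e := rho_basis; have [Ke span_e free_e] := rho_basis_is_basis.
have kP := quadratic_adjoinQP.
have k_mul p q s (A : 'M[algC]_(p, q)) (B : 'M[algC]_(q, s)) :
    (forall i j, k (A i j)) -> (forall i j, k (B i j)) -> forall i j, k ((A *m B) i j).
  move=> kA kB i j; rewrite mxE; apply/adjoinQP/rpred_sum => l _.
  by apply: rpredM; apply/adjoinQP.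
have k1 p i j : k ((1%:M : 'M[algC]_p) i j) by apply/adjoinQP; rewrite mxE rpred_nat.
have coord p (f : 'rV[algC]_p) q (g : 'rV[algC]_q) :
    (forall x, K x -> exists2 c : 'I_p -> algC, forall i, k (c i) & x = \sum_i c i * f 0 i) ->
    (forall i, K (g 0 i)) ->
  exists2 C : 'M[algC]_(p, q), forall i j, k (C i j) & g = f *m C.
  move=> span_f Kg.
  have /choice[C CP] j : exists c : 'I_p -> algC, (forall i, k (c i)) /\ g 0 j = \sum_i c i * f 0 i.
    by have [c' kc' ->] := span_f _ (Kg j); exists c'.
  exists (\matrix_(i, j) C j i); first by move=> i j; rewrite mxE; have [] := CP j.
  apply/rowP=> j; have [_ ->] := CP j; rewrite mxE; apply: eq_bigr => i _.
  by rewrite mxE mulrC.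
have uniq_coord p (f : 'rV[algC]_p) q (A B : 'M[algC]_(p, q)) :
    (forall c : 'I_p -> algC, (forall i, k (c i)) -> \sum_i c i * f 0 i = 0 -> forall i, c i = 0) ->
    (forall i j, k (A i j)) -> (forall i j, k (B i j)) -> f *m A = f *m B -> A = B.
  move=> free_f kA kB fAB; apply/matrixP=> i j; apply/eqP; rewrite -subr_eq0; apply/eqP.
  apply: (free_f (fun i => A i j - B i j)) => [l|].
    by apply/adjoinQP/rpredB; apply/adjoinQP.
  have /rowP/(_ j) := fAB; rewrite !mxE => fABj.
  under eq_bigr => l _ do rewrite mulrBl mulrC [B l j * _]mulrC.
  by rewrite sumrB fABj subrr.
(* [is_norm] allows any basis; the transition matrices [C] and [D] to and from [(1, rho)] force
   [m = 2] and preserve the determinant. *)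
have [C kC eC] := coord _ b _ e span_b Ke.
have [D kD bD] := coord _ e _ b span_e Kb.
have DC1 : D *m C = 1%:M.
  by apply: (uniq_coord _ e) => //; [exact: k_mul | rewrite mulmxA -bD -eC mulmx1].
have CD1 : C *m D = 1%:M.
  by apply: (uniq_coord _ b) => //; [exact: k_mul | rewrite mulmxA -eC -bD mulmx1].
have m2 : m = 2%N by apply/eqP; rewrite eqn_leq (mulmx1_min CD1) (mulmx1_min DC1).
subst m.
have [M0 [-> eM0 kM0]] : exists M0 : 'M[algC]_2,
    [/\ \det M = \det M0, e *m M0 = a *: e & forall i j, k (M0 i j)].
  exists (D *m M *m C); split.
  - have detDC : \det D * \det C = 1 by rewrite -det_mulmx DC1 det1.
    by rewrite !det_mulmx mulrAC detDC mul1r.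
  - by rewrite !mulmxA -bD -aM -scalemxAl -eC.
  by apply: (@k_mul _ _ _ (D *m M)); [apply: k_mul |].
pose e2 := map_mx (fun x => nu (nu x)) e.
have e2M0 : e2 *m M0 = nu (nu a) *: e2.
  apply/rowP=> j; have /rowP/(_ j)/(congr1 (fun y => nu (nu y))) := eM0.
  rewrite !mxE !(rmorphM nu) => <-; rewrite !(rmorph_sum nu); apply: eq_bigr => i _.
  by rewrite !mxE !(rmorphM nu); have [_ ->] := (kP _).1 (kM0 i j).
have eE (f : 'rV[algC]_2) (b' : algC) j : f *m M0 = b' *: f ->
    f 0 0 * M0 0 j + f 0 1 * M0 1 j = b' * f 0 j.
  move=> /rowP/(_ j); rewrite !mxE !big_ord_recl big_ord0 addr0 => <-.
  by congr (_ + f _ _ * M0 _ _); apply/val_inj.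
have detM0 : \det M0 = M0 0 0 * M0 1 1 - M0 0 1 * M0 1 0.
  rewrite (expand_det_row _ 0) !big_ord_recl big_ord0 /cofactor !det_mx11 !mxE /= addr0 !expr0 expr1.
  rewrite mul1r mulN1r mulrN.
  by congr (M0 _ _ * M0 _ _ - M0 _ _ * M0 _ _); apply/val_inj.
have := eE _ _ 0 eM0; have := eE _ _ 1 eM0; have := eE _ _ 0 e2M0; have := eE _ _ 1 e2M0.
rewrite /e2 /e !mxE !expr0 !expr1 !(rmorph1 nu) nu2 !mul1r !mulr1 => e3 e2' e1 e0.
(* Determinants are compared in the product of [M0] by the matrix with rows [e] and [e2], whose own
   determinant is [- (rho + rho^-1)]. *)
apply: (mulIf rho_addV_neq0); rewrite detM0.
transitivity ((M0 0 1 + rho * M0 1 1) * (M0 0 0 + - rho^-1 * M0 1 0)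
  - (M0 0 0 + rho * M0 1 0) * (M0 0 1 + - rho^-1 * M0 1 1)); first by ring.
by rewrite e0 e1 e2' e3; ring.
Qed.

Lemma is_norm_nu (a : algC) : K a -> is_norm K k a (a * nu (nu a)).
Proof.
move=> Ka; have [Ke span_e free_e] := rho_basis_is_basis.
have /choice[C CP] j : exists c : 'I_2 -> algC, (forall i, k (c i)) /\
    a * rho_basis 0 j = \sum_i c i * rho_basis 0 i.
  have [|c kc ->] := span_e (a * rho_basis 0 j); last by exists c.
  by apply/adjoinQP/rpredM; apply/adjoinQP.
have N : is_norm K k a (\det (\matrix_(i, j) C j i)).
  exists 2%N, rho_basis, (\matrix_(i, j) C j i); split=> //.
    by move=> i j; rewrite mxE; have [] := CP j.
  apply/rowP=> j; rewrite mxE; have [_ ->] := CP j; rewrite mxE; apply: eq_bigr => i _.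
  by rewrite [X in _ = _ * X]mxE mulrC.
by rewrite -(is_normE Ka N).
Qed.

End RelativeNorm.

(** * Comaximal elements of the ring of integers *)

Section Comaximal.

Variable rho : algC.
Local Notation O := (int_ring (adjoinQ rho)).

Definition comaximal (a b : algC) : Prop :=
  exists u w, [/\ O u, O w & u * a + w * b = 1].

Lemma int_ringN (x : algC) : O x -> O (- x).
Proof. by move=> /int_ringP[? ?]; apply/int_ringP; rewrite !rpredN. Qed.

Lemma int_ringX (x : algC) (m : nat) : O x -> O (x ^+ m).
Proof. by move=> /int_ringP[? ?]; apply/int_ringP; rewrite !rpredX. Qed.

Lemma int_ring_int (m : int) : O m%:~R.
Proof. by apply/int_ringP; rewrite adjoinQ_rat ?rpred_int // Aint_int. Qed.

Lemma comaximal_sym (a b : algC) : comaximal a b -> comaximal b a.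
Proof. by move=> [u [w [Ou Ow uw1]]]; exists w, u; rewrite addrC. Qed.

Lemma comaximalM (a b c : algC) : O a -> O b -> O c ->
  comaximal a b -> comaximal a c -> comaximal a (b * c).
Proof.
move=> Oa Ob Oc [u [w [Ou Ow uw1]]] [u' [w' [Ou' Ow' uw1']]].
exists (u * u' * a + u * w' * c + u' * w * b), (w * w'); split.
- by do ?[apply: int_ringD | apply: int_ringM].
- exact: int_ringM.
by rewrite -[RHS]mulr1 -{1}uw1 -uw1'; ring.
Qed.

Lemma comaximalX (a b : algC) (m : nat) : O a -> O b -> comaximal a b -> comaximal a (b ^+ m).
Proof.
move=> Oa Ob ab; elim: m => [|m IHm].
  by exists 0, 1; rewrite mul0r add0r mulr1; split; [apply: (int_ring_int 0) | apply: int_ring1 |].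
by rewrite exprS; apply: comaximalM => //; apply: int_ringX.
Qed.

Lemma comaximalDl (a b t : algC) : O t -> comaximal a b -> comaximal a (b + a * t).
Proof.
move=> Ot [u [w [Ou Ow uw1]]]; exists (u - w * t), w; split=> //.
  by apply: int_ringD => //; apply/int_ringN/int_ringM.
by rewrite -uw1; ring.
Qed.

(* Modulo [a] the element [z] is nilpotent, so [b + z t] is a unit when [b] is. *)
Lemma comaximal_nilpotent (a b z t e : algC) (m : nat) :
    O a -> O b -> O z -> O t -> O e -> z ^+ m = a * e ->
  comaximal a b -> comaximal a (b + z * t).
Proof.
move=> Oa Ob Oz Ot Oe zm ab; have [u [w [Ou Ow uw1]]] := comaximalX m Oa Ob ab.
pose S := \sum_(i < m) b ^+ (m.-1 - i) * (- (z * t)) ^+ i.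
have OS : O S.
  by apply: int_ring_sum => i; apply: int_ringM; apply: int_ringX => //; apply/int_ringN/int_ringM.
exists (u + w * (- t) ^+ m * e), (w * S); split.
- apply: int_ringD => //; apply: int_ringM => //; apply: int_ringM => //.
  by apply/int_ringX/int_ringN.
- exact: int_ringM.
have bS : b ^+ m - (- (z * t)) ^+ m = (b + z * t) * S by rewrite subrXX opprK.
have zt_m : (- (z * t)) ^+ m = (- t) ^+ m * (a * e) by rewrite -mulrN mulrC exprMn zm.
rewrite -uw1; transitivity (u * a + w * ((- t) ^+ m * (a * e) + (b + z * t) * S)); first by ring.
by rewrite -bS zt_m; ring.
Qed.

End Comaximal.

Lemma exists_prime_logn_lt (m r : nat) : (0 < r)%N -> (0 < m < r)%N ->
  exists p, [/\ prime p, (p %| r)%N & (logn p m < logn p r)%N].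
Proof.
move=> r_gt0 /andP[m_gt0 lt_mr].
have : ~~ (r %| m)%N by apply: contraL lt_mr => /dvdn_leq; rewrite -leqNgt; apply.
have [/allP all_le|/allPn[p]] := boolP (all (fun p => logn p r <= logn p m)%N (primes r)).
  case/negP; apply/dvdn_partP => // p p_r; rewrite p_part pfactor_dvdn //; last first.
    by move: p_r; rewrite mem_primes => /and3P[].
  exact: all_le.
by rewrite mem_primes => /and3P[p_pr _ p_r]; rewrite -ltnNge => lt_log _; exists p.
Qed.

(** * The ideal attached to [beta]: order and relative norm of its class *)

Section GrasIdeal.

Variables (n : int) (rho : algC) (nu : {rmorphism algC -> algC}).
Hypothesis n_ok : n \notin [:: 0; 3; -3].
Hypothesis root_rho : root (map_poly intr (gras_poly n)) rho.
Hypothesis nu_rho : nu rho = (rho - 1) / (rho + 1).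
Variables (r v z h : nat).
Hypothesis r_odd : odd r.
Hypothesis v_odd : odd v.
Hypothesis v_gt1 : (1 < v)%N.
Hypothesis z_h : z = (1 + (v ^ 2 + 1) * h)%N.
Hypothesis n_vz : n * (v%:Z * (v%:Z ^+ 2 - 1)) = v%:Z ^+ 4 - 6 * v%:Z ^+ 2 + 1 + 4 * z%:Z ^+ r.

Local Notation K := (adjoinQ rho).
Local Notation O := (int_ring K).
Local Notation vC := (v%:R : algC).
Local Notation zC := (z%:R : algC).
Local Notation x := (v./2%:R : algC).

Let r_gt0 : (0 < r)%N. Proof. by case: (r) r_odd. Qed.
Let nz0 := rho_neq0 root_rho.
Let nz1 := rho_neq1 root_rho.
Let nzN1 := rho_neqN1 root_rho.
Let nz1' : 1 - rho != 0. Proof. by rewrite -oppr_eq0 opprB. Qed.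
Let vE : vC = 2 * x + 1.
Proof. by rewrite -{1}(odd_double_half v) v_odd natrD -muln2 natrM addrC mulrC. Qed.

Let tau := nu rho.

(** This form of [(v - rho) / (rho + 1)] makes integrality visible: [v] is odd and
    [x = (v - 1) / 2]. *)
Definition gras_alpha : algC := x - (x + 1) * tau.
Local Notation al0 := gras_alpha.
Local Notation al1 := (nu al0).
Local Notation al2 := (nu al1).
Local Notation al3 := (nu al2).

Lemma gras_alphaE : al0 = (vC - rho) / (rho + 1).
Proof. by rewrite vE /gras_alpha /tau nu_rho; field. Qed.

Lemma gras_alpha1E : al1 = (x * rho + (x + 1)) / rho.
Proof.
rewrite /gras_alpha (rmorphB nu) (rmorphM nu) (rmorphD nu) rmorph1 rmorph_nat /tau.
by rewrite (nu2_rho root_rho nu_rho); field.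
Qed.

Lemma gras_alpha2E : al2 = (1 + vC * rho) / (rho - 1).
Proof.
rewrite vE /gras_alpha !(rmorphB nu) !(rmorphM nu) !(rmorphD nu) !rmorph1 !rmorph_nat /tau.
by rewrite (nu3_rho root_rho nu_rho); field; rewrite nz1 nz1'.
Qed.

Lemma gras_alpha3E : al3 = x - (x + 1) * rho.
Proof.
rewrite /gras_alpha !(rmorphB nu) !(rmorphM nu) !(rmorphD nu) !rmorph1 !rmorph_nat /tau.
by rewrite (nu4_adjoinQ root_rho nu_rho) ?adjoinQ_gen.
Qed.

(** The norm is [f_n(v) / f_n(-1)], and [f_n(-1) = -4]: this is the origin of the factor [4] in the
    equation for [n]. *)
Lemma gras_alpha_norm : al0 * al1 * al2 * al3 = zC ^+ r.
Proof.
apply: (@mulfI _ (4 : algC)); first by rewrite pnatr_eq0.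
have -> : 4 * zC ^+ r = n%:~R * (vC * (vC ^+ 2 - 1)) - (vC ^+ 4 - 6 * vC ^+ 2 + 1).
  by rewrite (n_vzC n_vz); ring.
rewrite gras_alpha3E gras_alpha2E gras_alpha1E gras_alphaE (n_rho root_rho) vE; field.
by rewrite nz0 nz1 nzN1.
Qed.

Lemma gras_beta_alpha : gras_beta rho v = al0 / al2.
Proof.
have [Qv Q1] : (v%:R : algC) \in Crat /\ (1 : algC) \in Crat by rewrite rpred_nat rpred1.
have nzv : 1 + vC * rho != 0.
  by apply: (linear_rho_neq0 n_ok root_rho) => //; rewrite pnatr_eq0; case: (v) v_gt1.
by rewrite gras_alpha2E gras_alphaE /gras_beta; field; rewrite nz1 nzN1 nzv.
Qed.

Lemma int_ring_nu y : O y -> O (nu y).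
Proof. by move=> /int_ringP[Ky Zy]; apply/int_ringP; rewrite (nu_adjoinQ nu_rho) ?Aint_aut. Qed.

Lemma int_ring_rho : O rho.
Proof. by apply/int_ringP; rewrite adjoinQ_gen (rho_Aint root_rho). Qed.

Lemma int_ring_gras_alpha : O al0.
Proof.
have On (i : nat) : O i%:R by have := int_ring_int rho i; rewrite -pmulrn.
apply: int_ringD => //; apply: int_ringN; apply: int_ringM; last exact: int_ring_nu int_ring_rho.
by rewrite natr1.
Qed.

Lemma z_neq0 : zC != 0. Proof. by rewrite z_h pnatr_eq0. Qed.

Lemma gras_alpha_neq0 : al0 != 0.
Proof.
have : zC ^+ r != 0 by rewrite expf_neq0 // z_neq0.
by rewrite -gras_alpha_norm !mulf_eq0 !negb_or => /andP[/andP[/andP[]]].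
Qed.

(** The right side is [(v^2 + 1) / 2], which divides [z^r - 1], whereas [al0] divides [z^r]; so [1]
    is a combination of [al0] and [b]. *)
Lemma gras_alpha_comaximal (b p q : algC) : O p -> O q ->
  p * al0 + q * b = x ^+ 2 + (x + 1) ^+ 2 -> comaximal rho al0 b.
Proof.
move=> Op Oq pqE; pose S := \sum_(i < r) zC ^+ i; pose H := 2 * h%:R * S.
have On (i : nat) : O i%:R by have := int_ring_int rho i; rewrite -pmulrn.
have OH : O H.
  apply: int_ringM; first by apply: int_ringM.
  by apply: int_ring_sum => i; apply: int_ringX.
have zrE : zC ^+ r = 1 + (x ^+ 2 + (x + 1) ^+ 2) * H.
  have -> : zC ^+ r = (zC - 1) * S + 1 by rewrite -subrX1 subrK.
  by rewrite z_h natrD natrM natrD natrX vE /H; ring.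
have Oal1 := int_ring_nu int_ring_gras_alpha; have Oal2 := int_ring_nu Oal1; have Oal3 := int_ring_nu Oal2.
exists (al1 * al2 * al3 - H * p), (- (H * q)); split.
- by apply: int_ringD; [do 2?apply: int_ringM | apply/int_ringN/int_ringM].
- exact/int_ringN/int_ringM.
transitivity (al0 * al1 * al2 * al3 - H * (p * al0 + q * b)); first by ring.
by rewrite gras_alpha_norm pqE zrE; ring.
Qed.

Let O1 : O 1. Proof. exact: int_ring1. Qed.
Let Ox : O x. Proof. by have := int_ring_int rho v./2; rewrite -pmulrn. Qed.
Let Otau : O tau. Proof. exact/int_ring_nu/int_ring_rho. Qed.

Lemma gras_alpha02_comaximal : comaximal rho al0 al2.
Proof.
have nztau : tau != 0 by rewrite fmorph_eq0.
apply: (@gras_alpha_comaximal _ x ((x + 1) * tau)) => //.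
  by apply: int_ringM => //; apply: int_ringD.
rewrite gras_alpha2E gras_alphaE vE /tau nu_rho; field.
by rewrite nz1 nzN1.
Qed.

Lemma gras_alpha01_comaximal : comaximal rho al0 al1.
Proof.
apply: (@gras_alpha_comaximal _ (-1) ((x + 1) * (tau + 1))).
- exact: int_ringN.
- by apply: int_ringM; apply: int_ringD.
rewrite gras_alpha1E gras_alphaE vE /tau nu_rho; field.
by rewrite nz0 nzN1.
Qed.

Lemma gras_alpha03_comaximal : comaximal rho al0 al3.
Proof.
apply: (@gras_alpha_comaximal _ vC (- ((x + 1) * (1 - tau)))).
- by have := int_ring_int rho v; rewrite -pmulrn.
- by apply: int_ringN; apply: int_ringM; apply: int_ringD => //; apply: int_ringN.
rewrite gras_alpha3E gras_alphaE vE /tau nu_rho; field.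
exact: nzN1.
Qed.

Lemma comaximal_nu (a b : algC) : comaximal rho a b -> comaximal rho (nu a) (nu b).
Proof.
move=> [u [w [Ou Ow uw1]]]; exists (nu u), (nu w); split; try exact: int_ring_nu.
by rewrite -!(rmorphM nu) -rmorphD uw1 rmorph1.
Qed.

Local Notation A := (al0 * al2).
Local Notation B := (al1 * al3).

Let Oal0 : O al0. Proof. exact: int_ring_gras_alpha. Qed.
Let Oal1 : O al1. Proof. exact: int_ring_nu. Qed.
Let Oal2 : O al2. Proof. exact: int_ring_nu. Qed.
Let Oal3 : O al3. Proof. exact: int_ring_nu. Qed.
Let nu4_al0 : nu al3 = al0.
Proof. by apply: (nu4_adjoinQ root_rho nu_rho); have /int_ringP[] := Oal0. Qed.

Lemma gras_alpha0B_comaximal : comaximal rho al0 B.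
Proof. exact: comaximalM gras_alpha01_comaximal gras_alpha03_comaximal. Qed.

Lemma gras_alpha2B_comaximal : comaximal rho al2 B.
Proof.
have := comaximal_nu (comaximal_nu gras_alpha0B_comaximal).
by rewrite !(rmorphM nu) nu4_al0 mulrC.
Qed.

Local Notation beta := (gras_beta rho v).
Local Notation g2 := (al0 * zC ^+ r.-1 / al2).

(* Generators of [I]; [gras_gens_exp] shows that their [r]-th powers generate
   [(beta)]. *)
Definition gras_gens (i : 'I_3) : algC := [:: zC; al0; g2]`_i.

Let nz_al0 : al0 != 0. Proof. exact: gras_alpha_neq0. Qed.
Let nz_al1 : al1 != 0. Proof. by rewrite fmorph_eq0. Qed.
Let nz_al2 : al2 != 0. Proof. by rewrite fmorph_eq0. Qed.
Let Oz : O zC. Proof. by have := int_ring_int rho z; rewrite -pmulrn. Qed.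
Let K_O y : O y -> K y. Proof. by case. Qed.

Lemma gras_gens_adjoinQ (i : 'I_3) : K (gras_gens i).
Proof.
case: i => [[|[|[|i]]] lt_i3] //; rewrite /gras_gens /=; try exact: K_O.
by apply/adjoinQP; rewrite rpred_div //; apply/adjoinQP; apply: K_O => //; apply/int_ringM/int_ringX.
Qed.

Lemma gras_gens_exp (i : 'I_3) :
  gras_gens i ^+ r / beta = [:: B * al2 ^+ 2; al0 ^+ r.-1 * al2; al0 ^+ r.-1 * (al0 ^+ r.-1 * B ^+ r.-1)]`_i.
Proof.
have expS (y : algC) : y ^+ r = y * y ^+ r.-1 by rewrite -exprS prednK.
case: i => [[|[|[|i]]] lt_i3] //; rewrite /gras_gens /= gras_beta_alpha.
- by rewrite -gras_alpha_norm; field; rewrite nz_al0 nz_al2.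
- by rewrite expS; field; rewrite nz_al0 nz_al2.
have -> : g2 ^+ r = al0 ^+ r * (al0 * B) ^+ r.-1 * al2 ^+ r.-1 / al2 ^+ r.
  have zr : (zC ^+ r.-1) ^+ r = (al0 * B) ^+ r.-1 * al2 ^+ r.-1.
    rewrite -exprM mulnC exprM -gras_alpha_norm -[in RHS]exprMn.
    by congr (_ ^+ _); ring.
  by rewrite expr_div_n exprMn zr mulrA.
rewrite !expS -exprMn; have nz2a : al2 ^+ r.-1 != 0 by rewrite expf_neq0.
by move: (al2 ^+ r.-1) ((al0 * B) ^+ _) (al0 ^+ r.-1) nz2a => X Y Z nzX; field; rewrite nz_al0 nz_al2 nzX.
Qed.

(** The last two quotients generate [al0^(r-1)], since [al2] is comaximal with [al0^(r-1) B^(r-1)];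
    and [al0^(r-1)] is comaximal with the first, [B al2^2]. *)
Lemma gras_gens_span : exists u : 'I_3 -> algC, (forall i, O (u i)) /\
  \sum_i u i * (gras_gens i ^+ r / beta) = 1.
Proof.
have OB : O B by apply: int_ringM.
have OX y m : O y -> O (y ^+ m) by apply: int_ringX.
have c1 : comaximal rho (al0 ^+ r.-1) (B * al2 ^+ 2).
  apply: comaximal_sym; apply: comaximalX => //; first by apply: int_ringM => //; apply: OX.
  apply: comaximal_sym; apply: comaximalM => //; first exact: OX.
    exact: gras_alpha0B_comaximal.
  by apply: comaximalX => //; apply: gras_alpha02_comaximal.
have c2 : comaximal rho al2 (al0 ^+ r.-1 * B ^+ r.-1).
  apply: comaximalM; try exact: OX; rewrite //.
    by apply: comaximalX => //; apply/comaximal_sym/gras_alpha02_comaximal.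
  by apply: comaximalX => //; apply: gras_alpha2B_comaximal.
have [q [p [Oq Op pq1]]] := c1; have [p' [q' [Op' Oq' pq1']]] := c2.
exists (fun i => [:: p; q * p'; q * q']`_i); split.
  by case=> [[|[|[|i]]] lt_i3] //=; apply: int_ringM.
rewrite !big_ord_recl big_ord0 !gras_gens_exp /= addr0.
by rewrite -[RHS]pq1 -[q in RHS]mulr1 -{1}pq1'; ring.
Qed.

Variables (omega : algC).
Hypothesis omega_r : omega ^+ r = beta.

Let nz_beta : beta != 0. Proof. by rewrite gras_beta_alpha mulf_neq0 ?invr_neq0. Qed.
Let K_beta : K beta. Proof. by apply/adjoinQP; apply: gras_beta_adjoinQ. Qed.

Lemma gras_gens_int (i : 'I_3) : gras_gens i ^+ r / beta \in Aint.
Proof.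
have ZO y : O y -> y \in Aint by case.
rewrite gras_gens_exp; case: i => [[|[|[|i]]] lt_i3] //=; apply: ZO.
- by apply: int_ringM; [apply: int_ringM | apply: int_ringX].
- by apply: int_ringM => //; apply: int_ringX.
by apply: int_ringM; [|apply: int_ringM]; apply: int_ringX => //; apply: int_ringM.
Qed.

Local Notation I := (root_ideal rho omega).

Lemma gras_ideal_fractional : fractional_ideal K I.
Proof.
have [u [Ou u1]] := gras_gens_span.
apply: (root_ideal_fractional r_gt0 nz_beta omega_r gras_gens_adjoinQ gras_gens_int u1 Oal2 nz_al2).
rewrite gras_beta_alpha -(prednK r_gt0) exprS.
have -> : al2 * al2 ^+ r.-1 * (al0 / al2) = al2 ^+ r.-1 * al0 by field.
by have [] : O (al2 ^+ r.-1 * al0) by apply: int_ringM => //; apply: int_ringX.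
Qed.

Lemma gras_ideal_exp : class_exp K (ideal_class K I) r = class_one K.
Proof.
have [u [Ou u1]] := gras_gens_span.
exact: (root_ideal_class_exp r_gt0 K_beta nz_beta omega_r gras_gens_adjoinQ gras_gens_int Ou u1).
Qed.

Hypothesis z_obstructions :
  forall p a b e, prime p -> (p %| r)%N -> (a < p)%N -> (b < p)%N -> (e < p)%N ->
    (0 < b)%N || (0 < e)%N ->
  exists q, [/\ prime q, (q %| z)%N & let V : 'F_q := v%:R in
    [/\ 2 != 0 :> 'F_q, V != 0, V ^+ 4 != 1 & power_obstruction p a b e V]].

Lemma gras_ideal_exp_neq (m : nat) : (0 < m < r)%N ->
  class_exp K (ideal_class K I) m <> class_one K.
Proof.
move=> m_r; have /andP[m_gt0 _] := m_r; have [u [Ou u1]] := gras_gens_span.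
move/(root_ideal_trivial_power r_gt0 nz_beta omega_r gras_gens_adjoinQ gras_gens_int Ou u1 m_gt0).
move=> [a [/adjoinQP Ka nz_a Zxi Zxi1]].
have [p [p_pr p_r lt_log]] := exists_prime_logn_lt r_gt0 m_r.
have p_gt0 := prime_gt0 p_pr; have p_odd : odd p := dvdn_odd p_r r_odd.
pose j := logn p m; have pj_gt0 : (0 < p ^ j)%N by rewrite expn_gt0 p_gt0.
have [m1 co_pm1 def_m] := pfactor_coprime p_pr m_gt0.
have /dvdnP[r1 def_r] : (p ^ j.+1 %| r)%N by rewrite pfactor_dvdn.
(* As [p^(j+1)] divides [r], a [p^j]-th root of [beta^m / a^r] exists inside [K]; being a root of a
   unit, [xi] is a unit. *)
pose d := a ^+ r1; pose xi := beta ^+ m1 / d ^+ p.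
have Kd : d \in adjoinQ_pred rho by rewrite rpredX.
have nz_d : d != 0 by rewrite expf_neq0.
have xi_pj : xi ^+ (p ^ j) = beta ^+ m / a ^+ r.
  rewrite expr_div_n -exprM -def_m /d -!exprM; congr (_ / _ ^+ _).
  by rewrite def_r expnS; ring.
have Zxi0 : xi \in Aint by apply: (Aint_exp pj_gt0); rewrite xi_pj.
have Zxi0' : xi^-1 \in Aint by apply: (Aint_exp pj_gt0); rewrite exprVn xi_pj.
have Kbeta : beta \in adjoinQ_pred rho by apply/adjoinQP.
have Kxi : xi \in adjoinQ_pred rho by rewrite rpred_div ?rpredX.
have nz_xi : xi != 0 by rewrite mulf_neq0 ?invr_neq0 ?expf_neq0.
have xiE : beta ^+ m1 = xi * d ^+ p by rewrite divfK // expf_neq0.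
clearbody xi d.
have nu4 := nu4_adjoinQ root_rho nu_rho.
have Kn2 y : y \in adjoinQ_pred rho -> nu (nu y) \in adjoinQ_pred rho.
  by move=> Ky; rewrite !(nu_adjoinQ nu_rho).
have nu_beta : nu (nu beta) = beta^-1.
  by rewrite gras_beta_alpha !(fmorph_div nu) nu4_al0 invf_div.
(* Dividing by the image under [nu^2] turns the unit into one of relative norm [1]. As [nu^2]
   inverts [beta], the exponent [m1] becomes [2 m1], still prime to the odd [p]. *)
have U : relative_unit rho nu (xi / nu (nu xi)).
  split.
  - by rewrite mulf_neq0 ?invr_neq0 ?fmorph_eq0.
  - exact/rpred_div/Kn2.
  - by rewrite rpredM // -!(fmorphV nu) !Aint_aut.
  - by rewrite invf_div rpredM // !Aint_aut.
  by rewrite !(fmorph_div nu) nu4 // invf_div.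
have p'2m1 : ~~ (p %| 2 * m1)%N.
  rewrite Euclid_dvdM // negb_or -!prime_coprime // co_pm1 andbT.
  by rewrite coprime_sym coprime2n.
have Kd2 : d / nu (nu d) \in adjoinQ_pred rho by apply/rpred_div/Kn2.
apply: (gras_beta_power_neq n_ok root_rho nu_rho r_odd _ v_gt1 n_vz z_obstructions p_pr p_r p'2m1 U Kd2).
  by rewrite z_h.
have nxiE : beta ^- m1 = nu (nu xi) * nu (nu d) ^+ p.
  by rewrite -exprVn -nu_beta -!(rmorphXn nu) xiE !(rmorphM nu) !(rmorphXn nu).
rewrite mul2n -addnn exprD -[X in _ * X]invrK nxiE xiE expr_div_n.
by rewrite mulf_div.
Qed.

Local Notation k := (adjoinQ (sqrtC (n%:~R ^+ 2 + 16) : algC)).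

(* The relative norm of [al0] is [A = al0 al2].  Modulo [A], that of [zC + g2] is
   the unit [B (al0 + al2)^2] plus a multiple of [zC], which is nilpotent. *)
Lemma gras_norms_comaximal : exists a1 a2 w1 w2,
  [/\ I a1, I a2, O w1 /\ nu (nu w1) = w1, O w2 /\ nu (nu w2) = w2 &
    w1 * (a1 * nu (nu a1)) + w2 * (a2 * nu (nu a2)) = 1].
Proof.
have O0 : O 0 := int_ring_int rho 0.
have Ig i : I (gras_gens i) := root_idealP r_gt0 omega_r (gras_gens_adjoinQ i) (gras_gens_int i).
have nu_al2 : nu (nu al2) = al0 := nu4_al0.
pose o2 : 'I_3 := @Ordinal 3 2 isT; pose o1 : 'I_3 := @Ordinal 3 1 isT; pose o0 : 'I_3 := @Ordinal 3 0 isT.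
have Ig2 : I g2 := Ig o2; have Ig1 : I al0 := Ig o1; have Ig0 : I zC := Ig o0.
have nu_g2 : nu (nu g2) = al2 * zC ^+ r.-1 / al0.
  by rewrite !(fmorph_div nu) !(rmorphM nu) !(rmorphXn nu) !rmorph_nat nu_al2.
(* For [r = 1] the factor [z^(r-1)] is not a multiple of [z], but then [g2] is [beta] and has
   relative norm [1]. *)
have [r1|r_gt1] := eqVneq r 1%N.
  exists g2, g2, 1, 0; split=> //; try by split=> //; rewrite ?rmorph0 ?rmorph1.
  by rewrite nu_g2 r1 /= expr0 !mulr1 mul0r addr0; field; rewrite nz_al0 nz_al2.
pose A := al0 * al2; pose T := al0 + al2; pose U := B * (T ^+ 2 - 2 * A).
have r_gt2 : (2 < r)%N by case: (r) r_odd r_gt1 => [|[|[|]]].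
(* The norm of [zC + g2] is [z^2 + z^(2r-2) + B (al0^2 + al2^2)]: here [z t] is the first two terms
   and [U] the last. *)
pose t := zC * (1 + zC ^+ (2 * r).-2.-2); pose N2 := U + zC * t.
have O2 : O 2 := int_ring_int rho 2.
have OA : O A by apply: int_ringM.
have OB : O B by apply: int_ringM.
have OT : O T by apply: int_ringD.
have OU : O U by apply: int_ringM => //; apply: int_ringD; [apply: int_ringX | apply/int_ringN/int_ringM].
have Ot : O t by apply: int_ringM => //; apply: int_ringD => //; apply: int_ringX.
have AT : comaximal rho A T.
  apply: comaximal_sym; apply: comaximalM => //.
    apply: comaximal_sym; rewrite /T addrC -[X in _ + X]mulr1; apply: comaximalDl => //.
    exact: gras_alpha02_comaximal.
  apply: comaximal_sym; rewrite /T -[X in _ + X]mulr1; apply: comaximalDl => //.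
  exact/comaximal_sym/gras_alpha02_comaximal.
have AU : comaximal rho A U.
  apply: comaximalM => //.
  - by apply: int_ringD; [apply: int_ringX | apply/int_ringN/int_ringM].
  - apply: comaximal_sym; apply: comaximalM => //; apply: comaximal_sym; [exact: gras_alpha0B_comaximal | exact: gras_alpha2B_comaximal].
  have -> : T ^+ 2 - 2 * A = T ^+ 2 + A * - 2 by ring.
  by apply: comaximalDl; [exact: int_ringN | exact: comaximalX].
have AN2 : comaximal rho A N2.
  apply: (@comaximal_nilpotent rho A U zC t B r) => //.
  by rewrite -gras_alpha_norm /A; ring.
have nuA : nu (nu A) = A by rewrite !(rmorphM nu) nu_al2 mulrC.
have nuT : nu (nu T) = T by rewrite /T (rmorphD nu al0) (rmorphD nu al1) nu4_al0 addrC.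
have nuB : nu (nu B) = B by rewrite !(rmorphM nu) nu4_al0 mulrC.
have fixD y1 y2 : nu (nu y1) = y1 -> nu (nu y2) = y2 -> nu (nu (y1 + y2)) = y1 + y2.
  by move=> e1 e2; rewrite !rmorphD e1 e2.
have fixM y1 y2 : nu (nu y1) = y1 -> nu (nu y2) = y2 -> nu (nu (y1 * y2)) = y1 * y2.
  by move=> e1 e2; rewrite !rmorphM e1 e2.
have fixN y : nu (nu y) = y -> nu (nu (- y)) = - y by move=> e; rewrite !rmorphN e.
have fix_nat (i : nat) : nu (nu i%:R) = i%:R by rewrite !rmorph_nat.
have nuN2 : nu (nu N2) = N2.
  have fixt : nu (nu t) = t.
    by apply: (fixM) => //; apply: fixD; rewrite ?rmorph1 // !rmorphXn fix_nat.
  apply: (fixD); apply: (fixM) => //; apply: fixD; first by rewrite expr2; apply: fixM.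
  by apply: fixN; apply: fixM.
have a2E : (zC + g2) * nu (nu (zC + g2)) = N2.
  rewrite !(rmorphD nu zC) !(rmorphD nu (nu zC)) !rmorph_nat nu_g2 /N2 /U /t.
  have -> : zC * (zC * (1 + zC ^+ (2 * r).-2.-2)) = zC ^+ 2 + zC ^+ r.-1 * zC ^+ r.-1.
    have e : (2 + (2 * r).-2.-2 = r.-1 + r.-1)%N by clear -r_gt2; lia.
    by rewrite mulrA -expr2 mulrDr mulr1 -!exprD e.
  have zrE : zC * zC ^+ r.-1 = A * B.
    by rewrite -exprS prednK // -gras_alpha_norm /A; ring.
  have -> : (zC + g2) * (zC + al2 * zC ^+ r.-1 / al0) =
      zC ^+ 2 + zC ^+ r.-1 * zC ^+ r.-1 + zC * zC ^+ r.-1 * (al2 / al0 + al0 / al2).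
    by field; rewrite nz_al0 nz_al2.
  by rewrite zrE /A /T; field; rewrite nz_al0 nz_al2.
have [u [w [Ou Ow uw1]]] := AN2.
have ON2 : O N2 by apply: int_ringD => //; apply: int_ringM.
have nu4 y : O y -> nu (nu (nu (nu y))) = y.
  by case/int_ringP=> Ky _; apply: (nu4_adjoinQ root_rho nu_rho).
have On2 y : O y -> O (nu (nu y)) by move=> Oy; apply/int_ring_nu/int_ring_nu.
(* Multiplying the relation [u A + w N2 = 1] by its image under [nu^2] and collecting terms gives
   coefficients fixed by [nu^2], that is, in the quadratic subfield. *)
exists al0, (zC + g2), (A * (u * nu (nu u)) + N2 * (u * nu (nu w) + nu (nu u) * w)),
  (N2 * (w * nu (nu w))); split=> //.
- case: Ig0 => /adjoinQP K0 Z0; case: Ig2 => /adjoinQP K2' Z2; split; last by rewrite mulrDl rpredD.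
  by apply/adjoinQP/rpredD.
- split.
    by apply: int_ringD; apply: int_ringM => //; [|apply: int_ringD]; apply: int_ringM => //; apply: On2.
  apply: fixD; apply: (fixM) => //; first by rewrite !(rmorphM nu) nu4 // mulrC.
  by rewrite !(rmorphD nu) !(rmorphM nu) !nu4 //; ring.
- split; first by apply: int_ringM => //; apply: int_ringM => //; apply: On2.
  by apply: fixM => //; rewrite !(rmorphM nu) nu4 // mulrC.
rewrite a2E -/A; transitivity ((u * A + w * N2) * nu (nu (u * A + w * N2))).
  have -> : nu (nu (u * A + w * N2)) = nu (nu u) * A + nu (nu w) * N2.
    by rewrite -{2}nuA -{2}nuN2 -!(rmorphM nu) -!(rmorphD nu).
  by ring.
by rewrite uw1 mul1r !rmorph1.
Qed.

(** The norm ideal is the whole ring: [beta] has relative norm [1], so norms of elements of [I] are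
    integral, and two of them are comaximal over the quadratic subfield. *)
Lemma gras_ideal_relative : relative_class K k (ideal_class K I).
Proof.
exists I; split=> //; first exact: gras_ideal_fractional.
have [a1 [a2 [w1 [w2 [Ia1 Ia2 [Ow1 nuw1] [Ow2 nuw2] w12]]]]] := gras_norms_comaximal.
have kP := quadratic_adjoinQP n_ok root_rho nu_rho.
have ok y : O y -> nu (nu y) = y -> int_ring k y.
  by move=> /int_ringP[Ky Zy] nuy; split=> //; apply/kP.
exists 1; split; [by have [] := int_ring1 (sqrtC (n%:~R ^+ 2 + 16) : algC) | exact: oner_neq0 |].
rewrite scale_set1; apply/seteqP; split=> [_ [m [c [b [Oc Nb ->]]]]|y Oy].
  apply: int_ring_sum => i; apply: int_ringM => //.
  have [a Ia Na] := Nb i; have [Ka _] := Ia.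
  rewrite (is_normE n_ok root_rho nu_rho Ka Na); apply: ok; last first.
    have /adjoinQP Ka' := Ka.
    by rewrite !(rmorphM nu) (nu4_adjoinQ root_rho nu_rho Ka') mulrC.
  have /adjoinQP Ka' := Ka.
  apply/int_ringP; split; first by rewrite rpredM // !(nu_adjoinQ nu_rho).
  apply: (Aint_exp r_gt0).
  have Zar := root_ideal_exp omega_r Ia.
  have -> : (a * nu (nu a)) ^+ r = (a ^+ r / beta) * nu (nu (a ^+ r / beta)).
    have nu_beta : nu (nu beta) = beta^-1.
      by rewrite gras_beta_alpha !(fmorph_div nu) nu4_al0 invf_div.
    rewrite (fmorph_div nu (a ^+ r)) (fmorph_div nu (nu (a ^+ r))) !(rmorphXn nu) nu_beta.
    by rewrite exprMn; field.
  by rewrite rpredM // !Aint_aut.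
have [kw1 kw2] := (ok _ Ow1 nuw1, ok _ Ow2 nuw2).
exists 2%N, (fun i : 'I_2 => y * [:: w1; w2]`_i), (fun i : 'I_2 => [:: a1 * nu (nu a1); a2 * nu (nu a2)]`_i).
split.
- by case=> [[|[|i]] lt_i2] //=; apply: int_ringM.
- case=> [[|[|i]] lt_i2] //=.
    by exists a1 => //; apply: is_norm_nu => //; case: Ia1.
  by exists a2 => //; apply: is_norm_nu => //; case: Ia2.
by rewrite !big_ord_recl big_ord0 /= addr0 -!mulrA -mulrDr w12 mulr1.
Qed.

End GrasIdeal.

(** * Infinitely many fields *)

Lemma gras_root_exists (n : int) : exists rho : algC, root (map_poly intr (gras_poly n)) rho.
Proof.
apply/closed_rootP; rewrite size_map_inj_poly ?rmorph0 ?size_gras_poly //.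
exact: intr_inj.
Qed.

(** Neither square root is rational, so the generator [nu] negates both; their product is fixed,
    hence rational, and it is integral. *)
Lemma gras_field_disc_square (n n' : int) (K : set algC) :
  gras_field n K -> gras_field n' K ->
  exists m : int, m ^+ 2 = (n ^+ 2 + 16) * (n' ^+ 2 + 16).
Proof.
move=> [n_ok [rho root_rho KE]] [n'_ok [rho' root_rho' KE']].
have [nu nu_rho] := gras_aut n_ok root_rho.
pose d : algC := sqrtC (n%:~R ^+ 2 + 16); pose d' : algC := sqrtC (n'%:~R ^+ 2 + 16).
have Kd : d \in adjoinQ_pred rho := adjoinQ_sqrtD root_rho.
have Kd' : d' \in adjoinQ_pred rho.
  by apply/adjoinQP; rewrite -KE KE'; apply/adjoinQP; apply: adjoinQ_sqrtD.
have nud : nu d = - d := nu_sqrtD root_rho nu_rho.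
have d'2 : d' ^+ 2 = n'%:~R ^+ 2 + 16 by rewrite sqrtCK.
have nud' : nu d' = - d'.
  have /eqP : nu d' ^+ 2 = d' ^+ 2.
    by rewrite -rmorphXn /= d'2 rmorphD rmorphXn /= rmorph_int rmorph_nat.
  rewrite eqf_sqr => /orP[/eqP nud'|/eqP //].
  have Qd' := fixed_adjoinQ_rat n_ok root_rho nu_rho Kd' nud'.
  by have := gras_nonsquare n'_ok root_rho' Qd'; rewrite d'2 eqxx.
have Qdd : d * d' \in Crat.
  apply: (fixed_adjoinQ_rat n_ok root_rho nu_rho); first exact: rpredM.
  by rewrite rmorphM /= nud nud' mulrNN.
have dd2 : (d * d') ^+ 2 = ((n ^+ 2 + 16) * (n' ^+ 2 + 16))%:~R.
  by rewrite exprMn d'2 sqrtCK !(rmorphM, rmorphD, rmorphXn, rmorph_nat).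
have /intrP[m def_m] : d * d' \in Num.int.
  by rewrite Cint_rat_Aint // (@Aint_exp _ 2) // dd2 Aint_int.
exists m; apply: (@intr_inj algC).
by rewrite -dd2 def_m rmorphXn.
Qed.

Lemma gras_field_common_multiple (s : seq (set algC)) :
  (forall K, K \in s -> gras_family K) ->
  exists M : nat, (0 < M)%N /\
    forall K, K \in s -> exists2 n : int, gras_field n K & (n ^+ 2 + 16 %| M%:Z)%Z.
Proof.
elim: s => [|K s IHs] famKs; first by exists 1%N.
have [|M [M_gt0 M_s]] := IHs; first by move=> K' sK'; apply: famKs; rewrite inE sK' orbT.
have [n nK] := famKs K (mem_head _ _).
exists (absz (n ^+ 2 + 16)%R * M)%N; split.
  by rewrite muln_gt0 M_gt0 andbT absz_gt0 gt_eqF // ltr_wpDl // sqr_ge0.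
move=> K'; rewrite inE => /orP[/eqP->|/M_s[n' n'K' n'M]].
  by exists n => //; rewrite PoszM dvdz_mulr // dvdzE.
by exists n' => //; rewrite PoszM dvdz_mull.
Qed.

Definition has_relative_class (r : nat) : set (set algC) :=
  [set K : set algC | gras_family K /\
    exists (k2 : set algC) (C : set (set algC)),
      [/\ quadratic_subfield K k2, class_group K C,
          relative_class K k2 C & class_has_order K C r]].

Lemma exists_new_gras_field (r M : nat) : odd r -> (0 < M)%N ->
  exists K, has_relative_class r K /\
    forall n : int, gras_field n K -> ~~ (n ^+ 2 + 16 %| M%:Z)%Z.
Proof.
move=> r_odd M_gt0; have r_gt0 : (0 < r)%N by case: r r_odd.
(* The factor [5] keeps [n] admissible: for [n] in [{0, 3, -3}], [n^2 + 16] is [16] or [25], which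
   [l] does not divide. *)
have M5_gt0 : (0 < 5 * M)%N by rewrite muln_gt0.
have [n [v [z [h [l [[v_gt1 v_odd z_h] n_vz [l_pr co_l l_n l2_n] obs]]]]]] :=
  exists_parameters r_odd M5_gt0.
have [co_l2 co_l5 co_lM] : [/\ coprime l 2, coprime l 5 & coprime l M].
  by move: co_l; rewrite !coprimeMr => /and3P[].
have n_ok : n \notin [:: 0; 3; -3].
  apply: contraL l_n; rewrite !inE => /or3P[] /eqP->.
  - by rewrite dvdzE /= -[(_ %| _)%N]/(l %| 2 ^ 4)%N -prime_coprime // coprimeXr.
  - by rewrite dvdzE /= -[(_ %| _)%N]/(l %| 5 ^ 2)%N -prime_coprime // coprimeXr.
  - by rewrite dvdzE /= -[(_ %| _)%N]/(l %| 5 ^ 2)%N -prime_coprime // coprimeXr.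
have [rho root_rho] := gras_root_exists n.
have [nu nu_rho] := gras_aut n_ok root_rho.
have nK : gras_field n (adjoinQ rho) by split=> //; exists rho.
exists (adjoinQ rho); split; last first.
  (* The product of the two discriminants is a square divisible by [l], hence by [l^2]; since [l] is
     prime to [n'^2 + 16], all of [l^2] would divide [n^2 + 16]. *)
  move=> n' n'K; apply: contra l2_n => n'_M.
  have [m m2] := gras_field_disc_square nK n'K.
  have l'n' : ~~ (l %| n' ^+ 2 + 16)%Z.
    apply: contraL co_lM => l_n'; rewrite prime_coprime // negbK.
    by have := dvdz_trans l_n' n'_M; rewrite dvdzE.
  have co_ln' : coprimez (l ^ 2)%N%:Z (n' ^+ 2 + 16).
    by rewrite coprimezE /= coprimeXl // prime_coprime //; move: l'n'; rewrite dvdzE.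
  rewrite -(Gauss_dvdzl _ co_ln') -m2 dvdzE abszX dvdn_exp2r //.
  have : (l %| m ^+ 2)%Z by rewrite m2 dvdz_mulr.
  by rewrite dvdzE abszX /= Euclid_dvdX // andbT.
split; first by exists n.
pose omega : algC := r.-root (gras_beta rho v).
have omega_r : omega ^+ r = gras_beta rho v by rewrite rootCK.
exists (adjoinQ (sqrtC (n%:~R ^+ 2 + 16) : algC)), (ideal_class (adjoinQ rho) (root_ideal rho omega)).
split.
- by exists n.
- exists (root_ideal rho omega) => //.
  exact: (gras_ideal_fractional n_ok root_rho nu_rho r_odd v_odd v_gt1 z_h n_vz omega_r).
- exact: (gras_ideal_relative n_ok root_rho nu_rho r_odd v_odd v_gt1 z_h n_vz omega_r).
split=> //.
  exact: (gras_ideal_exp n_ok root_rho nu_rho r_odd v_odd v_gt1 z_h n_vz omega_r).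
move=> m m_r.
exact: (gras_ideal_exp_neq n_ok root_rho nu_rho r_odd v_odd v_gt1 z_h n_vz omega_r obs m_r).
Qed.

Local Close Scope ring_scope.

Theorem theorem3p1 (r : nat) (hr : (0 < r)%N) (hodd : odd r) :
  infinite_set
    [set K : set algC | gras_family K /\
       exists (k2 : set algC) (C : set (set algC)),
         [/\ quadratic_subfield K k2, class_group K C,
             relative_class K k2 C & class_has_order K C r]].
Proof.
rewrite -/(has_relative_class r) => /finite_seqP[s sE].
have [K sK|M [M_gt0 sM]] := @gras_field_common_multiple s.
  by have : has_relative_class r K; [rewrite sE; exact: sK|case].
have [K [rK newK]] := exists_new_gras_field hodd M_gt0.
have [|n nK n_M] := sM K; first by move: rK; rewrite sE.
by have := newK n nK; rewrite n_M.
Qed.
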